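(* Let $d_{\mathrm{in}},d_{\mathrm{out}}\in\mathbb N$, let $\nu$ be a finite (Borel) measure on $\mathbb R^{d_{\mathrm{in}}}$, let $m\ge0$ be an integer, $p\in[1,\infty)$, and let $g\in C^{m,p}_\nu(\mathbb R^{d_{\mathrm{in}}},\mathbb R^{d_{\mathrm{out}}})$. Let $\psi\in\mathcal A_b^\infty$ and let $d_L\ge2$ be an integer. Then for every $\epsilon>0$ there exists a $d_L$-layered neural network $\varphi_{\psi,\theta}:\mathbb R^{d_{\mathrm{in}}}\to\mathbb R^{d_{\mathrm{out}}}$ with activation function $\psi$ such that $$\|g-\varphi_{\psi,\theta}\|_{W^{m,p}(\nu,\mathbb R^{d_{\mathrm{out}}})}\le\epsilon .$$
   Context: For $f\in C^m(\mathbb R^{d_{\mathrm{in}}},\mathbb R^{d_{\mathrm{out}}})$, $\|f\|_{W^{m,p}(\nu,\mathbb R^{d_{\mathrm{out}}})}=\big(\int\|f\|_2^p\,d\nu+\sum_{1\le|\alpha|\le m}\int\|\partial^\alpha f\|_2^p\,d\nu\big)^{1/p}$, where $\alpha$ ranges over multi-indices, $|\alpha|=\sum_i\alpha_i$, $\|\cdot\|_2$ is the Euclidean norm. $C^{m,p}_\nu(\mathbb R^{d_{\mathrm{in}}},\mathbb R^{d_{\mathrm{out}}})$ is the set of $f\in C^m(\mathbb R^{d_{\mathrm{in}}},\mathbb R^{d_{\mathrm{out}}})$ with finite such norm. $\psi\in\mathcal A_b^\infty$ means $\psi\in C^\infty(\mathbb R)$ and: (1) there is $a_-\ge0$ with $|\psi(t)|\le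 a_-$ for $t\le0$; (2) $\psi$ is strictly increasing for $t>0$ and $\psi(t)\to\infty$ as $t\to\infty$; (3) for every integer $k\ge1$ there is $a_k>0$ with $|\psi^{(k)}(t)|\le a_k$ for all $t\in\mathbb R$. A $d_L$-layered neural network with activation $\psi$ and some width $d_W\in\mathbb N$ is a map $x\mapsto\mathbf W_{d_L}z_{d_L-1}+\mathbf b_{d_L}$, where $z_0=x$, $z_j=\psi(\mathbf W_jz_{j-1}+\mathbf b_j)\in\mathbb R^{d_W}$ for $1\le j\le d_L-1$ ($\psi$ applied componentwise), with weights $\mathbf W_1\in\mathbb R^{d_W\times d_{\mathrm{in}}}$, $\mathbf W_j\in\mathbb R^{d_W\times d_W}$ for $2\le j\le d_L-1$, $\mathbf W_{d_L}\in\mathbb R^{d_{\mathrm{out}}\times d_W}$, and biases $\mathbf b_j\in\mathbb R^{d_W}$ ($j\le d_L-1$), $\mathbf b_{d_L}\in\mathbb R^{d_{\mathrm{out}}}$. *)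

(* Defs.v *)
(* R is an arbitrary realType; points of R^n are column vectors 'cV[R]_n. *)
From HB Require Import structures.
From mathcomp Require Export all_boot all_order all_algebra.
From mathcomp Require Export all_classical all_reals all_analysis.

Set Implicit Arguments.
Unset Strict Implicit.
Unset Printing Implicit Defensive.

Export Order.TTheory GRing.Theory Num.Theory.
Export numFieldNormedType.Exports.

#[global] Open Scope classical_set_scope.
#[global] Open Scope ring_scope.

Notation borel_cV R n := (g_sigma_algebraType (@open 'cV[R]_n)).

(* The library norm on 'cV[R]_n is the maximum norm, whence a separate
   Euclidean norm; both induce the same topology. *)
Definition norm2 (R : realType) n (v : 'cV[R]_n) : R :=
  Num.sqrt (\sum_(i < n) v i 0 ^+ 2).

Definition partial (R : realType) (din dout : nat) (i : 'I_din)
    (f : 'cV[R]_din -> 'cV[R]_dout) : 'cV[R]_din -> 'cV[R]_dout :=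
  fun x => 'D_(delta_mx i 0) f x.

(* All iterated partial derivatives of order at most m exist everywhere and are
   continuous. *)
Fixpoint Cm (R : realType) (din dout m : nat)
    (f : 'cV[R]_din -> 'cV[R]_dout) : Prop :=
  continuous f /\
  if m is k.+1 then
    forall i : 'I_din,
      (forall x, derivable f x (delta_mx i 0)) /\ Cm k (partial i f)
  else True.

(* d_0^(a 0) (d_1^(a 1) (... f)); the order of the partial derivatives does
   not matter when f is of class C^|a|. *)
Definition mpartial (R : realType) (din dout : nat) (a : 'I_din -> nat)
    (f : 'cV[R]_din -> 'cV[R]_dout) : 'cV[R]_din -> 'cV[R]_dout :=
  foldr (fun i h => iter (a i) (partial i) h) f (enum 'I_din).

(* Multi-indices a with |a| <= m have all their entries in {0, ..., m}.
   The value is meant for f of class C^m, and is +oo if an integral diverges. *)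
Definition sobolev_norm (R : realType) (din dout : nat)
    (nu : {finite_measure set (borel_cV R din) -> \bar R})
    (m : nat) (p : R) (f : 'cV[R]_din -> 'cV[R]_dout) : \bar R :=
  ((\int[nu]_x (norm2 (f x) `^ p)%:E
    + \sum_(a : {ffun 'I_din -> 'I_m.+1} | (1 <= \sum_i a i <= m)%N)
        \int[nu]_x (norm2 (mpartial (fun i => a i : nat) f x) `^ p)%:E)
   `^ p^-1)%E.

Definition Cmp (R : realType) (din dout : nat)
    (nu : {finite_measure set (borel_cV R din) -> \bar R})
    (m : nat) (p : R) (f : 'cV[R]_din -> 'cV[R]_dout) : Prop :=
  Cm m f /\ (sobolev_norm nu m p f < +oo)%E.

Definition Cinfty (R : realType) (psi : R -> R) : Prop :=
  forall (k : nat) (t : R), derivable (derive1n k psi) t 1.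

Definition Abinfty (R : realType) (psi : R -> R) : Prop :=
  [/\ Cinfty psi,
      exists2 a : R, 0 <= a & forall t : R, t <= 0 -> `|psi t| <= a,
      (forall s t : R, 0 < s -> s < t -> psi s < psi t)
        /\ psi t @[t --> +oo] --> +oo
    & forall k : nat, (1 <= k)%N ->
        exists2 a : R, 0 < a & forall t : R, `|derive1n k psi t| <= a].

(* Parameters of a network with L >= 2 layers: the layers 2, ..., L - 1 are the
   entries of hidden, in this order. *)
Record nn_params (R : realType) (din dW dout L : nat) := NNParams {
  first_layer : 'M[R]_(dW, din) * 'cV[R]_dW;
  hidden : (L - 2).-tuple ('M[R]_(dW, dW) * 'cV[R]_dW);
  last_layer : 'M[R]_(dout, dW) * 'cV[R]_dout }.

Definition affine (R : realType) (n k : nat) (Wb : 'M[R]_(k, n) * 'cV[R]_k)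
    (z : 'cV[R]_n) : 'cV[R]_k := Wb.1 *m z + Wb.2.

Definition nn (R : realType) (din dW dout L : nat) (psi : R -> R)
    (theta : nn_params R din dW dout L) (x : 'cV[R]_din) : 'cV[R]_dout :=
  let z1 := map_mx psi (affine (first_layer theta) x) in
  let z := foldl (fun z Wb => map_mx psi (affine Wb z)) z1 (hidden theta) in
  affine (last_layer theta) z.

(* Main.v *)
(* Call a function well approximated if for every nondecreasing weight W >= 1 tending to
   infinity and every e > 0 some network is within e * W(|x|) of it, together with all
   derivatives of order at most m; this controls the Sobolev norm because W can be chosen
   with W(|x|)^p integrable.  In one variable this class is closed under pointwise limits
   of functions with uniformly bounded derivatives of all orders.  It contains psi'
   (difference quotients), hence averages of psi^(3) (l t) over dilations l, one of which
   is nonzero and decays like 1 / t^2 with all its derivatives; its periodization is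
   periodic and not constant, and has a nonzero Fourier mode, whence the cosine.  So
   cos (a x + b) is well approximated with one hidden layer, and then with any number of
   them because psi (d0 + c u) is affine in u to first order in c.

   Convolving with the kernels ((1 + cos) / 2)^n in one coordinate after the other, and
   replacing the integrals by Riemann sums, shows that trigonometric polynomials
   approximate a compactly supported C^m function and its derivatives on one period cell.
   When the period grows, the weight absorbs the error outside of the cell.  A cutoff and
   dominated convergence reduce g to the compactly supported case. *)
Require Import Defs.
From mathcomp Require Import measurable_realfun.
From mathcomp Require Import ring lra.

Set Implicit Arguments.
Unset Strict Implicit.
Unset Printing Implicit Defensive.

(** The activation is unbounded and the domain is not compact, so errors are measured against slowly
    growing weights. This notion is stable under dilations and limits and, because a root of a
    weight is again a weight, under composition with psi.

    The third derivative answers two demands. Only psi' and the higher derivatives are bounded, and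
    each of the two integrations by parts in the dilation parameter uses up one derivative, so decay
    like 1 / t^2 is available from order three on. And if the third derivative of the average
    vanished identically, the average would be a quadratic polynomial, bounded on t <= 0 and hence
    constant, although for t > 0 it is at least a positive multiple of psi, which tends to infinity.

    A periodization may be constant even when the function is not zero; a large dilation beforehand
    prevents this. Depth is gained on the cosines because linearizing psi around a point requires a
    function with bounded derivatives. The powers of (1 + cos) / 2 serve as kernel because an exact
    recursion for their mass already gives their concentration at 0. *)

(** * Derivatives and Taylor bounds in one variable *)

Definition is_deriv (R : realType) (f f' : R -> R) : Prop :=
  forall t : R, is_derive t (1 : R) f (f' t).

Lemma derivative_continuous (R : realType) (f f' : R -> R) :
  is_deriv f f' -> continuous f.
Proof.
by move=> df t; apply/differentiable_continuous/derivable1_diffP/ex_derive.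
Qed.

(** No order between [a] and [b] is assumed, and [c] is located through its distance to [a]: this is
    the form that a second application in [taylor_bound] needs. *)
Lemma mean_value (R : realType) (f f' : R -> R) (a b : R) :
  is_deriv f f' ->
  exists2 c, `|c - a| <= `|b - a| & f b - f a = f' c * (b - a).
Proof.
move=> df.
have cf : continuous f := derivative_continuous df.
have [ab|ba] := leP a b.
  have [c] := @MVT_segment R f f' a b ab (fun x _ => df x) (continuous_subspaceT cf).
  rewrite in_itv/= => /andP[ac cb] E; exists c => //.
  by rewrite !ger0_norm ?subr_ge0// lerD2r.
have [c] := @MVT_segment R f f' b a (ltW ba) (fun x _ => df x) (continuous_subspaceT cf).
rewrite in_itv/= => /andP[bc ca] E; exists c; last by rewrite -opprB E; ring.
by rewrite !ler0_norm ?subr_le0// ?(ltW ba)// lerN2 lerD2r.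
Qed.

Lemma derivative_lipschitz (R : realType) (f f' : R -> R) (C a b : R) :
  is_deriv f f' -> (forall t, `|f' t| <= C) ->
  `|f b - f a| <= C * `|b - a|.
Proof.
by move=> df fC; have [c _ ->] := mean_value a b df; rewrite normrM ler_wpM2r.
Qed.

Lemma taylor_bound (R : realType) (f f' f'' : R -> R) (C t h : R) :
  is_deriv f f' -> is_deriv f' f'' ->
  (forall t, `|f'' t| <= C) -> `|f (t + h) - f t - h * f' t| <= C * h ^+ 2.
Proof.
move=> df df' fC; have [c + E] := mean_value t (t + h) df.
rewrite [t + h - t]addrAC subrr add0r => ch.
rewrite E [t + h - t]addrAC subrr add0r mulrC -mulrBr normrM.
rewrite -real_normK ?num_real// expr2 mulrCA ler_wpM2l//.
rewrite (le_trans (derivative_lipschitz t c df' fC))// ler_wpM2l//.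
by rewrite (le_trans _ (fC 0)).
Qed.

(** Unlike differentiability, an inequality with quadratic remainder survives pointwise limits; this
    is how limits are differentiated in [derivative_cvg]. *)
Lemma taylor_is_derive (R : realType) (f : R -> R) (C t v : R) :
  (forall h, `|f (t + h) - f t - h * v| <= C * h ^+ 2) -> is_derive t (1 : R) f v.
Proof.
move=> H.
have C0 : 0 <= C by have := H 1; rewrite expr1n mulr1; apply: le_trans.
suff L : (fun h : R => h^-1 *: ((f \o shift t) (h *: 1) - f t)) @ 0^' --> v.
  by apply: DeriveDef; [apply/cvg_ex; exists v|apply/cvg_lim].
apply/cvgrPdist_le => e e0; near=> h.
have h0 : h != 0 by near: h; exact: nbhs_dnbhs_neq.
rewrite distrC /= [_ *: 1]mulr1 [h + t]addrC.
have -> : h^-1 *: (f (t + h) - f t) - v = h^-1 * (f (t + h) - f t - h * v).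
  by rewrite mulrBr mulKf.
rewrite normrM normfV ler_pdivrMl ?normr_gt0//.
apply: le_trans (H h) _.
rewrite -real_normK ?num_real// expr2 mulrA mulrC ler_wpM2l//.
have : `|h| <= e / (C + 1).
  near: h; apply: dnbhs0_le; rewrite divr_gt0// ltr_wpDl//.
rewrite ler_pdivlMr ?ltr_wpDl// => /(le_trans _); apply.
by rewrite mulrC ler_wpM2l// lerDl.
Unshelve. all: by end_near. Qed.

Lemma is_derivD (R : realType) (f g f' g' : R -> R) : is_deriv f f' -> is_deriv g g' ->
  is_deriv (fun t => f t + g t) (fun t => f' t + g' t).
Proof. by move=> df dg t; apply: (@is_deriveD _ _ _ f g t 1 _ _ (df t) (dg t)). Qed.

Lemma is_derivB (R : realType) (f g f' g' : R -> R) : is_deriv f f' -> is_deriv g g' ->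
  is_deriv (fun t => f t - g t) (fun t => f' t - g' t).
Proof. by move=> df dg t; apply: (@is_deriveB _ _ _ f g t 1 _ _ (df t) (dg t)). Qed.

Lemma is_derivZ (R : realType) (c : R) (f f' : R -> R) : is_deriv f f' ->
  is_deriv (fun t => c * f t) (fun t => c * f' t).
Proof. by move=> df t; apply: (@is_deriveZ _ _ _ f c t 1 _ (df t)). Qed.

Lemma is_derivM (R : realType) (f g f' g' : R -> R) : is_deriv f f' -> is_deriv g g' ->
  is_deriv (fun t => f t * g t) (fun t => f t * g' t + g t * f' t).
Proof. by move=> df dg t; apply: (@is_deriveM _ _ f g t 1 _ _ (df t) (dg t)). Qed.

Lemma is_deriv_comp (R : realType) (f g f' g' : R -> R) : is_deriv f f' -> is_deriv g g' ->
  is_deriv (fun t => f (g t)) (fun t => f' (g t) * g' t).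
Proof. by move=> df dg t; apply: (@is_derive1_comp _ f g t _ _ (df (g t)) (dg t)). Qed.

Lemma is_deriv_cst (R : realType) (c : R) : is_deriv (fun=> c) (fun=> 0).
Proof. by move=> t; apply: is_derive_cst. Qed.

Lemma is_deriv_id (R : realType) : is_deriv (fun t : R => t) (fun=> 1).
Proof. by move=> t; apply: is_derive_id. Qed.

Lemma is_deriv_ext (R : realType) (f f' g g' : R -> R) : is_deriv f f' ->
  f =1 g -> f' =1 g' -> is_deriv g g'.
Proof. by move=> df /funext <- /funext <-. Qed.

Lemma is_deriv_affine (R : realType) (a b : R) (f f' : R -> R) : is_deriv f f' ->
  is_deriv (fun t => f (a * t + b)) (fun t => a * f' (a * t + b)).
Proof.
move=> df; have dl : is_deriv (fun t => a * t + b) (fun=> a).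
  apply: is_deriv_ext (is_derivD (is_derivZ a (@is_deriv_id R)) (is_deriv_cst b)) _ _ => // t.
  by rewrite mulr1 addr0.
by apply: is_deriv_ext (is_deriv_comp df dl) _ _ => // t; rewrite mulrC.
Qed.

Lemma is_deriv_inj (R : realType) (f f' g' : R -> R) :
  is_deriv f f' -> is_deriv f g' -> f' =1 g'.
Proof. by move=> df dg t; rewrite -(@derive_val _ _ _ _ _ _ _ (df t)) (@derive_val _ _ _ _ _ _ _ (dg t)). Qed.

Lemma zero_deriv_cst (R : realType) (f f' : R -> R) a b :
  is_deriv f f' -> (forall t, f' t = 0) -> f a = f b.
Proof.
by move=> df f0; apply: is_derive_0_is_cst => z; rewrite -(f0 z).
Qed.

(** * Antiderivatives and integrals of continuous functions *)

Lemma antiderivative_unique (R : realType) (f F G : R -> R) (a b : R) :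
  is_deriv F f -> is_deriv G f -> F b - F a = G b - G a.
Proof.
move=> dF dG.
have := zero_deriv_cst a b (is_derivB dF dG) (fun t => subrr (f t)).
lra.
Qed.

(** An integral based at [a] is differentiated only to the right of [a]; hence half-lines first,
    glued together in [antiderivative_exists]. *)
Lemma antiderivative_on (R : realType) (f : R -> R) (a : R) : continuous f ->
  exists F : R -> R, forall x, a < x -> is_derive x (1 : R) F (f x).
Proof.
move=> cf; exists (fun x => \int[lebesgue_measure]_(t in `[a, x]) f t)%R => x ax.
have xx : x < x + 1 by rewrite ltrDl.
have fi : (@lebesgue_measure R).-integrable `[a, x + 1] (EFin \o f).
  apply: continuous_compact_integrable; first exact: segment_compact.
  exact: continuous_subspaceT.
have [d1 d2] := continuous_FTC1_closed xx fi ax (cf x).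
by apply: (DeriveDef d1); rewrite -derive1E d2.
Qed.

Lemma antiderivative_on_unique (R : realType) (f F G : R -> R) (a : R) :
  (forall x, a < x -> is_derive x (1 : R) F (f x)) ->
  (forall x, a < x -> is_derive x (1 : R) G (f x)) ->
  forall x y, a < x -> a < y -> F x - F y = G x - G y.
Proof.
move=> dF dG.
suff H x y : a < x -> x <= y -> F x - F y = G x - G y.
  move=> x y ax ay; have [xy|yx] := leP x y; first exact: H.
  by rewrite -opprB (H _ _ ay (ltW yx)) opprB.
move=> ax xy.
have dH z : a < z -> is_derive z (1 : R) (F - G) 0.
  by move=> az; rewrite -(subrr (f z)); apply: is_deriveB; [exact: dF|exact: dG].
have [c _] : exists2 c, c \in `[x, y]%R & (F - G) y - (F - G) x = 0 * (y - x).
  apply: (@MVT_segment R _ (fun=> 0)) => // [z|].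
    by rewrite in_itv/= => /andP[xz _]; apply: dH; exact: lt_trans xz.
  apply: derivable_within_continuous => z; rewrite in_itv/= => /andP[xz _].
  by apply/ex_derive/dH; exact: lt_le_trans xz.
rewrite -![(_ - _ : _ -> _) _]/(_ - _) /=; lra.
Qed.

Lemma antiderivative_exists (R : realType) (f : R -> R) :
  continuous f -> exists F, is_deriv F f.
Proof.
move=> cf.
have [G dG] := choice (fun n : nat => antiderivative_on (- n%:R) cf).
(* [n x] is large enough for 0 and [x] to lie in the same half-line. Normalized at 0, the
   antiderivatives on the half-lines agree wherever two of them are defined. *)
pose n (x : R) := (Num.truncn `|x|).+1.
have nx x : `|x| < (n x)%:R by rewrite /n; exact: truncnS_gt.
pose F x := G (n x) x - G (n x) 0.
have FE N x : `|x| < N%:R -> F x = G N x - G N 0.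
  move=> xN; set M := maxn (n x) N.
  have le k l : (k <= l)%N -> forall z : R, - k%:R < z -> is_derive z (1 : R) (G l) (f z).
    by move=> kl z kz; apply: dG; apply: le_lt_trans kz; rewrite lerN2 ler_nat.
  have E k : (k <= M)%N -> `|x| < k%:R -> G k x - G k 0 = G M x - G M 0.
    move=> kM xk; apply: (@antiderivative_on_unique R f _ _ (- k%:R)) => //.
    - exact: le.
    - by move: xk; rewrite ltr_norml => /andP[].
    - by rewrite oppr_lt0 (le_lt_trans _ xk).
  by rewrite /F !E ?leq_maxl ?leq_maxr.
exists F => x; set N := (n x).+1.
have xN : `|x| < N%:R by rewrite (lt_trans (nx x))// ltr_nat.
have dN : is_derive x (1 : R) (fun y => G N y - G N 0) (f x).
  rewrite -[f x]subr0; apply: is_deriveB.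
  by apply: dG; move: xN; rewrite ltr_norml => /andP[].
apply: near_eq_is_derive dN.
near=> y; apply/esym/FE; near: y.
by apply: (@cvgr_norm_lt _ _ _ (nbhs x) _ id x) => //.
Unshelve. all: by end_near. Qed.

(* The value does not depend on the antiderivative chosen, and is junk when f has none. *)
Definition Int (R : realType) (f : R -> R) (a b : R) : R :=
  let F := xget (fun=> 0) [set F | is_deriv F f] in F b - F a.

Lemma IntE (R : realType) (f F : R -> R) (a b : R) :
  is_deriv F f -> Int f a b = F b - F a.
Proof.
move=> dF; rewrite /Int; apply: (@antiderivative_unique R f _ _ a b _ dF).
by case: xgetP => [G _ //|/(_ F)].
Qed.

Lemma Int_deriv (R : realType) (f : R -> R) (a : R) :
  continuous f -> is_deriv (Int f a) f.
Proof.
move=> /antiderivative_exists[F dF].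
apply: is_deriv_ext (is_derivB dF (is_deriv_cst (F a))) _ _ => t.
  by rewrite (IntE _ _ dF).
by rewrite subr0.
Qed.

Lemma IntD (R : realType) (f g : R -> R) (a b : R) : continuous f -> continuous g ->
  Int (fun t => f t + g t) a b = Int f a b + Int g a b.
Proof.
move=> /antiderivative_exists[F dF] /antiderivative_exists[G dG].
rewrite (IntE _ _ dF) (IntE _ _ dG) (IntE _ _ (is_derivD dF dG)); ring.
Qed.

Lemma IntB (R : realType) (f g : R -> R) (a b : R) : continuous f -> continuous g ->
  Int (fun t => f t - g t) a b = Int f a b - Int g a b.
Proof.
move=> /antiderivative_exists[F dF] /antiderivative_exists[G dG].
rewrite (IntE _ _ dF) (IntE _ _ dG) (IntE _ _ (is_derivB dF dG)); ring.
Qed.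

Lemma IntZ (R : realType) (c : R) (f : R -> R) (a b : R) : continuous f ->
  Int (fun t => c * f t) a b = c * Int f a b.
Proof.
move=> /antiderivative_exists[F dF].
rewrite (IntE _ _ dF) (IntE _ _ (is_derivZ c dF)); ring.
Qed.

Lemma Int_cst (R : realType) (c a b : R) : Int (fun=> c) a b = c * (b - a).
Proof.
have d : is_deriv (fun t => c * t) (fun=> c).
  by apply: is_deriv_ext (is_derivZ c (@is_deriv_id R)) _ _ => // t; rewrite mulr1.
by rewrite (IntE _ _ d) mulrBr.
Qed.

Lemma Int_chasles (R : realType) (f : R -> R) (a b c : R) :
  Int f a c = Int f a b + Int f b c.
Proof. rewrite /Int; lra. Qed.

Lemma Int_affine (R : realType) (f : R -> R) (c d a b : R) : continuous f ->
  c * Int (fun t => f (c * t + d)) a b = Int f (c * a + d) (c * b + d).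
Proof.
move=> /antiderivative_exists[F dF]; rewrite (IntE _ _ dF).
have [->|c0] := eqVneq c 0; first by rewrite !mul0r subrr.
have dG : is_deriv (fun t => c^-1 * F (c * t + d)) (fun t => f (c * t + d)).
  apply: is_deriv_ext (is_derivZ c^-1 (is_deriv_affine c d dF)) _ _ => // t.
  by rewrite mulKf.
by rewrite (IntE _ _ dG) mulrBr !mulVKf.
Qed.

Lemma le_Int (R : realType) (f g : R -> R) (a b : R) : continuous f -> continuous g ->
  a <= b -> (forall t, a <= t <= b -> f t <= g t) -> Int f a b <= Int g a b.
Proof.
move=> /antiderivative_exists[F dF] /antiderivative_exists[G dG] ab fg.
rewrite (IntE _ _ dF) (IntE _ _ dG).
have dH := is_derivB dG dF.
have [c cab] := @MVT_segment R _ _ a b ab (fun x _ => dH x)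
  (continuous_subspaceT (derivative_continuous dH)).
have : 0 <= (g c - f c) * (b - a).
  by rewrite mulr_ge0 ?subr_ge0//; apply: fg; move: cab; rewrite in_itv.
lra.
Qed.

Lemma Int_norm_le (R : realType) (f : R -> R) (C a b : R) : continuous f ->
  a <= b -> (forall t, a <= t <= b -> `|f t| <= C) -> `|Int f a b| <= C * (b - a).
Proof.
move=> cf ab fC.
have cC (c : R) : continuous (fun _ : R => c) by move=> x; exact: cst_continuous.
rewrite ler_norml -mulNr -!Int_cst; apply/andP; split; apply: le_Int => // t /fC;
  by rewrite ler_norml => /andP[].
Qed.

Lemma eq_Int (R : realType) (f g : R -> R) (a b : R) : continuous f -> continuous g ->
  a <= b -> (forall t, a <= t <= b -> f t = g t) -> Int f a b = Int g a b.
Proof.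
by move=> cf cg ab fg; apply/eqP; rewrite eq_le !le_Int// => t /fg ->.
Qed.

Lemma Int_parts (R : realType) (f g f' g' : R -> R) (a b : R) :
  is_deriv f f' -> is_deriv g g' -> continuous f' -> continuous g' ->
  Int (fun t => f t * g' t) a b = f b * g b - f a * g a - Int (fun t => f' t * g t) a b.
Proof.
move=> df dg cf' cg'.
have cf := derivative_continuous df; have cg := derivative_continuous dg.
have c1 : continuous (fun t => f t * g' t) by move=> t; apply: continuousM; [exact: cf|exact: cg'].
have c2 : continuous (fun t => f' t * g t) by move=> t; apply: continuousM; [exact: cf'|exact: cg].
have : Int (fun t => f t * g' t + f' t * g t) a b = f b * g b - f a * g a.
  apply: (@IntE R _ (fun t => f t * g t)).
  by apply: is_deriv_ext (is_derivM df dg) _ _ => // t; rewrite [g t * _]mulrC.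
rewrite IntD//; lra.
Qed.

(** * Riemann sums and uniform continuity *)

(** The modulus of continuity enters as a hypothesis, so that one [n] can serve a whole family of
    integrands in [kernel_sum_riemann]. *)
Lemma riemann_sum_bound (R : realType) (f : R -> R) (a b e : R) (n : nat) :
  continuous f -> a <= b -> (0 < n)%N ->
  (forall s t, a <= s <= b -> a <= t <= b -> `|s - t| <= (b - a) / n%:R -> `|f s - f t| <= e) ->
  `|\sum_(k < n) (b - a) / n%:R * f (a + k%:R * ((b - a) / n%:R)) - Int f a b| <= e * (b - a).
Proof.
move=> cf ab n0 fe; set h := (b - a) / n%:R.
have h0 : 0 <= h by rewrite divr_ge0 ?subr_ge0.
have nh : n%:R * h = b - a by rewrite mulrC divfK// pnatr_eq0 -lt0n.
have S k : Int f a (a + k%:R * h) = \sum_(i < k) Int f (a + i%:R * h) (a + i.+1%:R * h).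
  elim: k => [|k IH]; first by rewrite big_ord0 mul0r addr0 /Int subrr.
  by rewrite big_ord_recr/= -IH -Int_chasles.
have -> : Int f a b = \sum_(i < n) Int f (a + i%:R * h) (a + i.+1%:R * h).
  by rewrite -S nh addrC subrK.
rewrite -sumrB; apply: (le_trans (ler_norm_sum _ _ _)).
have -> : e * (b - a) = \sum_(i < n) e * h.
  by rewrite sumr_const card_ord -mulr_natr -nh; ring.
apply: ler_sum => i _; set s := a + _ * h.
have E : a + i.+1%:R * h = s + h by rewrite /s -natr1; ring.
rewrite E distrC.
have -> : h * f s = Int (fun=> f s) s (s + h) by rewrite Int_cst; ring.
have cc : continuous (fun _ : R => f s) by move=> x; exact: cst_continuous.
rewrite -IntB//; have -> : e * h = e * (s + h - s) by ring.
have sa : a <= s by rewrite lerDl mulr_ge0.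
have sb : s + h <= b.
  by rewrite -E -lerBrDl -nh ler_wpM2r// ler_nat.
apply: Int_norm_le.
- by move=> x; apply: continuousB; [exact: cf|exact: cc].
- by rewrite lerDl.
- move=> t /andP[st th]; apply: fe.
  + by rewrite (le_trans sa)//= (le_trans th).
  + by rewrite sa (le_trans _ sb)// lerDl.
  + by rewrite ger0_norm ?subr_ge0// lerBlDl.
Qed.

Lemma heine (R : realType) (V : normedModType R) (K : set V) (f : V -> R) (e : R) :
  compact K -> continuous f -> 0 < e ->
  exists2 d : R, 0 < d & forall x y, K x -> `|x - y| < d -> `|f x - f y| <= e.
Proof.
move=> /compact_near_coveringP cK cf e0.
have : \forall d \near (0 : R)^'+, K `<=` (fun x => forall y, `|x - y| < d -> `|f x - f y| <= e).
  apply: (cK R (0 : R)^'+ (fun d x => forall y, `|x - y| < d -> `|f x - f y| <= e)) => x Kx.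
  have /cvgrPdist_lt/(_ (e / 2)) := cf x; rewrite divr_gt0// => /(_ isT).
  move=> /nbhs_ballP[r /= r0 br].
  near=> x' d => y xy.
  have bx' : ball x r x'.
    by near: x'; exact: nbhsx_ballx.
  have hb z : ball x r z -> `|f x - f z| < e / 2 by move=> /br.
  have : ball x (r / 2) x' by near: x'; apply: nbhsx_ballx; rewrite divr_gt0.
  rewrite -ball_normE /= => xx'.
  have dr : d < r / 2.
    by near: d; apply: nbhs_right_lt; rewrite divr_gt0.
  have bz : ball x r y.
    rewrite -ball_normE /= (_ : x - y = (x - x') + (x' - y)); last by rewrite addrA subrK.
    have {}xy : `|x' - y| < d by [].
    by rewrite (le_lt_trans (ler_normD _ _))//; lra.
  have h1 := hb _ bz; have h2 := hb _ bx'.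
  rewrite (_ : f x' - f y = (f x - f y) - (f x - f x')); last by ring.
  by rewrite (le_trans (ler_normB _ _))//; lra.
move=> dK; have [d [d0 dP]] := filter_ex (filterI (nbhs_right_gt (0 : R)) dK).
by exists d => // x y Kx; exact: dP.
Unshelve. all: by end_near. Qed.

Lemma heine_itv (R : realType) (f : R -> R) (a b e : R) : continuous f -> 0 < e ->
  exists2 d : R, 0 < d & forall x y, a <= x <= b -> `|x - y| < d -> `|f x - f y| <= e.
Proof.
move=> cf e0; have [d d0 H] := heine (@segment_compact R a b) cf e0.
by exists d => // x y xab; apply: H; rewrite /= in_itv.
Qed.

Lemma riemann_cvg (R : realType) (f : R -> R) (a b : R) : continuous f -> a <= b ->
  \sum_(k < n.+1) (b - a) / n.+1%:R * f (a + k%:R * ((b - a) / n.+1%:R)) @[n --> \oo]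
    --> Int f a b.
Proof.
move=> cf ab; apply/cvgrPdist_le => e e0.
have e'0 : 0 < e / (b - a + 1) by rewrite divr_gt0// ltr_wpDl ?subr_ge0.
have [d d0 H] := heine_itv a b cf e'0.
have d'0 : 0 < d / (b - a + 1) by rewrite divr_gt0// ltr_wpDl ?subr_ge0.
have [N _ HN] := near_infty_natSinv_lt (PosNum d'0).
exists N => // n /= Nn; rewrite distrC.
have := HN n Nn; rewrite /= ltr_pdivlMr ?ltr_wpDl ?subr_ge0// => nd.
apply: le_trans (riemann_sum_bound (e := e / (b - a + 1)) cf ab (ltn0Sn n) _) _.
  move=> s t sab tab st; apply: H => //; apply: le_lt_trans st _.
  apply: le_lt_trans nd; rewrite mulrC ler_wpM2l// ?invr_ge0// lerDl//.
by rewrite mulrAC ler_pdivrMr ?ltr_wpDl ?subr_ge0// [leRHS]mulrDr mulr1 lerDl ltW.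
Qed.

(** * Limits of functions with bounded derivatives *)

Lemma cvg_norm_le (R : realType) (u : nat -> R) (l C : R) :
  u n @[n --> \oo] --> l -> (forall n, `|u n| <= C) -> `|l| <= C.
Proof.
move=> ul uC; have nul : `|u n| @[n --> \oo] --> `|l| by exact: cvg_norm.
apply: (ler_cvg_to nul (cvg_cst C)); exact: nearW.
Qed.

Lemma cvg_dist_le (R : realType) (u : nat -> R) (l e : R) :
  u n @[n --> \oo] --> l -> 0 < e -> \forall n \near \oo, `|u n - l| <= e.
Proof.
by move=> /cvgrPdist_le ul e0; near do rewrite distrC; exact: ul.
Unshelve. all: by end_near. Qed.

(* By Taylor, h (g_n'(t) - g_N'(t)) is within 2 C h^2 of a difference of values of
   g_n - g_N, so the derivatives are Cauchy as well. *)
Lemma derivative_cvg (R : realType) (g g' g'' : nat -> R -> R) (C : R) (f : R -> R) :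
  (forall n, is_deriv (g n) (g' n)) -> (forall n, is_deriv (g' n) (g'' n)) ->
  (forall n t, `|g'' n t| <= C) -> (forall t, g n t @[n --> \oo] --> f t) ->
  exists f' : R -> R, is_deriv f f' /\ forall t, g' n t @[n --> \oo] --> f' t.
Proof.
move=> dg dg' gC gf.
have C0 : 0 <= C by exact: le_trans (gC 0%N 0).
have cv t : cvg (g' n t @[n --> \oo]).
  apply: cauchy_cvg; apply: cauchy_exP => e e0.
  have D0 : 0 < 4 * (C + 1) by rewrite mulr_gt0// ltr_wpDl.
  (* Of the allowed error e h, the two Taylor remainders C h^2 take at most e h / 4 each, and the
     four distances of values to their limits e h / 16 each. *)
  pose h := e / (4 * (C + 1)).
  have h0 : 0 < h by rewrite divr_gt0.
  have eh : e = 4 * (C + 1) * h by rewrite /h mulrC divfK// gt_eqF.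
  have q0 : 0 < e * h / 16 by rewrite divr_gt0// mulr_gt0.
  have [N _ HN] := filterI (cvg_dist_le (gf t) q0) (cvg_dist_le (gf (t + h)) q0).
  exists (g' N t); exists N => // n /= Nn.
  rewrite -ball_normE /=.
  have [a1 a2] := HN n Nn; have [b1 b2] := HN N (leqnn N).
  have := taylor_bound t h (dg n) (dg' n) (gC n).
  have := taylor_bound t h (dg N) (dg' N) (gC N).
  rewrite -(ltr_pM2l h0) -[X in X * `|_|](gtr0_norm h0) -normrM mulrBr.
  set x := h * g' N t; set y := h * g' n t.
  move: a1 a2 b1 b2.
  rewrite !ler_norml ltr_norml => /andP[? ?] /andP[? ?] /andP[? ?] /andP[? ?] /andP[? ?] /andP[? ?].
  have : C * h ^+ 2 <= e * h / 4.
    by rewrite [in leRHS]eh; have := mulr_gt0 h0 h0; nra.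
  have : 0 < e * h by rewrite mulr_gt0.
  move=> ? ?; apply/andP; split; lra.
exists (fun t => lim (g' n t @[n --> \oo])); split=> // t.
apply: (@taylor_is_derive _ _ C) => h.
have L : g n (t + h) - g n t - h * g' n t @[n --> \oo] -->
   f (t + h) - f t - h * lim (g' n t @[n --> \oo]).
  apply: cvgB; first by apply: cvgB; exact: gf.
  by apply: cvgMr; exact: cv.
by apply: cvg_norm_le L _ => n; exact: (taylor_bound _ _ (dg n) (dg' n) (gC n)).
Qed.

(** A smooth function carries all its derivatives as data, so that sums, limits and approximations
    are stated for all orders at once. *)
Definition isjet (R : realType) (u : nat -> R -> R) : Prop :=
  forall k, is_deriv (u k) (u k.+1).

Lemma isjet_unique (R : realType) (u v : nat -> R -> R) :
  isjet u -> isjet v -> u 0%N =1 v 0%N -> forall k, u k =1 v k.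
Proof.
move=> ju jv uv; elim=> [//|k /funext uvk].
by apply: is_deriv_inj (ju k) _; rewrite uvk; exact: jv.
Qed.

(** Order 0 is exempt from the bound because the lemma is applied to averages of the activation
    function, which is unbounded. *)
Lemma jet_limit (R : realType) (u : nat -> nat -> R -> R) (C : nat -> R) (f : R -> R) :
  (forall n, isjet (u n)) -> (forall n k t, (0 < k)%N -> `|u n k t| <= C k) ->
  (forall t, u n 0%N t @[n --> \oo] --> f t) ->
  exists2 v, isjet v & v 0%N = f /\ forall k t, u n k t @[n --> \oo] --> v k t.
Proof.
move=> ju uC uf.
pose P k (g : R -> R) := forall t, u n k t @[n --> \oo] --> g t.
(* The implication under the existential makes the choice total; when [g] is not the limit of order
   [k], any value will do. *)
have step k g : exists g', P k g -> is_deriv g g' /\ P k.+1 g'.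
  have [Pg|nPg] := pselect (P k g); last by exists g.
  have [g' [dg Hg]] := @derivative_cvg R (u ^~ k) (u ^~ k.+1) (u ^~ k.+2) (C k.+2) g
    (fun n => ju n k) (fun n => ju n k.+1) (fun n t => uC n k.+2 t isT) Pg.
  by exists g'.
have [S HS] := choice (fun kg : nat * (R -> R) => step kg.1 kg.2).
pose v := fix v k := if k is j.+1 then S (j, v j) else f.
have Pv k : P k (v k).
  by elim: k => [//|k IH]; exact: (HS (k, v k) IH).2.
by exists v => [k|]; [exact: (HS (k, v k) (Pv k)).1|].
Qed.

(** * Networks of one variable *)

(** The common Lipschitz constant, inherited by the limit, lets convergence at one point control a
    neighbourhood whose radius does not depend on [n]; compactness of the interval does the rest. *)
Lemma lipschitz_cvg_locally_uniform (R : realType) (g : nat -> R -> R) (f : R -> R) (C r e : R) :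
  (forall n s t, `|g n s - g n t| <= C * `|s - t|) ->
  (forall t, g n t @[n --> \oo] --> f t) -> 0 < e ->
  \forall n \near \oo, forall t, `|t| <= r -> `|g n t - f t| <= e.
Proof.
move=> gC gf e0.
have fC s t : `|f s - f t| <= C * `|s - t|.
  by apply: (@cvg_norm_le _ (fun n => g n s - g n t)) => //; exact: cvgB.
have C0 : 0 <= C by have := gC 0%N 1 0; rewrite subr0 normr1 mulr1; exact: le_trans.
have /compact_near_coveringP cK := @segment_compact R (- r) r.
have : \forall n \near \oo, `[- r, r] `<=` (fun t => `|g n t - f t| <= e).
  apply: (cK nat \oo (fun n t => `|g n t - f t| <= e)) => x _.
  have d0 : 0 < e / (4 * (C + 1)) by rewrite divr_gt0// mulr_gt0// ltr_wpDl.
  have e4 : 0 < e / 4 by rewrite divr_gt0.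
  near=> x' n.
  have : `|g n x - f x| <= e / 4 by near: n; exact: cvg_dist_le.
  have : ball x (e / (4 * (C + 1))) x' by near: x'; apply: nbhsx_ballx.
  rewrite -ball_normE /= ltr_pdivlMr ?mulr_gt0 ?ltr_wpDl// => xx' gx.
  have := gC n x x'; have := fC x x'.
  have : C * `|x - x'| <= e / 4 by have := normr_ge0 (x - x'); nra.
  move: gx; set z := C * _; rewrite !ler_norml.
  move=> /andP[? ?] ? /andP[? ?] /andP[? ?]; apply/andP; split; lra.
by apply: filterS => n H t tr; apply: H; rewrite /= in_itv/= -ler_norml.
Unshelve. all: by end_near. Qed.

Definition weight (R : realType) (W : R -> R) : Prop :=
  [/\ forall t, 1 <= W t, {homo W : s t / s <= t} &
      forall M, exists r, forall t, r <= t -> M <= W t].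

(** Turns an error measured at the image of an affine map into one measured at the source: [V] is
    [W] slowed down by the growth of the map. The divisor [A + 1] stays positive when [A] is 0. *)
Lemma weight_affine (R : realType) (W : R -> R) (A B : R) : weight W -> 0 <= A ->
  exists2 V, weight V & forall s t : R, 0 <= t -> s <= A * t + B -> V s <= W t.
Proof.
move=> [W1 Wle Woo] A0; have A1 : 0 < A + 1 by rewrite ltr_wpDl.
exists (fun s => W ((s - B) / (A + 1))).
  split=> [t|s t st|M]; first exact: W1.
    by apply: Wle; rewrite ler_pM2r ?invr_gt0// lerD2r.
  have [r rP] := Woo M; exists (r * (A + 1) + B) => t rt.
  by apply: rP; rewrite ler_pdivlMr// lerBrDr.
by move=> s t t0 st; apply: Wle; rewrite ler_pdivrMr//; nra.
Qed.

(* One-dimensional networks with one hidden layer, with all their derivatives; phi k is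
   the k-th derivative of the activation function. *)
Definition net1 (R : realType) (phi : nat -> R -> R) (s : seq (R * R * R)) (k : nat) (t : R) : R :=
  \sum_(p <- s) p.1.1 * p.1.2 ^+ k * phi k (p.1.2 * t + p.2).

Definition approx1 (R : realType) (m : nat) (phi u : nat -> R -> R) : Prop :=
  forall (W : R -> R) (e : R), weight W -> 0 < e -> exists s, forall k t, (k <= m)%N ->
    `|u k t - net1 phi s k t| <= e * W `|t|.

Lemma approx1_activation (R : realType) (m : nat) (phi : nat -> R -> R) : approx1 m phi phi.
Proof.
move=> W e [W1 _ _] e0; exists [:: (1, 1, 0)] => k t _.
rewrite /net1 big_seq1/= expr1n !mul1r addr0 subrr normr0 mulr_ge0 ?ltW//.
exact: lt_le_trans (W1 _).
Qed.

Lemma approx1_closed (R : realType) (m : nat) (phi u : nat -> R -> R) :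
  (forall (W : R -> R) (e : R), weight W -> 0 < e -> exists2 v, approx1 m phi v &
    forall k t, (k <= m)%N -> `|u k t - v k t| <= e * W `|t|) -> approx1 m phi u.
Proof.
move=> H W e wW e0; have e2 : 0 < e / 2 by rewrite divr_gt0.
have [v av uv] := H W _ wW e2; have [s vs] := av W _ wW e2.
exists s => k t km; have := uv k t km; have := vs k t km.
rewrite (_ : u k t - net1 phi s k t = (u k t - v k t) + (v k t - net1 phi s k t)) => [h1 h2|]; last by ring.
by apply: (le_trans (ler_normD _ _)); lra.
Qed.

Lemma approx1_0 (R : realType) (m : nat) (phi : nat -> R -> R) : approx1 m phi (fun _ _ => 0).
Proof.
move=> W e [W1 _ _] e0; exists [::] => k t _.
rewrite /net1 big_nil subrr normr0 mulr_ge0 ?ltW//.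
exact: lt_le_trans (W1 _).
Qed.

Lemma approx1_add (R : realType) (m : nat) (phi u v : nat -> R -> R) :
  approx1 m phi u -> approx1 m phi v -> approx1 m phi (fun k t => u k t + v k t).
Proof.
move=> au av W e wW e0; have e2 : 0 < e / 2 by rewrite divr_gt0.
have [s us] := au W _ wW e2; have [s' vs] := av W _ wW e2.
exists (s ++ s') => k t km; have := us k t km; have := vs k t km.
rewrite /net1 big_cat/= -/(net1 _ _ _ _) -/(net1 _ _ _ _) opprD addrACA => h1 h2.
by apply: (le_trans (ler_normD _ _)); lra.
Qed.

Lemma approx1_affine (R : realType) (m : nat) (phi u : nat -> R -> R) (c a b : R) :
  approx1 m phi u -> approx1 m phi (fun k t => c * a ^+ k * u k (a * t + b)).
Proof.
move=> au W e wW e0.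
have [V wV VW] := weight_affine `|b| wW (normr_ge0 a).
set K := `|c| * (1 + `|a|) ^+ m.
have K0 : 0 <= K by rewrite mulr_ge0// exprn_ge0// addr_ge0.
have eK : 0 < e / (K + 1) by rewrite divr_gt0// ltr_wpDl.
have [s us] := au V _ wV eK.
exists [seq (c * p.1.1, a * p.1.2, p.1.2 * b + p.2) | p <- s] => k t km.
have -> : net1 phi [seq (c * p.1.1, a * p.1.2, p.1.2 * b + p.2) | p <- s] k t =
    c * a ^+ k * net1 phi s k (a * t + b).
  rewrite /net1 big_map big_distrr/=; apply: eq_bigr => p _.
  rewrite exprMn_comm; last exact: mulrC.
  rewrite (_ : a * p.1.2 * t + (p.1.2 * b + p.2) = p.1.2 * (a * t + b) + p.2); last by ring.
  by ring.
rewrite -mulrBr normrM normrM normrX.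
have V0 : 0 <= W `|t| by case: wW => W1 _ _; apply: le_trans (W1 _).
have h1 : `|a| ^+ k <= (1 + `|a|) ^+ m.
  apply: (@le_trans _ _ ((1 + `|a|) ^+ k)).
    by rewrite lerXn2r ?nnegrE ?addr_ge0// lerDr.
  by rewrite ler_weXn2l// lerDl.
apply: (@le_trans _ _ (K * (e / (K + 1) * W `|t|))).
  apply: ler_pM; rewrite ?mulr_ge0 ?exprn_ge0 ?ler_wpM2l//.
  apply: le_trans (us _ _ km) _; apply: ler_wpM2l; first exact: ltW.
  by apply: VW => //; rewrite (le_trans (ler_normD _ _))// normrM.
rewrite mulrA ler_wpM2r// mulrCA; apply: ler_piMr; first exact: ltW.
by rewrite ler_pdivrMr ?ltr_wpDl// mul1r lerDl.
Qed.

Lemma approx1_sum (R : realType) (m : nat) (phi u : nat -> R -> R) (I : Type) (s : seq I)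
    (c a b : I -> R) : approx1 m phi u ->
  approx1 m phi (fun k t => \sum_(i <- s) c i * a i ^+ k * u k (a i * t + b i)).
Proof.
move=> au; elim: s => [|i s IH].
  rewrite (_ : (fun k t => _) = fun _ _ => 0); first exact: approx1_0.
  by apply/funext => k; apply/funext => t; rewrite big_nil.
rewrite (_ : (fun k t => _) = fun k t => c i * a i ^+ k * u k (a i * t + b i) +
   \sum_(i <- s) c i * a i ^+ k * u k (a i * t + b i)).
  by apply: approx1_add => //; exact: approx1_affine.
by apply/funext => k; apply/funext => t; rewrite big_cons.
Qed.

Lemma isjet_affine (R : realType) (u : nat -> R -> R) (c a b : R) :
  isjet u -> isjet (fun k t => c * a ^+ k * u k (a * t + b)).
Proof.
move=> ju k; apply: is_deriv_ext (is_derivZ (c * a ^+ k) (is_deriv_affine a b (ju k))) _ _ => // t.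
by rewrite exprSr; ring.
Qed.

Lemma isjet_sum (R : realType) (u : nat -> R -> R) (I : Type) (s : seq I) (c a b : I -> R) :
  isjet u -> isjet (fun k t => \sum_(i <- s) c i * a i ^+ k * u k (a i * t + b i)).
Proof.
move=> ju k; elim: s => [|i s IH].
  by apply: is_deriv_ext (@is_deriv_cst R 0) _ _ => t; rewrite big_nil.
apply: is_deriv_ext (is_derivD (isjet_affine (c i) (a i) (b i) ju k) IH) _ _ => t;
  by rewrite big_cons.
Qed.

Lemma isjetB (R : realType) (u v : nat -> R -> R) : isjet u -> isjet v ->
  isjet (fun k t => u k t - v k t).
Proof. by move=> ju jv k; exact: is_derivB. Qed.

Lemma jet_lipschitz (R : realType) (u : nat -> R -> R) (C : nat -> R) k s t : isjet u ->
  (forall k t, `|u k t| <= C k) -> `|u k s - u k t| <= C k.+1 * `|s - t|.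
Proof. by move=> ju uC; apply: derivative_lipschitz (ju k) _. Qed.

(** Where the weight exceeds 2 D / e, the trivial bound of the difference by twice [C k] is good
    enough. What remains is a bounded interval, on which order k converges uniformly because
    [C k.+1] is a common Lipschitz constant. *)
Lemma approx1_limit (R : realType) (m : nat) (phi : nat -> R -> R)
    (u : nat -> nat -> R -> R) (C : nat -> R) (f : R -> R) :
  (forall n, isjet (u n)) -> (forall n k t, `|u n k t| <= C k) ->
  (forall n, approx1 m phi (u n)) -> (forall t, u n 0%N t @[n --> \oo] --> f t) ->
  exists v, [/\ isjet v, v 0%N = f, forall k t, `|v k t| <= C k, approx1 m phi v &
    forall k t, u n k t @[n --> \oo] --> v k t].
Proof.
move=> ju uC au uf.
have [v jv [v0 uv]] := jet_limit ju (fun n k t _ => uC n k t) uf.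
have vC k t : `|v k t| <= C k by exact: cvg_norm_le (uv k t) _.
exists v; split=> //.
apply: approx1_closed => W e wW e0; have [W1 Wle Woo] := wW.
pose D := \sum_(k < m.+1) C k.
have C0 k : 0 <= C k by exact: le_trans (uC 0%N k 0).
have CD k : (k <= m)%N -> C k <= D.
  by move=> km; rewrite /D (bigD1 (Ordinal (km : (k < m.+1)%N)))//= lerDl sumr_ge0.
have [r rP] := Woo (2 * D / e).
have : \forall n \near \oo, forall k : 'I_m.+1, forall t, `|t| <= r -> `|u n k t - v k t| <= e.
  apply: filter_forall => k.
  apply: (lipschitz_cvg_locally_uniform (C := C k.+1)) => //.
  by move=> n s t; exact: jet_lipschitz.
move=> [N _ HN]; exists (u N) => // k t km; rewrite distrC.
have W0 := W1 `|t|.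
have [tr|/ltW rt] := leP `|t| r.
  by rewrite (le_trans (HN N (leqnn N) (Ordinal (km : (k < m.+1)%N)) t tr))// ler_peMr// ltW.
have := rP _ rt; rewrite ler_pdivrMr// mulrC [W _ * _]mulrC => DW.
apply: le_trans DW; apply: (le_trans (ler_normB _ _)).
rewrite mulrC mulr_natl mulr2n.
by rewrite lerD// (le_trans _ (CD k km)).
Qed.

Lemma bounded_multiples_eq0 (R : realType) (x K : R) :
  (forall s, 0 <= s -> `|x| * s <= K) -> x = 0.
Proof.
move=> H; have [//|x0] := eqVneq x 0.
have x1 : 0 < `|x| by rewrite normr_gt0.
have K0 : 0 <= K by have := H 0 (lexx _); rewrite mulr0.
have := H ((K + 1) / `|x|); rewrite divr_ge0 ?addr_ge0// => /(_ isT).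
by rewrite mulrC divfK ?gt_eqF//; lra.
Qed.

(** The mean value theorem bounds the difference quotients of [u] at every order even if [u 0] is
    unbounded, as it is for the activation function, so [approx1_limit] applies to them. *)
Lemma approx1_deriv (R : realType) (m : nat) (phi u : nat -> R -> R) (C : nat -> R) :
  isjet u -> (forall k t, `|u k.+1 t| <= C k) -> approx1 m phi u ->
  approx1 m phi (fun k => u k.+1).
Proof.
move=> ju uC au.
pose h (n : nat) : R := n.+1%:R^-1.
have h0 n : 0 < h n by rewrite invr_gt0.
pose v n k t := (h n)^-1 * 1 ^+ k * u k (1 * t + h n) + - (h n)^-1 * 1 ^+ k * u k (1 * t + 0).
have vE n k t : v n k t = (h n)^-1 * (u k (t + h n) - u k t).
  by rewrite /v expr1n !mulr1 !mul1r addr0 mulNr mulrBr.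
have [||||w [jw w0 _ aw _]] := @approx1_limit R m phi v C (u 1%N).
- by move=> n k; apply: is_derivD; apply: isjet_affine ju k.
- move=> n k t; rewrite vE normrM normfV (gtr0_norm (h0 n)) ler_pdivrMl//.
  have := derivative_lipschitz t (t + h n) (ju k) (uC k).
  by rewrite addrAC subrr add0r (gtr0_norm (h0 n)) mulrC.
- by move=> n; apply: approx1_add; exact: approx1_affine.
- move=> t; apply/cvgrPdist_le => e e0.
  have C0 : 0 <= C 1%N by exact: le_trans (uC 1%N 0).
  have eC : 0 < e / (C 1%N + 1) by rewrite divr_gt0// ltr_wpDl.
  near=> n; rewrite distrC vE.
  have -> : (h n)^-1 * (u 0%N (t + h n) - u 0%N t) - u 1%N t =
     (h n)^-1 * (u 0%N (t + h n) - u 0%N t - h n * u 1%N t).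
    by rewrite [RHS]mulrBr mulKf// gt_eqF.
  rewrite normrM normfV (gtr0_norm (h0 n)) ler_pdivrMl//.
  apply: (le_trans (taylor_bound t (h n) (ju 0%N) (ju 1%N) (uC 1%N))).
  rewrite expr2 mulrCA ler_pM2l//.
  have : h n < e / (C 1%N + 1).
    near: n; apply: (near_infty_natSinv_lt (PosNum eC)).
  rewrite ltr_pdivlMr ?ltr_wpDl// => he; apply: le_trans (ltW he).
  by rewrite mulrC ler_wpM2l ?ltW// ltrDl.
move=> W e wW e0; have [s ws] := aw W e wW e0.
exists s => k t km; rewrite -(isjet_unique (v := fun k => u k.+1) jw _ _ k) ?w0//.
exact: ws.
Unshelve. all: by end_near. Qed.

(** * Averages over dilations *)

Lemma continuous_add (R : realType) (T : topologicalType) (f g : T -> R) :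
  continuous f -> continuous g -> continuous (fun t => f t + g t).
Proof. by move=> cf cg t; apply: cvgD; [exact: cf|exact: cg]. Qed.

Lemma continuous_mul (R : realType) (T : topologicalType) (f g : T -> R) :
  continuous f -> continuous g -> continuous (fun t => f t * g t).
Proof. by move=> cf cg t; apply: cvgM; [exact: cf|exact: cg]. Qed.

Lemma continuous_affine (R : realType) (f : R -> R) (a b : R) : continuous f ->
  continuous (fun t => f (a * t + b)).
Proof.
move=> cf t; apply: (@continuous_comp _ _ _ (fun t => a * t + b) f); last exact: cf.
apply: cvgD; last exact: cvg_cst.
by apply: cvgM; [exact: cvg_cst|exact: cvg_id].
Qed.

Lemma continuous_exp (R : realType) (k : nat) : continuous (fun t : R => t ^+ k).
Proof. by move=> t; exact: exprn_continuous. Qed.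

(** The factor [l ^+ k] comes from the chain rule when order 0 is differentiated k times in [t]
    under the integral sign. *)
Definition dilation_average (R : realType) (q : R -> R) (u : nat -> R -> R) (k : nat) (t : R) : R :=
  Int (fun l => q l * l ^+ k * u k (l * t)) 1 2.

Lemma dilation_average_continuous (R : realType) (q : R -> R) (u : nat -> R -> R) k t :
  isjet u -> continuous q -> continuous (fun l => q l * l ^+ k * u k (l * t)).
Proof.
move=> ju cq; apply: continuous_mul; first by apply: continuous_mul => //; exact: continuous_exp.
rewrite (_ : (fun l : R => u k (l * t)) = (fun l => u k (t * l + 0))).
  exact: continuous_affine (derivative_continuous (ju k)).
by apply/funext => l; rewrite addr0 mulrC.
Qed.

(** Left Riemann sums on [1, 2], written, with a translation by 0, in the format of [isjet_sum] and
    [approx1_sum]. *)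
Definition dilation_sum (R : realType) (q : R -> R) (u : nat -> R -> R) (n k : nat) (t : R) : R :=
  \sum_(i < n.+1) (n.+1%:R^-1 * q (1 + i%:R / n.+1%:R)) * (1 + i%:R / n.+1%:R) ^+ k *
    u k ((1 + i%:R / n.+1%:R) * t + 0).

Lemma dilation_sum_cvg (R : realType) (q : R -> R) (u : nat -> R -> R) k t :
  isjet u -> continuous q ->
  dilation_sum q u n k t @[n --> \oo] --> dilation_average q u k t.
Proof.
move=> ju cq.
have h12 : (1 : R) <= 2 by rewrite ler1n.
have := riemann_cvg (dilation_average_continuous (k := k) (t := t) ju cq) h12.
rewrite (_ : (2 : R) - 1 = 1); last by ring.
rewrite -/(dilation_average q u k t).
rewrite (_ : (fun n => _) = fun n => dilation_sum q u n k t)//.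
apply/funext => n; apply: eq_bigr => i _.
by rewrite addr0 mul1r !mulrA.
Qed.

Lemma dilation_sum_bound (R : realType) (q : R -> R) (u : nat -> R -> R) (M C : R) n k t :
  (forall l, 1 <= l <= 2 -> `|q l| <= M) -> (forall t, `|u k t| <= C) ->
  `|dilation_sum q u n k t| <= M * 2 ^+ k * C.
Proof.
move=> qM uC.
have -> : M * 2 ^+ k * C = \sum_(i < n.+1) n.+1%:R^-1 * (M * 2 ^+ k * C).
  by rewrite sumr_const card_ord -[RHS]mulr_natl mulrA divff ?mul1r// pnatr_eq0.
apply: le_trans (ler_norm_sum _ _ _) _; apply: ler_sum => i _.
have l12 : 1 <= (1 : R) + i%:R / n.+1%:R <= 2.
  rewrite lerDl divr_ge0//= (_ : 2 = 1 + 1)// lerD2l ler_pdivrMr// mul1r ler_nat.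
  exact: ltnW.
rewrite -!mulrA normrM ger0_norm ?invr_ge0//.
apply: ler_wpM2l; first by rewrite invr_ge0.
rewrite !normrM normrX; apply: ler_pM; rewrite ?mulr_ge0 ?exprn_ge0 ?normr_ge0//; first exact: qM.
apply: ler_pM; rewrite ?exprn_ge0 ?normr_ge0//.
rewrite lerXn2r ?nnegrE//; case/andP: l12 => l1 l2.
by rewrite ger0_norm// (le_trans _ l1).
Qed.

(** Differentiation under the integral sign follows from a limit of Riemann sums, whose derivatives
    are bounded independently of the number of nodes. *)
Lemma isjet_dilation_average (R : realType) (q : R -> R) (u : nat -> R -> R) (M : R) (C : nat -> R) :
  isjet u -> continuous q -> (forall l, 1 <= l <= 2 -> `|q l| <= M) ->
  (forall k t, (0 < k)%N -> `|u k t| <= C k) -> isjet (dilation_average q u).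
Proof.
move=> ju cq qM uC.
have [|||v jv [v0 vP]] := @jet_limit R (dilation_sum q u) (fun k => M * 2 ^+ k * C k)
    (dilation_average q u 0).
- by move=> n; exact: isjet_sum.
- by move=> n k t k0; apply: dilation_sum_bound => // s; exact: uC.
- by move=> t; exact: dilation_sum_cvg.
suff -> : dilation_average q u = v by [].
apply/funext => k; apply/funext => t; apply: cvg_unique (vP k t) => //.
exact: dilation_sum_cvg.
Qed.

Lemma approx1_dilation_average (R : realType) (m : nat) (phi : nat -> R -> R) (q : R -> R)
    (u : nat -> R -> R) (M : R) (C : nat -> R) :
  isjet u -> continuous q -> (forall l, 1 <= l <= 2 -> `|q l| <= M) ->
  (forall k t, `|u k t| <= C k) -> approx1 m phi u ->
  approx1 m phi (dilation_average q u) /\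
  forall k t, `|dilation_average q u k t| <= M * 2 ^+ k * C k.
Proof.
move=> ju cq qM uC au.
have [||||v [jv v0 vC av vP]] := @approx1_limit R m phi (dilation_sum q u)
    (fun k => M * 2 ^+ k * C k) (dilation_average q u 0).
- by move=> n; exact: isjet_sum.
- by move=> n k t; apply: dilation_sum_bound => // s; exact: uC.
- by move=> n; exact: approx1_sum.
- by move=> t; exact: dilation_sum_cvg.
suff -> : dilation_average q u = v by [].
apply/funext => k; apply/funext => t; apply: cvg_unique (vP k t) => //.
exact: dilation_sum_cvg.
Qed.

Lemma continuous_bounded_itv (R : realType) (f : R -> R) (a b : R) : a <= b -> continuous f ->
  exists2 M : R, 0 <= M & forall t, a <= t <= b -> `|f t| <= M.
Proof.
move=> ab cf.
have cnf : continuous (fun t => `|f t|) by move=> t; apply: cvg_norm; exact: cf.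
have [c _ cM] := EVT_max ab (continuous_subspaceT cnf).
by exists `|f c| => // t tab; apply: cM; rewrite in_itv.
Qed.

Lemma is_deriv_horner (R : realType) (p : {poly R}) : is_deriv (horner p) (horner p^`()).
Proof. by move=> t; exact: is_derive_poly. Qed.

Lemma quadratic_bounded_left (R : realType) (a b c M : R) :
  (forall t : R, t <= 0 -> `|a + b * t + c * t ^+ 2| <= M) -> b = 0 /\ c = 0.
Proof.
move=> H.
have M0 : 0 <= M by exact: le_trans (H 0 (lexx _)).
have c0 : c = 0.
  apply: (@bounded_multiples_eq0 _ c (4 * M + 1)) => s s0.
  have := H 0 (lexx _); have := H (- s); have := H (- (2 * s)).
  rewrite !oppr_le0 s0 mulr_ge0// => /(_ isT) h2 /(_ isT) h1 h0.
  (* The second difference at 0, - s and - 2 s isolates the quadratic coefficient. *)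
  have : `|2 * c * s ^+ 2| <= 4 * M.
    move: h0 h1 h2; rewrite !ler_norml => /andP[? ?] /andP[? ?] /andP[? ?].
    apply/andP; split; nra.
  (* The same with step 1 settles s <= 1, where s^2 no longer dominates s. *)
  have := H (-1); have := H (- 2); rewrite !oppr_le0 !ler01 ler0n => /(_ isT) g2 /(_ isT) g1.
  have : `|2 * c| <= 4 * M.
    move: h0 g1 g2; rewrite !ler_norml => /andP[? ?] /andP[? ?] /andP[? ?].
    apply/andP; split; nra.
  rewrite [`|2 * c * _|]normrM [`|2 * c|]normrM normrX (ger0_norm s0) [`|2|]ger0_norm// => h4 h5.
  have := normr_ge0 c.
  have [s1|s1] := lerP s 1; nra.
split=> //; apply: (@bounded_multiples_eq0 _ b (2 * M)) => s s0.
have := H 0 (lexx _); have := H (- s); rewrite oppr_le0 s0 => /(_ isT).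
rewrite c0 -[X in _ * X <= _](ger0_norm s0) -normrM !ler_norml.
by move=> /andP[? ?] /andP[? ?]; apply/andP; split; nra.
Qed.

Lemma third_derivative_eq0 (R : realType) (u : nat -> R -> R) : isjet u ->
  (forall t, u 3%N t = 0) -> forall t, u 0%N t = u 0%N 0 + u 1%N 0 * t + u 2%N 0 / 2 * t ^+ 2.
Proof.
move=> ju u3 t.
have u2 s : u 2%N s = u 2%N 0 by exact: zero_deriv_cst (ju 2%N) u3.
have dl (a : R) : is_deriv (fun s => a * s) (fun=> a).
  by apply: is_deriv_ext (is_derivZ a (@is_deriv_id R)) _ _ => // s; rewrite mulr1.
have d1 := is_derivB (ju 1%N) (dl (u 2%N 0)).
have := zero_deriv_cst _ 0 d1 _ => /= z1.
have u1 s : u 1%N s = u 1%N 0 + u 2%N 0 * s.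
  have := z1 s; rewrite mulr0 subr0 => <-; last by move=> x; rewrite u2 subrr.
  by rewrite subrK.
have dq : is_deriv (fun s => u 1%N 0 * s + u 2%N 0 / 2 * (s * s))
    (fun s => u 1%N 0 + u 2%N 0 * s).
  apply: is_deriv_ext (is_derivD (dl (u 1%N 0))
    (is_derivZ (u 2%N 0 / 2) (is_derivM (@is_deriv_id R) (@is_deriv_id R)))) _ _ => // s.
  by field.
have := zero_deriv_cst t 0 (is_derivB (ju 0%N) dq) _ => /= z0.
have := z0 (fun s => _); rewrite expr2 => /(_ _)/eqP.
have -> : u 0%N 0 - (u 1%N 0 * 0 + u 2%N 0 / 2 * (0 * 0)) = u 0%N 0 by ring.
rewrite subr_eq => /(_ _)/eqP ->; first by ring.
by move=> s; rewrite u1 subrr.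
Qed.

(** The double zeros at 1 and 2 remove the boundary terms of two integrations by parts. *)
Definition bump_weight (R : realType) (l : R) : R := ((l - 1) * (l - 2)) ^+ 2.

(** Differentiating u k (l t) in l produces a factor t and raises the order by one. Read backwards,
    two integrations by parts in l absorb t^2 and leave an integral of u k (l t) against a fixed
    polynomial. *)
Lemma dilation_average_decay (R : realType) (u : nat -> R -> R) (k : nat) (C : R) :
  isjet u -> (forall t, `|u k t| <= C) ->
  exists D : R, forall t, t ^+ 2 * `|dilation_average (@bump_weight R) u k.+2 t| <= D.
Proof.
move=> ju uC.
pose d : {poly R} := ('X - 1%:P) * ('X - 2%:P).
have dE x : d.[x] = (x - 1) * (x - 2) by rewrite /d !hornerE.
clearbody d.
have d1 : d.[1] = 0 by rewrite dE subrr mul0r.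
have d2 : d.[2] = 0 by rewrite dE subrr mulr0.
pose P : {poly R} := d * (d * 'X^(k.+2)).
have P'E x : P^`().[x] = d^`().[x] * (d * 'X^(k.+2)).[x] + d.[x] * (d * 'X^(k.+2))^`().[x].
  by rewrite /P derivM hornerD !hornerM.
have h12 : (1 : R) <= 2 by rewrite ler1n.
have [M M0 MP] := continuous_bounded_itv h12 (@continuous_horner _ P^`()^`()).
exists (M * C) => t.
have cu j : continuous (fun l : R => u j (l * t)).
  rewrite (_ : (fun l : R => u j (l * t)) = (fun l => u j (t * l + 0))).
    exact: continuous_affine (derivative_continuous (ju j)).
  by apply/funext => l; rewrite addr0 mulrC.
have cp (p : {poly R}) : continuous (horner p) by exact: continuous_horner.
have du j : is_deriv (fun l => u j (l * t)) (fun l => t * u j.+1 (l * t)).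
  by apply: is_deriv_ext (is_deriv_affine t 0 (ju j)) _ _ => l; rewrite addr0 [t * l]mulrC.
have c0 : continuous (fun l : R => u k (l * t) * P^`()^`().[l]) by exact: continuous_mul.
have c2 : continuous (fun l : R => P.[l] * u k.+2 (l * t)) by exact: continuous_mul.
(* two integrations by parts; P and P' vanish at both ends *)
have key : Int (fun l => t ^+ 2 * (P.[l] * u k.+2 (l * t)) - u k (l * t) * P^`()^`().[l]) 1 2 = 0.
  have dH : is_deriv (fun l => P.[l] * (t * u k.+1 (l * t)) - u k (l * t) * P^`().[l])
      (fun l => t ^+ 2 * (P.[l] * u k.+2 (l * t)) - u k (l * t) * P^`()^`().[l]).
    apply: is_deriv_ext (is_derivB (is_derivM (is_deriv_horner P) (is_derivZ t (du k.+1)))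
      (is_derivM (du k) (is_deriv_horner P^`()))) _ _ => // l.
    by ring.
  rewrite (IntE _ _ dH) !P'E /P !hornerM d1 d2; ring.
move: key; rewrite IntB//; last by apply: continuous_mul => // x; exact: cst_continuous.
rewrite IntZ// => /eqP; rewrite subr_eq0 => /eqP key.
rewrite -(ger0_norm (sqr_ge0 t)) -normrM.
have -> : dilation_average (@bump_weight R) u k.+2 t = Int (fun l => P.[l] * u k.+2 (l * t)) 1 2.
  congr Int; apply/funext => l; congr (_ * _).
  by rewrite /bump_weight /P hornerM (hornerM d) hornerXn dE; ring.
rewrite key; apply: le_trans (Int_norm_le (C := M * C) c0 h12 _) _.
  by move=> l l12; rewrite normrM mulrC ler_pM// MP.
by rewrite (_ : (2 : R) - 1 = 1) ?mulr1//; ring.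
Qed.

Lemma bump_weight_ge0 (R : realType) (l : R) : 0 <= bump_weight l.
Proof. exact: sqr_ge0. Qed.

Lemma bump_weight_continuous (R : realType) : continuous (@bump_weight R).
Proof.
have -> : @bump_weight R = horner ((('X - 1%:P) * ('X - 2%:P)) ^+ 2).
  by apply/funext => l; rewrite /bump_weight !hornerE.
exact: continuous_horner.
Qed.

Lemma Int_bump_weight_gt0 (R : realType) : 0 < Int (@bump_weight R) 1 2.
Proof.
have cw := @bump_weight_continuous R.
have c0 (c : R) : continuous (fun _ : R => c) by move=> x; exact: cst_continuous.
have pos (a b : R) : a <= b -> 0 <= Int (@bump_weight R) a b.
  move=> ab; have <- : Int (fun=> 0 : R) a b = 0 by rewrite Int_cst mul0r.
  by apply: le_Int => // t _; exact: bump_weight_ge0.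
rewrite (Int_chasles _ 1 (5 / 4)) (Int_chasles _ (5 / 4) (7 / 4)).
have h1 := pos 1 (5 / 4) ltac:(lra); have h2 := pos (7 / 4) 2 ltac:(lra).
have : Int (fun=> 1 / 256 : R) (5 / 4) (7 / 4) <= Int (@bump_weight R) (5 / 4) (7 / 4).
  apply: le_Int => //; first by lra.
  move=> t /andP[t1 t2]; rewrite /bump_weight.
  have : 1 / 16 <= (t - 1) * (2 - t) by nra.
  have -> : (t - 1) * (t - 2) = - ((t - 1) * (2 - t)) by ring.
  rewrite sqrrN; nra.
rewrite Int_cst; lra.
Qed.

Definition activation_jet (R : realType) (psi : R -> R) (k : nat) : R -> R := derive1n k psi.

Lemma isjet_activation (R : realType) (psi : R -> R) : Cinfty psi -> isjet (activation_jet psi).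
Proof.
move=> cpsi k t; rewrite /activation_jet derive1nS derive1E.
by apply/derivableP; exact: cpsi.
Qed.

(* Averaging psi(l t) over l in [1, 2] against a smooth bump turns boundedness of psi'
   into quadratic decay of the third derivative. *)
Lemma integrable_kernel (R : realType) (m : nat) (psi : R -> R) : Abinfty psi ->
  exists F : nat -> R -> R, [/\ isjet F, approx1 m (activation_jet psi) F,
    exists C : nat -> R, forall k t, `|F k t| <= C k /\ t ^+ 2 * `|F k t| <= C k &
    exists t, F 0%N t != 0].
Proof.
move=> [cpsi [a a0 psia] [psiinc psioo] psib].
set phi := activation_jet psi.
have jphi : isjet phi by exact: isjet_activation.
have [A AP] : exists A : nat -> R, forall k t, `|phi k.+1 t| <= A k.
  have [|A AP] := @choice nat R (fun k B => forall t, `|phi k.+1 t| <= B).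
    by move=> k; have [B _ H] := psib k.+1 isT; exists B.
  by exists A.
have cw := @bump_weight_continuous R.
have h12 : (1 : R) <= 2 by rewrite ler1n.
have [M M0 wM] := continuous_bounded_itv h12 cw.
pose G := dilation_average (@bump_weight R) phi.
have jG : isjet G.
  apply: (isjet_dilation_average (M := M) (C := fun k => A k.-1)) => //.
  by move=> [//|k] t _; exact: AP.
pose F k := G k.+3.
pose q (l : R) := bump_weight l * l ^+ 3.
have cq : continuous q by apply: continuous_mul => //; exact: continuous_exp.
have [Mq Mq0 qM] := continuous_bounded_itv h12 cq.
(* Two views of F: as derivatives of the average of psi, it is a jet whose vanishing can be
   integrated; as an average of the third derivative of psi, it inherits boundedness and
   approximability. *)
have FE : F = dilation_average q (fun k => phi k.+3).
  apply/funext => k; apply/funext => t; congr Int; apply/funext => l; congr (_ * _).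
  by rewrite /q -mulrA -exprD.
have a1 := approx1_deriv jphi AP (@approx1_activation R m phi).
have j1 k : is_deriv (phi k.+1) (phi k.+2) by exact: jphi.
have a2 := approx1_deriv (u := fun k => phi k.+1) j1 (fun k t => AP k.+1 t) a1.
have a3 := approx1_deriv (u := fun k => phi k.+2) (fun k => j1 k.+1) (fun k t => AP k.+2 t) a2.
have [aF FC] := approx1_dilation_average (C := fun k => A k.+2) (fun k => j1 k.+2) cq qM
  (fun k t => AP k.+2 t) a3.
exists F; split.
- by move=> k; exact: jG.
- by rewrite FE.
- have [D DP] : exists D : nat -> R, forall k t, t ^+ 2 * `|F k t| <= D k.
    have [|D DP] := @choice nat R (fun k D => forall t, t ^+ 2 * `|F k t| <= D).
      by move=> k; apply: (dilation_average_decay (C := A k) jphi) => t; exact: AP.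
    by exists D.
  exists (fun k => Num.max (Mq * 2 ^+ k * A k.+2) (D k)) => k t.
  by rewrite !le_max FE FC -FE DP orbT.
- apply: contrapT => nF.
  have F0 t : G 3%N t = 0.
    by apply/eqP; apply: contrapT => /negP H; apply: nF; exists t.
  have GE := third_derivative_eq0 jG F0.
  have cphi t : continuous (fun l : R => bump_weight l * l ^+ 0 * phi 0%N (l * t)).
    exact: dilation_average_continuous.
  have [] := @quadratic_bounded_left R (G 0%N 0) (G 1%N 0) (G 2%N 0 / 2) (M * a).
    move=> t t0; rewrite -GE; apply: le_trans (Int_norm_le (C := M * a) (cphi t) h12 _) _.
      move=> l /andP[l1 l2]; rewrite expr0 mulr1 normrM ler_pM//; first by apply: wM; rewrite l1.
      by apply: psia; rewrite mulr_ge0_le0// (le_trans _ l1).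
    by rewrite (_ : (2 : R) - 1 = 1) ?mulr1//; ring.
  move=> G1 G2.
  set I := Int (@bump_weight R) 1 2.
  have I0 : 0 < I := Int_bump_weight_gt0 R.
  (* At this point [G 0] is known to be constant, and psi (l t) >= psi t for l in [1, 2] since psi
     increases on t > 0. *)
  have GI t : 0 < t -> I * psi t <= G 0%N 0.
    move=> t0; have -> : G 0%N 0 = G 0%N t by rewrite (GE t) G1 G2 !mul0r !addr0.
    rewrite mulrC -IntZ//; apply: le_Int => //.
      by apply: continuous_mul => // x; exact: cst_continuous.
    move=> l /andP[l1 l2]; rewrite expr0 mulr1 mulrC ler_wpM2l ?bump_weight_ge0//.
    have [->|l1'] := eqVneq l 1; first by rewrite mul1r.
    apply/ltW/psiinc => //; rewrite ltr_pMl// lt_neqAle eq_sym l1'//.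
  have /cvgryPge/(_ (G 0%N 0 / I + 1)) := psioo.
  move=> [r [_ rP]].
  have := rP (Num.max r 0 + 1); rewrite /= => /(_ _).
  have r0 : 0 < Num.max r 0 + 1 by rewrite ltr_wpDl// le_max lexx orbT.
  have rr : r < Num.max r 0 + 1 by rewrite ltr_pwDr// le_max lexx.
  move=> /(_ rr); have := GI _ r0; rewrite mulrC -ler_pdivlMr//.
  by move=> h1 h2; have := le_trans h2 h1; lra.
Qed.

(** * Periodization *)

Lemma abs_bounded_series_cvg (R : realType) (a : nat -> R) (B : R) :
  (forall n, \sum_(i < n) `|a i| <= B) -> cvg (\sum_(i < n) a i @[n --> \oo]).
Proof.
move=> aB; rewrite (_ : (fun n => _) = series a); last first.
  by apply/funext => n; rewrite seriesEord.
apply: normed_cvg; rewrite (_ : [normed series a] = fun n => \sum_(i < n) `|a i|).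
  apply: nondecreasing_is_cvgn; last by exists B => _ [n _ <-].
  by apply/nondecreasing_seqP => n; rewrite big_ord_recr/= lerDl.
by apply/funext => n; rewrite /normed_series_of seriesEord.
Qed.

Lemma abs_bounded_series_term (R : realType) (a : nat -> R) (B : R) :
  (forall n, \sum_(i < n) `|a i| <= B) -> a n @[n --> \oo] --> 0.
Proof.
move=> /abs_bounded_series_cvg; rewrite (_ : (fun n => _) = series a).
  exact: cvg_series_cvg_0.
by apply/funext => n; rewrite /normed_series_of seriesEord.
Qed.

Definition atan_diff (R : realType) (t : R) : R := atan (t + pi) - atan (t - pi).

(* Telescoping this function controls the sums of 1 / (1 + t^2) over translates by 2 pi Z. *)
Lemma atan_diff_ge (R : realType) : exists2 c : R, 0 < c &
  forall t : R, 1 <= c * (1 + t ^+ 2) * atan_diff t.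
Proof.
have p0 : 0 < (pi : R) by exact: pi_gt0.
have p2 : 2 <= (pi : R) by exact: pi_ge2.
(* The mean value point x lies within 3 pi of t, so x^2 <= 2 t^2 + 18 pi^2; the length 2 pi of the
   interval is at least 1. *)
exists (2 + 18 * pi ^+ 2) => [|t]; first by rewrite ltr_wpDr// mulr_ge0// sqr_ge0.
have da : is_deriv (@atan R) (fun x => (1 + x ^+ 2)^-1) by move=> x; apply: DeriveDef; [exact: derivable_atan|rewrite -derive1E derive1_atan].
have [x + E] := mean_value (t - pi) (t + pi) da.
rewrite /atan_diff E (_ : t + pi - (t - pi) = 2 * pi); last by ring.
rewrite [X in _ <= X]ger0_norm ?mulr_ge0 ?(ltW p0)// => xt.
have x1 : `|x| <= `|t| + 3 * pi.
  rewrite (_ : x = t + ((x - (t - pi)) - pi)); last by ring.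
  rewrite (le_trans (ler_normD _ _))// lerD2l (le_trans (ler_normB _ _))//.
  rewrite [`|pi|]ger0_norm ?(ltW p0)//; lra.
have x2 : x ^+ 2 <= 2 * t ^+ 2 + 18 * pi ^+ 2.
  rewrite -[x ^+ 2]real_normK ?num_real// -[t ^+ 2]real_normK ?num_real//.
  apply: (@le_trans _ _ ((`|t| + 3 * pi) ^+ 2)).
    by rewrite lerXn2r ?nnegrE// addr_ge0// mulr_ge0// ltW.
  by have := sqr_ge0 (`|t| - 3 * pi); nra.
rewrite mulrCA ler_pdivlMl; last by rewrite ltr_wpDr// sqr_ge0.
have h0 : 0 <= t ^+ 2 := sqr_ge0 t.
have h1 : 0 <= (pi : R) ^+ 2 := sqr_ge0 _.
have h2 : 1 + x ^+ 2 <= (2 + 18 * pi ^+ 2) * (1 + t ^+ 2) by nra.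
rewrite mulr1 (le_trans h2)// ler_peMr//; last by lra.
by rewrite mulr_ge0 ?addr_ge0// mulr_ge0.
Qed.

Lemma atan_diff_ge0 (R : realType) (t : R) : 0 <= atan_diff t.
Proof.
have [c c0 cP] := atan_diff_ge R.
have h : 0 < c * (1 + t ^+ 2) by rewrite mulr_gt0// ltr_wpDr// sqr_ge0.
by rewrite -(pmulr_rge0 _ h) (le_trans ler01).
Qed.

Lemma atan_diff_suml (R : realType) (t : R) n : \sum_(i < n) atan_diff (t - i%:R * (2 * pi)) <= pi.
Proof.
have -> : \sum_(i < n) atan_diff (t - i%:R * (2 * pi)) = atan (t + pi) - atan (t + pi - n%:R * (2 * pi)).
  elim: n => [|n IH]; first by rewrite big_ord0 mul0r subr0 subrr.
  rewrite big_ord_recr/= IH /atan_diff -[n.+1%:R]natr1.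
  rewrite (_ : t - n%:R * (2 * pi) + pi = t + pi - n%:R * (2 * pi)); last by ring.
  rewrite (_ : t - n%:R * (2 * pi) - pi = t + pi - (n%:R + 1) * (2 * pi)); last by ring.
  by ring.
have := @atan_ltpi2 R (t + pi); have := @atan_gtNpi2 R (t + pi - n%:R * (2 * pi)); lra.
Qed.

Lemma atan_diff_sumr (R : realType) (t : R) n : \sum_(i < n) atan_diff (t + i%:R * (2 * pi)) <= pi.
Proof.
have -> : \sum_(i < n) atan_diff (t + i%:R * (2 * pi)) = atan (t - pi + n%:R * (2 * pi)) - atan (t - pi).
  elim: n => [|n IH]; first by rewrite big_ord0 mul0r addr0 subrr.
  rewrite big_ord_recr/= IH /atan_diff -[n.+1%:R]natr1.
  rewrite (_ : t + n%:R * (2 * pi) - pi = t - pi + n%:R * (2 * pi)); last by ring.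
  rewrite (_ : t + n%:R * (2 * pi) + pi = t - pi + (n%:R + 1) * (2 * pi)); last by ring.
  by ring.
have := @atan_ltpi2 R (t - pi + n%:R * (2 * pi)); have := @atan_gtNpi2 R (t - pi); lra.
Qed.

(** The sum of 2 n consecutive translates, cut in two so that each half is a partial sum of a series
    over the naturals. *)
Definition periodic_sum (R : realType) (f : R -> R) (n : nat) (t : R) : R :=
  \sum_(i < n) f (t - i%:R * (2 * pi)) + \sum_(i < n) f (t + i.+1%:R * (2 * pi)).

Lemma translate_sum_bound (R : realType) (f : R -> R) (K t : R) (n : nat) : 0 <= K ->
  ((forall i, `|f (t - i%:R * (2 * pi))| <= K * atan_diff (t - i%:R * (2 * pi))) ->
    \sum_(i < n) `|f (t - i%:R * (2 * pi))| <= K * pi) /\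
  ((forall i, `|f (t + i%:R * (2 * pi))| <= K * atan_diff (t + i%:R * (2 * pi))) ->
    \sum_(i < n) `|f (t + i%:R * (2 * pi))| <= K * pi).
Proof.
move=> K0; split=> H.
  apply: le_trans (ler_wpM2l K0 (atan_diff_suml t n)).
  by rewrite big_distrr/=; apply: ler_sum => i _; exact: H.
apply: le_trans (ler_wpM2l K0 (atan_diff_sumr t n)).
by rewrite big_distrr/=; apply: ler_sum => i _; exact: H.
Qed.

Lemma periodic_sum_shift (R : realType) (t : R) (i : nat) :
  t + i.+1%:R * (2 * pi) = (t + 2 * pi) + i%:R * (2 * pi).
Proof. rewrite -[i.+1%:R]natr1; ring. Qed.

Lemma periodic_sum_bound (R : realType) (f : R -> R) (K t : R) (n : nat) : 0 <= K ->
  (forall t, `|f t| <= K * atan_diff t) -> `|periodic_sum f n t| <= K * (2 * pi).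
Proof.
move=> K0 fK; apply: (le_trans (ler_normD _ _)).
have -> : K * (2 * pi) = K * pi + K * pi :> R by ring.
apply: lerD; apply: (le_trans (ler_norm_sum _ _ _)).
  by apply: (translate_sum_bound f t n K0).1.
under eq_bigr do rewrite periodic_sum_shift.
by apply: (translate_sum_bound f (t + 2 * pi) n K0).2.
Qed.

Lemma periodic_sum_cvg (R : realType) (f : R -> R) (K t : R) : 0 <= K ->
  (forall t, `|f t| <= K * atan_diff t) -> cvg (periodic_sum f n t @[n --> \oo]).
Proof.
move=> K0 fK.
have c1 := @abs_bounded_series_cvg R (fun i => f (t - i%:R * (2 * pi))) (K * pi)
  (fun n => (translate_sum_bound f t n K0).1 (fun i => fK _)).
have c2 := @abs_bounded_series_cvg R (fun i => f (t + 2 * pi + i%:R * (2 * pi))) (K * pi)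
  (fun n => (translate_sum_bound f (t + 2 * pi) n K0).2 (fun i => fK _)).
rewrite (_ : (fun n => _) = (fun n => \sum_(i < n) f (t - i%:R * (2 * pi)) +
    \sum_(i < n) f (t + 2 * pi + i%:R * (2 * pi)))); first exact: is_cvgD c1 c2.
by apply/funext => n; congr (_ + _); apply: eq_bigr => i _; rewrite periodic_sum_shift.
Qed.

(** Shifting by one period only exchanges the extreme translates, which are terms of convergent
    series and so tend to 0. *)
Lemma periodic_sum_periodic (R : realType) (f : R -> R) (K t : R) : 0 <= K ->
  (forall t, `|f t| <= K * atan_diff t) ->
  periodic_sum f n (t + 2 * pi) - periodic_sum f n t @[n --> \oo] --> 0.
Proof.
move=> K0 fK.
have E n : periodic_sum f n (t + 2 * pi) - periodic_sum f n t =
    f (t + 2 * pi + n%:R * (2 * pi)) - f (t + 2 * pi - n%:R * (2 * pi)).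
  elim: n => [|n IH].
    by rewrite /periodic_sum !big_ord0 mul0r !addr0 !subr0 subrr.
  move: IH; rewrite /periodic_sum !big_ord_recr/= -[n.+1%:R]natr1.
  rewrite (_ : t + 2 * pi - (n%:R + 1) * (2 * pi) = t - n%:R * (2 * pi)); last by ring.
  rewrite (_ : t + (n%:R + 1) * (2 * pi) = t + 2 * pi + n%:R * (2 * pi)); last by ring.
  by lra.
rewrite (_ : (fun n => _) = (fun n => f (t + 2 * pi + n%:R * (2 * pi)) -
   f (t + 2 * pi - n%:R * (2 * pi)))); last by apply/funext => n; exact: E.
rewrite -[X in _ --> X](subr0 0).
have c1 := @abs_bounded_series_term R (fun i => f (t + 2 * pi - i%:R * (2 * pi))) (K * pi)
  (fun n => (translate_sum_bound f (t + 2 * pi) n K0).1 (fun i => fK _)).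
have c2 := @abs_bounded_series_term R (fun i => f (t + 2 * pi + i%:R * (2 * pi))) (K * pi)
  (fun n => (translate_sum_bound f (t + 2 * pi) n K0).2 (fun i => fK _)).
exact: cvgB c2 c1.
Qed.

(** Dilation by a large S concentrates F near 0. The periodization is then F t0 plus a tail at t0 /
    S, and only a tail at pi; the tails are of order 1 / S^2, so the two values differ. *)
Lemma periodic_element (R : realType) (m : nat) (phi F : nat -> R -> R) (C : nat -> R) :
  isjet F -> approx1 m phi F ->
  (forall k t, `|F k t| <= C k /\ t ^+ 2 * `|F k t| <= C k) -> (exists t, F 0%N t != 0) ->
  exists P : nat -> R -> R, [/\ isjet P, approx1 m phi P,
    exists B : nat -> R, forall k t, `|P k t| <= B k,
    forall t, P 0%N (t + 2 * pi) = P 0%N t &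
    exists s t, P 0%N s != P 0%N t].
Proof.
move=> jF aF FC [t0 Ft0].
have [c c0 cP] := atan_diff_ge R.
have p0 : 0 < (pi : R) by exact: pi_gt0.
have p2 : 2 <= (pi : R) by exact: pi_ge2.
have C0 k : 0 <= C k by exact: le_trans (FC k 0).1.
have F0 : 0 < `|F 0%N t0| by rewrite normr_gt0.
(* S >= |t0| puts t0 / S in [- 1, 1], so that its other translates have modulus at least 1. The last
   term makes |F t0| exceed 4 pi k0, the sum of the two tail bounds at the end. *)
pose S : R := `|t0| + 1 + 8 * pi * c * (C 0%N + 1) / `|F 0%N t0|.
have S'0 : 0 < 8 * pi * c * (C 0%N + 1) / `|F 0%N t0|.
  by rewrite divr_gt0// mulr_gt0 ?ltr_wpDl// mulr_gt0// mulr_gt0.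
have S1 : 1 <= S by rewrite /S; have := normr_ge0 t0; lra.
have S0 : 0 < S by exact: lt_le_trans S1.
have St0 : `|t0| <= S by rewrite /S; lra.
pose f (k : nat) (t : R) := S ^+ k * F k (S * t).
pose K k := c * (S ^+ k * (C k + C k)).
have K0 k : 0 <= K k.
  by apply: mulr_ge0; [exact: ltW|rewrite mulr_ge0 ?exprn_ge0 ?addr_ge0// ltW].
have fK k t : `|f k t| <= K k * atan_diff t.
  have h : (1 + t ^+ 2) * `|f k t| <= S ^+ k * (C k + C k).
    rewrite /f normrM normrX (ger0_norm (ltW S0)) mulrCA ler_wpM2l ?exprn_ge0 ?(ltW S0)//.
    rewrite mulrDl mul1r; have [h1 h2] := FC k (S * t); apply: lerD => //.
    apply: le_trans h2; rewrite exprMn ler_wpM2r// ler_peMl ?sqr_ge0//.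
    by rewrite expr_ge1// ltW.
  apply: (@le_trans _ _ (c * (1 + t ^+ 2) * atan_diff t * `|f k t|)); first by rewrite ler_peMl.
  rewrite (_ : c * _ * _ * _ = c * atan_diff t * ((1 + t ^+ 2) * `|f k t|)); last by ring.
  rewrite /K [leRHS]mulrAC; apply: ler_wpM2l => //.
  by rewrite mulr_ge0 ?atan_diff_ge0// ltW.
pose u (n k : nat) (t : R) := \sum_(i < n) 1 * S ^+ k * F k (S * t + (- (S * (i%:R * (2 * pi))))) +
  \sum_(i < n) 1 * S ^+ k * F k (S * t + S * (i.+1%:R * (2 * pi))).
have uE n k t : u n k t = periodic_sum (f k) n t.
  by congr (_ + _); apply: eq_bigr => i _; rewrite /f ?mulrBr ?mulrDr mul1r.
have [|||t|P [jP P0 PB aP Pc]] := @approx1_limit R m phi u (fun k => K k * (2 * pi))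
    (fun t => lim (periodic_sum (f 0%N) n t @[n --> \oo])).
- by move=> n k; apply: is_derivD; exact: isjet_sum.
- by move=> n k t; rewrite uE; apply: periodic_sum_bound.
- by move=> n; apply: approx1_add; exact: approx1_sum.
- by under eq_fun do rewrite uE; exact: periodic_sum_cvg (K0 0%N) (fK 0%N).
have Pf t : periodic_sum (f 0%N) n t @[n --> \oo] --> P 0%N t.
  by have := Pc 0%N t; under eq_fun do rewrite uE.
exists P; split => //.
- by exists (fun k => K k * (2 * pi)).
- move=> t; apply/eqP; rewrite -subr_eq0; apply/eqP.
  apply: cvg_unique (periodic_sum_periodic t (K0 0%N) (fK 0%N)) => //.
  exact: cvgB (Pf _) (Pf _).
pose k0 := 2 * c * C 0%N / S ^+ 2.
have k00 : 0 <= k0.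
  by rewrite divr_ge0 ?sqr_ge0// mulr_ge0// mulr_ge0// ltW.
(* For |x| >= 1 the factor 1 + x^2 is at most 2 x^2, and the decay of F at S x brings in 1 / S^2. *)
have fk x : 1 <= `|x| -> `|f 0%N x| <= k0 * atan_diff x.
  move=> x1; have x2 : 1 <= x ^+ 2 by rewrite -real_normK ?num_real// expr_ge1.
  apply: (@le_trans _ _ (c * (1 + x ^+ 2) * atan_diff x * `|f 0%N x|)); first by rewrite ler_peMl.
  apply: (@le_trans _ _ (2 * c * atan_diff x * (x ^+ 2 * `|f 0%N x|))).
    rewrite (_ : c * _ * _ * _ = c * atan_diff x * `|f 0%N x| * (1 + x ^+ 2)); last by ring.
    rewrite (_ : 2 * c * _ * _ = c * atan_diff x * `|f 0%N x| * (2 * x ^+ 2)); last by ring.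
    apply: ler_wpM2l; last by lra.
    by rewrite mulr_ge0// mulr_ge0 ?atan_diff_ge0// ltW.
  rewrite (_ : k0 * _ = 2 * c * atan_diff x * (C 0%N / S ^+ 2)); last by rewrite /k0; ring.
  apply: ler_wpM2l; first by rewrite mulr_ge0 ?atan_diff_ge0// mulr_ge0// ltW.
  rewrite ler_pdivlMr ?exprn_gt0// /f expr0 mul1r mulrAC -exprMn mulrC [x * S]mulrC mulrC.
  exact: (FC 0%N (S * x)).2.
have tail t n : (forall i, 1 <= `|t - i%:R * (2 * pi)|) -> (forall i, 1 <= `|t + 2 * pi + i%:R * (2 * pi)|) ->
    `|periodic_sum (f 0%N) n t| <= k0 * (2 * pi).
  move=> h1 h2; apply: (le_trans (ler_normD _ _)).
  have -> : k0 * (2 * pi) = k0 * pi + k0 * pi by ring.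
  apply: lerD; apply: (le_trans (ler_norm_sum _ _ _)).
    by apply: (translate_sum_bound (f 0%N) t n k00).1 => i; exact: fk.
  under eq_bigr do rewrite periodic_sum_shift.
  by apply: (translate_sum_bound (f 0%N) (t + 2 * pi) n k00).2 => i; exact: fk.
have n2 (i : nat) : 0 <= (i%:R : R) * (2 * pi) by rewrite mulr_ge0// mulr_ge0// ltW.
have Ppi : `|P 0%N pi| <= k0 * (2 * pi).
  apply: cvg_norm_le (Pf pi) _ => n; apply: tail => i.
    case: i => [|i]; first by rewrite mul0r subr0 ger0_norm; lra.
    by have h := n2 i; rewrite -[i.+1%:R]natr1 ler0_norm; lra.
  by have h := n2 i; rewrite ger0_norm; lra.
exists (t0 / S), pi; apply/eqP => E.
have t1 : `|t0 / S| <= 1.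
  by rewrite normrM normfV (ger0_norm (ltW S0)) ler_pdivrMr// mul1r.
have : `|P 0%N (t0 / S) - F 0%N t0| <= k0 * (2 * pi).
  (* The shift to [n.+1] ensures that the central term, equal to F t0, is present and can be split
     off. *)
  have Pf' : periodic_sum (f 0%N) n.+1 (t0 / S) - F 0%N t0 @[n --> \oo] --> P 0%N (t0 / S) - F 0%N t0.
    by have := Pf (t0 / S); rewrite -cvg_shiftS /= => PfS; apply: cvgB; [exact: PfS|exact: cvg_cst].
  apply: cvg_norm_le Pf' _ => n.
  rewrite /periodic_sum big_ord_recl/= mul0r subr0 {1}/f expr0 mul1r mulrC divfK ?gt_eqF//.
  rewrite [X in X - _](_ : _ = F 0%N t0 + (\sum_(i < n) f 0%N (t0 / S - 2 * pi - i%:R * (2 * pi)) +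
     \sum_(i < n.+1) f 0%N (t0 / S + 2 * pi + i%:R * (2 * pi)))); last first.
    rewrite addrA; congr (_ + _ + _); apply: eq_bigr => i _.
      by congr (f _ _); rewrite /bump /= add1n -[i.+1%:R]natr1; ring.
    by rewrite periodic_sum_shift.
  rewrite addrAC subrr add0r; apply: (le_trans (ler_normD _ _)).
  move: t1; rewrite ler_norml => /andP[ta tb].
  have -> : k0 * (2 * pi) = k0 * pi + k0 * pi by ring.
  apply: lerD; apply: (le_trans (ler_norm_sum _ _ _)).
    apply: (translate_sum_bound (f 0%N) _ n k00).1 => i; apply: fk.
    by have h := n2 i; rewrite ler0_norm; lra.
  apply: (translate_sum_bound (f 0%N) _ n.+1 k00).2 => i; apply: fk.
  by have h := n2 i; rewrite ger0_norm; lra.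
rewrite E => h.
have : `|F 0%N t0| <= 4 * pi * k0.
  rewrite (_ : F 0%N t0 = P 0%N pi - (P 0%N pi - F 0%N t0)); last by ring.
  by apply: (le_trans (ler_normB _ _)); lra.
apply/negP; rewrite -ltNge.
rewrite /k0 (_ : 4 * pi * _ = (8 * pi * c * C 0%N) / S ^+ 2); last by ring.
rewrite ltr_pdivrMr ?exprn_gt0//.
have : 8 * pi * c * (C 0%N + 1) <= S * `|F 0%N t0|.
  by rewrite -ler_pdivrMr// /S; have := normr_ge0 t0; lra.
have : S * `|F 0%N t0| <= `|F 0%N t0| * S ^+ 2 by rewrite mulrC ler_wpM2l// expr2 ler_peMr// ltW.
have : 8 * pi * c * C 0%N < 8 * pi * c * (C 0%N + 1).
  by rewrite ltr_pM2l ?ltrDl// mulr_gt0// mulr_gt0.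
lra.
Qed.

(** * Cosine kernels and Fourier coefficients *)

Lemma is_deriv_cos (R : realType) : is_deriv (@cos R) (fun t => - sin t).
Proof. by move=> t; exact: is_derive_cos. Qed.

Lemma is_deriv_sin (R : realType) : is_deriv (@sin R) (@cos R).
Proof. by move=> t; exact: is_derive_sin. Qed.

Lemma is_deriv_exp (R : realType) (f f' : R -> R) (n : nat) : is_deriv f f' ->
  is_deriv (fun t => f t ^+ n) (fun t => n%:R * f t ^+ n.-1 * f' t).
Proof.
move=> df; elim: n => [|n IH].
  by apply: is_deriv_ext (@is_deriv_cst R 1) _ _ => t; rewrite ?mul0r.
apply: is_deriv_ext (is_derivM df IH) _ _ => t; rewrite -?exprS//=.
case: n {IH} => [|n] /=; first by rewrite expr0; ring.
by rewrite -[n.+2%:R]natr1 exprS; ring.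
Qed.

Lemma continuous_cos_mul (R : realType) (a b : R) : continuous (fun s : R => cos (a * s + b)).
Proof. by apply: continuous_affine; exact: continuous_cos. Qed.

(** This is cos (s / 2) to the power 2 n: a nonnegative trigonometric polynomial with its peak at
    0. *)
Definition cosine_kernel (R : realType) (n : nat) (s : R) : R := ((1 + cos s) / 2) ^+ n.

Definition cosine_mass (R : realType) (n : nat) : R := Int (@cosine_kernel R n) (- pi) pi.

Lemma cosine_kernel_ge0 (R : realType) n (s : R) : 0 <= cosine_kernel n s.
Proof. by rewrite exprn_ge0// divr_ge0//; have := cos_geN1 s; lra. Qed.

Lemma is_deriv_half_cos (R : realType) :
  is_deriv (fun s : R => (1 + cos s) / 2) (fun s => - sin s / 2).
Proof.
apply: is_deriv_ext (is_derivZ (2^-1) (is_derivD (is_deriv_cst 1) (@is_deriv_cos R))) _ _ => s.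
  by rewrite mulrC.
by rewrite add0r mulrC.
Qed.

Lemma cosine_kernel_continuous (R : realType) n : continuous (@cosine_kernel R n).
Proof. exact: derivative_continuous (is_deriv_exp n (@is_deriv_half_cos R)). Qed.

(** Wallis recursion: the difference of the two integrands is the derivative of sin s times the n-th
    kernel, which vanishes at - pi and pi. *)
Lemma cosine_mass_rec (R : realType) n :
  (n.*2.+2)%:R * cosine_mass R n.+1 = (n.*2.+1)%:R * cosine_mass R n.
Proof.
have dH := is_derivM (@is_deriv_sin R) (is_deriv_exp n (@is_deriv_half_cos R)).
have cK k := @cosine_kernel_continuous R k.
have cc (c : R) : continuous (fun _ : R => c) by move=> x; exact: cst_continuous.
have E : Int (fun s => (n.*2.+2)%:R * cosine_kernel n.+1 s - (n.*2.+1)%:R * @cosine_kernel R n s)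
    (- pi) pi = 0.
  rewrite (_ : (fun s => _) = (fun s => sin s * (n%:R * ((1 + cos s) / 2) ^+ n.-1 * (- sin s / 2)) +
     ((1 + cos s) / 2) ^+ n * cos s)).
    by rewrite (IntE _ _ dH) sinN sinpi !(oppr0, mul0r, addr0).
  apply/funext => s; rewrite /cosine_kernel; set y := (1 + cos s) / 2.
  have ce : cos s = 2 * y - 1 by rewrite /y; field.
  have se : sin s * sin s = 4 * y * (1 - y).
    by have := cos2Dsin2 s; rewrite ce !expr2; nra.
  rewrite (_ : sin s * _ = - (n%:R * y ^+ n.-1 * (sin s * sin s) / 2)); last by field.
  have e1 : (n.*2.+1)%:R = 2 * n%:R + 1 :> R by rewrite -[LHS]natr1 -mul2n natrM.
  have e2 : (n.*2.+2)%:R = 2 * n%:R + 2 :> R by rewrite -[LHS]natr1 e1; ring.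
  rewrite se ce e1 e2 exprS.
  by case: n {dH cK e1 e2} => [|n] /=; rewrite ?expr0 ?exprS; field.
move: E; rewrite IntB; last 2 first.
- by apply: continuous_mul.
- by apply: continuous_mul.
by rewrite !IntZ// => /eqP; rewrite subr_eq0 => /eqP.
Qed.

Lemma cosine_mass_gt0 (R : realType) n : 0 < cosine_mass R n.
Proof.
elim: n => [|n IH].
  rewrite /cosine_mass (_ : @cosine_kernel R 0 = fun=> 1) ?Int_cst; last first.
    by apply/funext => s; rewrite /cosine_kernel expr0.
  by rewrite mul1r opprK addr_gt0// pi_gt0.
by rewrite -(pmulr_rgt0 _ (ltr0Sn R n.*2.+1)) cosine_mass_rec pmulr_rgt0.
Qed.

(** Since 1 - cos s = 2 - 2 (1 + cos s) / 2, the moment is twice the difference of consecutive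
    masses. The factor 1 / (n + 1) is the concentration of the kernel at 0. *)
Lemma cosine_moment (R : realType) n :
  Int (fun s => @cosine_kernel R n s * (1 - cos s)) (- pi) pi = cosine_mass R n / n.+1%:R.
Proof.
have cK k := @cosine_kernel_continuous R k.
have cc (c : R) : continuous (fun _ : R => c) by move=> x; exact: cst_continuous.
rewrite (_ : (fun s => _) = (fun s => 2 * @cosine_kernel R n s - 2 * cosine_kernel n.+1 s)); last first.
  by apply/funext => s; rewrite /cosine_kernel [in RHS]exprS; field.
rewrite IntB; last 2 first.
- by apply: continuous_mul.
- by apply: continuous_mul.
rewrite !IntZ// -/(cosine_mass R n) -/(cosine_mass R n.+1).
have n0 : n.+1%:R != 0 :> R by rewrite pnatr_eq0.
apply: (mulIf n0); rewrite divfK// mulrBl.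
have := cosine_mass_rec R n.
by rewrite -[n.*2.+2]/(n.+1.*2) -mul2n natrM -[(n.*2.+1)%:R]natr1 -mul2n natrM -natr1; lra.
Qed.

(** Smallness near 0 and boundedness away from 0 are merged into one majorant e + M (1 - cos s),
    whose integral against the kernel is known exactly. *)
Lemma cosine_kernel_approx (R : realType) (h : R -> R) (n : nat) (e M : R) : continuous h ->
  (forall s, `|s| <= pi -> `|h s| <= e + M * (1 - cos s)) ->
  `|Int (fun s => cosine_kernel n s * h s) (- pi) pi| <= cosine_mass R n * (e + M / n.+1%:R).
Proof.
move=> ch hM.
have cK := @cosine_kernel_continuous R n.
have p0 : - pi <= pi :> R by have := pi_gt0 R; lra.
have cc (c : R) : continuous (fun _ : R => c) by move=> x; exact: cst_continuous.
have c1 : continuous (fun s => @cosine_kernel R n s * (1 - cos s)).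
  apply: continuous_mul => // s; apply: continuousB; [exact: cc|exact: continuous_cos].
have c2 : continuous (fun s => e * @cosine_kernel R n s) by exact: continuous_mul.
have c3 : continuous (fun s => M * (@cosine_kernel R n s * (1 - cos s))) by exact: continuous_mul.
have c4 : continuous (fun s => cosine_kernel n s * h s) by exact: continuous_mul.
have c5 : continuous (fun s => e * @cosine_kernel R n s + M * (@cosine_kernel R n s * (1 - cos s))).
  exact: continuous_add.
have E : Int (fun s => e * @cosine_kernel R n s + M * (@cosine_kernel R n s * (1 - cos s))) (- pi) pi =
    cosine_mass R n * (e + M / n.+1%:R).
  by rewrite IntD// !IntZ// cosine_moment -/(cosine_mass R n); ring.
have bd s : - pi <= s <= pi -> `|cosine_kernel n s * h s| <=
    e * cosine_kernel n s + M * (cosine_kernel n s * (1 - cos s)).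
  move=> sp; rewrite normrM ger0_norm ?cosine_kernel_ge0//.
  rewrite [leRHS](_ : _ = cosine_kernel n s * (e + M * (1 - cos s))); last by ring.
  by rewrite ler_wpM2l ?cosine_kernel_ge0// hM// ler_norml.
rewrite -E ler_norml; apply/andP; split.
  rewrite -mulN1r -IntZ//; apply: le_Int => //; first exact: continuous_mul.
  by move=> s /bd; rewrite mulN1r ler_norml => /andP[].
by apply: le_Int => // s /bd; rewrite ler_norml => /andP[].
Qed.

Lemma one_minus_cos_ge (R : realType) (d s : R) : 0 < d -> d <= `|s| -> `|s| <= pi ->
  1 - cos d <= 1 - cos s.
Proof.
move=> d0 ds sp; rewrite lerD2l lerN2.
have -> : cos s = cos `|s| by have [?|?] := ger0P s => //; rewrite cosN.
have := ds; rewrite le_eqVlt => /predU1P[->//|ds'].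
by apply/ltW; rewrite ltr_cos ?in_itv/= ?normr_ge0 ?(ltW d0)//; apply: le_trans ds sp.
Qed.

Lemma one_minus_cos_gt0 (R : realType) (d : R) : 0 < d -> d <= pi -> 0 < 1 - cos d.
Proof.
move=> d0 dp; rewrite subr_gt0 -cos0 ltr_cos ?in_itv/= ?lexx ?(ltW d0)//.
by rewrite pi_ge0.
Qed.

Lemma Int_periodic (R : realType) (f : R -> R) (T a b : R) : continuous f ->
  (forall t, f (t + T) = f t) -> Int f a (a + T) = Int f b (b + T).
Proof.
move=> cf fT.
have E : Int f (b + T) (a + T) = Int f b a.
  have := Int_affine 1 T b a cf; rewrite !mul1r => <-.
  by congr Int; apply/funext => t; rewrite mul1r fT.
rewrite (Int_chasles f a b (a + T)) (Int_chasles f b (b + T) (a + T)) E.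
by rewrite addrC -addrA -Int_chasles /Int subrr addr0.
Qed.

Lemma Int_reflect (R : realType) (G : R -> R) (t : R) : continuous G ->
  (forall x, G (x + 2 * pi) = G x) ->
  Int (fun s => G (t - s)) (- pi) pi = Int G (- pi) pi.
Proof.
move=> cG GT.
have := Int_affine (-1) t (- pi) pi cG; rewrite mulN1r.
rewrite (_ : (fun s => G (-1 * s + t)) = (fun s => G (t - s))); last first.
  by apply/funext => s; congr G; ring.
rewrite (_ : -1 * - pi + t = t + pi); last by ring.
rewrite (_ : -1 * pi + t = t - pi); last by ring.
move=> /eqP; rewrite eqr_oppLR => /eqP ->.
have := Int_periodic (t - pi) (- pi) cG GT.
rewrite (_ : - pi + 2 * pi = pi); last by ring.
rewrite (_ : t - pi + 2 * pi = t + pi); last by ring.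
by move=> <-; rewrite /Int opprB.
Qed.

Definition cosine_jet (R : realType) (k : nat) (t : R) : R := cos (t + k%:R * (pi / 2)).

Lemma isjet_cosine (R : realType) : isjet (@cosine_jet R).
Proof.
move=> k; apply: is_deriv_ext (is_deriv_affine 1 (k%:R * (pi / 2)) (@is_deriv_cos R)) _ _ => t.
  by rewrite mul1r.
rewrite /cosine_jet -[k.+1%:R]natr1 !mul1r.
by rewrite (_ : t + (k%:R + 1) * (pi / 2) = t + k%:R * (pi / 2) + pi / 2) ?cosDpihalf//; ring.
Qed.

Lemma cosD2pi_natl (R : realType) (y : R) : cos (y + 2 * pi) = cos y.
Proof. by rewrite mulr_natl cosD2pi. Qed.

Lemma cos_sub_periods (R : realType) (y : R) (j : nat) : cos (y - (2 * pi) *+ j) = cos y.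
Proof.
elim: j y => [|j IH] y; first by rewrite mulr0n subr0.
by rewrite mulrS opprD addrA IH -[in RHS](subrK (2 * pi) y) cosD2pi_natl.
Qed.

Section fourier.
Variables (R : realType) (P : R -> R).
Hypotheses (cP : continuous P) (P2pi : forall t, P (t + 2 * pi) = P t).

Definition fourier_cos (j : nat) : R := Int (fun x => P x * cos (j%:R * x)) (- pi) pi.
Definition fourier_sin (j : nat) : R := Int (fun x => P x * sin (j%:R * x)) (- pi) pi.

Let ccos (j : nat) : continuous (fun s : R => cos (j%:R * s)).
Proof.
rewrite (_ : (fun s : R => _) = (fun s => cos (j%:R * s + 0))).
  exact: continuous_affine (@continuous_cos R).
by apply/funext => s; rewrite addr0.
Qed.

Let csin (j : nat) : continuous (fun s : R => sin (j%:R * s)).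
Proof.
rewrite (_ : (fun s : R => _) = (fun s => sin (j%:R * s + 0))).
  exact: continuous_affine (@continuous_sin R).
by apply/funext => s; rewrite addr0.
Qed.

Let ccst (c : R) : continuous (fun _ : R => c).
Proof. by move=> x; exact: cst_continuous. Qed.

Let cPt (t : R) : continuous (fun s => P (t - s)).
Proof.
rewrite (_ : (fun s => _) = (fun s => P (-1 * s + t))); first exact: continuous_affine.
by apply/funext => s; rewrite mulN1r addrC.
Qed.

Lemma convolution_cos (j : nat) (t : R) :
  Int (fun s => P (t - s) * cos (j%:R * s)) (- pi) pi =
  fourier_cos j * cos (j%:R * t) + fourier_sin j * sin (j%:R * t).
Proof.
pose G x := P x * cos (j%:R * (t - x)).
have cG : continuous G.
  apply: continuous_mul => //.
  rewrite (_ : (fun s : R => _) = (fun s => cos (- j%:R * s + j%:R * t))).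
    exact: continuous_cos_mul.
  by apply/funext => s; congr cos; ring.
have GT x : G (x + 2 * pi) = G x.
  rewrite /G P2pi; congr (_ * _).
  rewrite (_ : j%:R * (t - (x + 2 * pi)) = j%:R * (t - x) - (2 * pi) *+ j); last first.
    by rewrite -mulr_natl; ring.
  exact: cos_sub_periods.
have -> : Int (fun s => P (t - s) * cos (j%:R * s)) (- pi) pi = Int G (- pi) pi.
  by rewrite -(Int_reflect t cG GT); congr Int; apply/funext => s; rewrite /G subKr.
rewrite (_ : G = (fun x => cos (j%:R * t) * (P x * cos (j%:R * x)) + sin (j%:R * t) * (P x * sin (j%:R * x)))).
  rewrite IntD; last 2 first.
  - by apply: continuous_mul => //; exact: continuous_mul.
  - by apply: continuous_mul => //; exact: continuous_mul.
  by rewrite !IntZ; [rewrite mulrC [sin _ * _]mulrC|exact: continuous_mul|exact: continuous_mul].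
by apply/funext => x; rewrite /G mulrBr cosB; ring.
Qed.

Let translation_invariant (g : R -> R) : Prop := continuous g /\
  exists c, forall t, Int (fun s => P (t - s) * g s) (- pi) pi = c.

Let translation_invariantD (a b : R) (f g : R -> R) : translation_invariant f ->
  translation_invariant g -> translation_invariant (fun s => a * f s + b * g s).
Proof.
move=> [cf [x xP]] [cg [y yP]]; have caf := continuous_mul (@ccst a) cf.
have cbg := continuous_mul (@ccst b) cg; split; first exact: continuous_add.
exists (a * x + b * y) => t; rewrite -(xP t) -(yP t).
have c1 := continuous_mul (@cPt t) cf; have c2 := continuous_mul (@cPt t) cg.
rewrite -!IntZ// -IntD; last 2 first.
- exact: continuous_mul.
- exact: continuous_mul.
by congr Int; apply/funext => s; ring.
Qed.

Hypothesis P0 : forall j, (0 < j)%N -> fourier_cos j = 0 /\ fourier_sin j = 0.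

Let invariant_cos j : translation_invariant (fun s => cos (j%:R * s)).
Proof.
split=> //; case: j => [|j]; last first.
  exists 0 => t; have [c s] := P0 (ltn0Sn j).
  by rewrite convolution_cos c s !mul0r addr0.
exists (fourier_cos 0) => t; rewrite convolution_cos !mul0r cos0 sin0 mulr0 mulr1 addr0 //.
Qed.

(** The factor cos (j s) makes the induction on [n] possible: one more factor (1 + cos s) / 2 mixes
    the frequencies j - 1, j and j + 1. Frequency 0 is apart because j - 1 must be a natural
    number. *)
Let invariant_kernel n j : translation_invariant (fun s => cosine_kernel n s * cos (j%:R * s)).
Proof.
elim: n j => [|n IH] j.
  rewrite (_ : (fun s => _) = (fun s => cos (j%:R * s))); first exact: invariant_cos.
  by apply/funext => s; rewrite /cosine_kernel expr0 mul1r.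
case: j => [|j].
  rewrite (_ : (fun s => _) = (fun s => 1 / 2 * (cosine_kernel n s * cos (0%:R * s)) +
    1 / 2 * (cosine_kernel n s * cos (1%:R * s)))); first exact: translation_invariantD.
  by apply/funext => s; rewrite /cosine_kernel exprS mul0r cos0 !mul1r; field.
(* The middle frequency is repeated with coefficient 0 to fit three terms into binary
   combinations. *)
have h := translation_invariantD 1 1 (translation_invariantD (1/4) (1/4) (IH j) (IH j.+2))
  (translation_invariantD (1/2) 0 (IH j.+1) (IH j.+1)).
rewrite (_ : (fun s => _) = (fun s => 1 * (1 / 4 * (cosine_kernel n s * cos (j%:R * s)) +
    1 / 4 * (cosine_kernel n s * cos (j.+2%:R * s))) +
    1 * (1 / 2 * (cosine_kernel n s * cos (j.+1%:R * s)) +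
    0 * (cosine_kernel n s * cos (j.+1%:R * s))))) //.
apply/funext => s; rewrite /cosine_kernel exprS.
have -> : j%:R * s = j.+1%:R * s - s by rewrite -[j.+1%:R]natr1; ring.
have -> : j.+2%:R * s = j.+1%:R * s + s by rewrite -[j.+2%:R]natr1; ring.
by rewrite cosB cosD; field.
Qed.

(** Without nonconstant modes, the convolutions of [P] with the kernels do not depend on the point;
    after division by the mass they converge to [P]. *)
Lemma fourier_uniqueness (C : R) : (forall s t, `|P s - P t| <= C * `|s - t|) ->
  (forall t, `|P t| <= C) -> forall s t, P s = P t.
Proof.
move=> PL PC s0 t0.
have C0 : 0 <= C by exact: le_trans (PC 0).
have pp := pi_gt0 R.
have key (e : R) : 0 < e -> exists M : R, forall n t,
    `|cosine_mass R n * P t - Int (fun s => P (t - s) * (cosine_kernel n s * cos (0%:R * s))) (- pi) pi|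
       <= cosine_mass R n * (e + M / n.+1%:R).
  move=> e0; pose d := Num.min pi (e / (C + 1)).
  have d0 : 0 < d by rewrite lt_min pp divr_gt0// ltr_wpDl.
  have dp : d <= pi by rewrite ge_min lexx.
  have Cd : C * d <= e.
    apply: (@le_trans _ _ (C * (e / (C + 1)))); first by rewrite ler_wpM2l// ge_min lexx orbT.
    by rewrite mulrCA ler_piMr ?(ltW e0)// ler_pdivrMr ?ltr_wpDl// mul1r lerDl.
  have cd := one_minus_cos_gt0 d0 dp.
  exists (2 * C / (1 - cos d)) => n t.
  have cK := @cosine_kernel_continuous R n.
  have ch : continuous (fun s => P t - P (t - s)).
    by apply: (continuous_add (@ccst _)) => s; apply: cvgN; exact: cPt.
  rewrite (_ : _ - _ = Int (fun s => cosine_kernel n s * (P t - P (t - s))) (- pi) pi).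
    apply: cosine_kernel_approx => // s sp.
    have c1 : 0 <= 1 - cos s by rewrite subr_ge0 cos_le1.
    have [ds|sd] := leP d `|s|.
      apply: (@le_trans _ _ (2 * C)).
        by apply: le_trans (ler_normB _ _) _; have := PC t; have := PC (t - s); lra.
      have cd' : 1 - cos d != 0 by rewrite gt_eqF.
      rewrite -[leLHS](divfK cd') ler_wpDl ?(ltW e0)// ler_wpM2l ?divr_ge0 ?mulr_ge0 ?(ltW cd)//.
      exact: one_minus_cos_ge.
    apply: le_trans (PL _ _) _; rewrite subKr.
    apply: (@le_trans _ _ (C * d)); first by rewrite ler_wpM2l// ltW.
    by rewrite ler_wpDr// mulr_ge0// divr_ge0 ?mulr_ge0// ltW.
  rewrite /cosine_mass mulrC -IntZ// -IntB; last 2 first.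
  - exact: continuous_mul.
  - by apply: continuous_mul => //; exact: continuous_mul.
  by congr Int; apply/funext => s; rewrite mul0r cos0; ring.
apply/eqP; rewrite -subr_eq0 -normr_le0; apply/ler_addgt0Pr => e e0; rewrite add0r.
have e4 : 0 < e / 4 by rewrite divr_gt0.
have [M MP] := key _ e4.
have M0 : 0 < e / 4 / (`|M| + 1) by rewrite !divr_gt0// ltr_wpDl.
have [N _ HN] := near_infty_natSinv_lt (PosNum M0).
have := HN N (leqnn N); rewrite /= ltr_pdivlMr ?ltr_wpDl// => MN.
have MN' : M / N.+1%:R <= e / 4.
  apply: le_trans (ltW MN); rewrite mulrC ler_wpM2l ?invr_ge0//.
  by rewrite (le_trans (ler_norm M))// lerDl.
have [_ [c cE]] := invariant_kernel N 0.
have mN := cosine_mass_gt0 R N.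
have ee : e / 2 = e / 4 + e / 4 by field.
have H t : `|cosine_mass R N * P t - c| <= cosine_mass R N * (e / 2).
  by rewrite -(cE t); apply: le_trans (MP N t) _; rewrite ler_pM2l// ee lerD2l.
have : cosine_mass R N * `|P s0 - P t0| <= cosine_mass R N * e.
  rewrite -[X in X * _](gtr0_norm mN) -normrM mulrBr.
  rewrite (_ : _ - _ = (cosine_mass R N * P s0 - c) - (cosine_mass R N * P t0 - c)); last by ring.
  by apply: le_trans (ler_normB _ _) _; have := H s0; have := H t0; lra.
by rewrite ler_pM2l.
Qed.

End fourier.

(** Convolution with cos (j s) projects [P] onto its j-th mode, and the Riemann sums of the
    convolution are combinations of translates of [P]. *)
Lemma periodic_jet_cosine (R : realType) (m : nat) (phi P : nat -> R -> R) (B : nat -> R) :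
  isjet P -> approx1 m phi P -> (forall k t, `|P k t| <= B k) ->
  (forall t, P 0%N (t + 2 * pi) = P 0%N t) -> (exists s t, P 0%N s != P 0%N t) ->
  approx1 m phi (@cosine_jet R).
Proof.
move=> jP aP PB P2pi [s0 [t0 Pst]].
have cP := derivative_continuous (jP 0%N).
have [j j0 AB] : exists2 j, (0 < j)%N & fourier_cos (P 0%N) j ^+ 2 + fourier_sin (P 0%N) j ^+ 2 != 0.
  apply: contrapT => H; move/negP: Pst; apply; apply/eqP.
  apply: (@fourier_uniqueness R (P 0%N) cP P2pi _ (Num.max (B 0%N) (B 1%N))).
  - move=> j j0; have : fourier_cos (P 0%N) j ^+ 2 + fourier_sin (P 0%N) j ^+ 2 == 0.
      by apply/negPn/negP => AB; apply: H; exists j.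
    by rewrite paddr_eq0 ?sqr_ge0// !sqrf_eq0 => /andP[/eqP -> /eqP ->].
  - move=> s t; apply: le_trans (derivative_lipschitz t s (jP 0%N) (PB 1%N)) _.
    by rewrite ler_wpM2r// le_max lexx orbT.
  - by move=> t; rewrite le_max PB.
set A := fourier_cos _ _ in AB; set D := fourier_sin _ _ in AB.
pose h (n : nat) : R := (pi - - pi) / n.+1%:R.
pose sp (n i : nat) : R := - pi + i%:R * h n.
pose u (n k : nat) (t : R) := \sum_(i < n.+1) (h n * cos (j%:R * sp n i)) * 1 ^+ k * P k (1 * t + - sp n i).
have pp := pi_gt0 R.
have cPs t : continuous (fun s => P 0%N (t - s) * cos (j%:R * s)).
  apply: continuous_mul.
    rewrite (_ : (fun s => _) = (fun s => P 0%N (-1 * s + t))); first exact: continuous_affine.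
    by apply/funext => s; rewrite mulN1r addrC.
  rewrite (_ : (fun s : R => _) = (fun s => cos (j%:R * s + 0))).
    exact: continuous_cos_mul.
  by apply/funext => s; rewrite addr0.
have [||||v [jv v0 _ av _]] := @approx1_limit R m phi u (fun k => 2 * pi * B k)
    (fun t => A * cos (j%:R * t) + D * sin (j%:R * t)).
- by move=> n; exact: isjet_sum.
- move=> n k t.
  have -> : 2 * pi * B k = \sum_(i < n.+1) h n * B k.
    have n0 : n.+1%:R != 0 :> R by rewrite pnatr_eq0.
    rewrite sumr_const card_ord -[RHS]mulr_natr /h; move: n0.
    by set N := n.+1%:R => n0; field.
  apply: le_trans (ler_norm_sum _ _ _) _; apply: ler_sum => i _.
  have h0 : 0 <= h n by rewrite divr_ge0// opprK addr_ge0// ltW.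
  rewrite expr1n mulr1 -mulrA normrM (ger0_norm h0) ler_wpM2l// normrM.
  rewrite -[leRHS]mul1r ler_pM//.
  by rewrite ler_norml cos_le1 cos_geN1.
- by move=> n; exact: approx1_sum.
- move=> t; rewrite -(convolution_cos cP P2pi).
  have npp : - pi <= pi :> R by lra.
  have := riemann_cvg (cPs t) npp.
  rewrite (_ : (fun n => _) = (fun n => u n 0%N t))//.
  apply/funext => n; apply: eq_bigr => i _.
  by rewrite expr0 mulr1 mul1r -/(h n) -/(sp n i); ring.
have jn0 : j%:R != 0 :> R by rewrite pnatr_eq0 -lt0n.
set E := A ^+ 2 + D ^+ 2 in AB.
(* After rescaling, the mode is A cos t + D sin t and its quarter-period shift is D cos t - A sin t;
   the coefficients A / E and D / E cancel the sine and leave cos t. *)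
pose w k t := A / E * (j%:R^-1) ^+ k * v k (j%:R^-1 * t + 0) +
  D / E * (j%:R^-1) ^+ k * v k (j%:R^-1 * t + j%:R^-1 * (pi / 2)).
have aw : approx1 m phi w by apply: approx1_add; exact: approx1_affine.
have jw : isjet w by move=> k; apply: is_derivD; apply: isjet_affine jv k.
have w0 : w 0%N =1 @cosine_jet R 0.
  move=> t; rewrite /w !expr0 !mulr1 addr0 v0 -mulrDr !mulVKf// /cosine_jet mul0r addr0.
  by rewrite cosDpihalf sinDpihalf /E; field.
move=> W e wW e0; have [s ws] := aw W e wW e0.
by exists s => k t km; rewrite -(isjet_unique jw (@isjet_cosine R) w0)//; exact: ws.
Qed.

Lemma approx1_cosine (R : realType) (m : nat) (psi : R -> R) : Abinfty psi ->
  approx1 m (activation_jet psi) (@cosine_jet R).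
Proof.
move=> /(integrable_kernel m)[F [jF aF [C FC] F0]].
have [P [jP aP [B PB] P2pi Pst]] := periodic_element jF aF FC F0.
exact: periodic_jet_cosine PB P2pi Pst.
Qed.

(** * Partial derivatives *)

Section partial_derivatives.
Variables (R : realType) (d : nat).
Notation X := 'cV[R]_d.
Implicit Types (f g : X -> R) (x : X) (i : 'I_d).

Definition pd i f : X -> R := fun x => 'D_(delta_mx i 0) f x.

Fixpoint Cs (m : nat) f : Prop :=
  continuous f /\
  if m is k.+1 then forall i, (forall x, derivable f x (delta_mx i 0)) /\ Cs k (pd i f)
  else True.

(* Bounds the iterated partial derivatives of order at most m at x whose innermost
   differentiation has index < k and whose indices decrease outwards: this is the order
   in which mpartial differentiates. *)
Fixpoint jet_bound (m k : nat) f x (B : R) : Prop :=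
  `|f x| <= B /\
  if m is l.+1 then forall i, (i < k)%N -> jet_bound l i.+1 (pd i f) x B else True.

Lemma is_derive_line (x v : X) f (l : R) :
  is_derive (0 : R) (1 : R) (fun h : R => f (h *: v + x)) l -> is_derive x v f l.
Proof.
move=> [df dl]; apply: DeriveDef; first exact/derivable1P.
rewrite -dl /derive; set g1 := fun h => h^-1 *: _; set g2 := fun h => h^-1 *: _.
suff -> : g1 = g2 by [].
by apply/funext => h; rewrite /g1 /g2 /= addr0 scale0r add0r [_ *: 1]mulr1.
Qed.

Lemma line_is_derive (x v : X) f (l : R) :
  is_derive x v f l -> is_derive (0 : R) (1 : R) (fun h : R => f (h *: v + x)) l.
Proof.
move=> [df dl]; apply: DeriveDef; first exact: (iffLR (derivable1P f x v)).
rewrite -dl /derive; set g1 := fun h => h^-1 *: _; set g2 := fun h => h^-1 *: _.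
suff -> : g1 = g2 by [].
by apply/funext => h; rewrite /g1 /g2 /= addr0 scale0r add0r [_ *: 1]mulr1.
Qed.

Lemma pd_is_derive i f (f' : X -> R) : (forall x, is_derive x (delta_mx i 0) f (f' x)) ->
  (forall x, derivable f x (delta_mx i 0)) /\ pd i f = f'.
Proof.
move=> df; split=> [x|]; first exact: ex_derive.
by apply/funext => x; exact: derive_val.
Qed.

Lemma CsS m f : Cs m.+1 f -> Cs m f.
Proof.
elim: m f => [|m IH] f [cf H]; first by split.
by split=> // i; have [df Hf] := H i; split => //; exact: IH.
Qed.

Lemma Cs_le m n f : (m <= n)%N -> Cs n f -> Cs m f.
Proof.
elim: n m => [|n IH] m; first by rewrite leqn0 => /eqP ->.
by rewrite leq_eqVlt => /predU1P[->//|mn] /CsS; exact: IH.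
Qed.

Lemma Cs_continuous m f : Cs m f -> continuous f.
Proof. by case: m => [|m] []. Qed.

Lemma pd_cst i (c : R) : (forall x, derivable (fun _ : X => c) x (delta_mx i 0)) /\
  pd i (fun=> c) = fun=> 0.
Proof. by apply: pd_is_derive => x; exact: is_derive_cst. Qed.

Lemma pdD i f g : (forall x, derivable f x (delta_mx i 0)) ->
  (forall x, derivable g x (delta_mx i 0)) ->
  (forall x, derivable (fun x => f x + g x) x (delta_mx i 0)) /\
  pd i (fun x => f x + g x) = fun x => pd i f x + pd i g x.
Proof.
move=> df dg; apply: pd_is_derive => x.
by apply: (@is_deriveD _ _ _ f g); exact/derivableP.
Qed.

Lemma pdM i f g : (forall x, derivable f x (delta_mx i 0)) ->
  (forall x, derivable g x (delta_mx i 0)) ->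
  (forall x, derivable (fun x => f x * g x) x (delta_mx i 0)) /\
  pd i (fun x => f x * g x) = fun x => f x * pd i g x + g x * pd i f x.
Proof.
move=> df dg; apply: pd_is_derive => x.
by apply: (@is_deriveM _ _ f g); exact/derivableP.
Qed.

Lemma pdZ i (c : R) f : (forall x, derivable f x (delta_mx i 0)) ->
  (forall x, derivable (fun x => c * f x) x (delta_mx i 0)) /\
  pd i (fun x => c * f x) = fun x => c * pd i f x.
Proof.
move=> df; apply: pd_is_derive => x.
by apply: (@is_deriveZ _ _ _ f c); exact/derivableP.
Qed.

Lemma pd_comp i (phi phi' : R -> R) f : is_deriv phi phi' ->
  (forall x, derivable f x (delta_mx i 0)) ->
  (forall x, derivable (fun x => phi (f x)) x (delta_mx i 0)) /\
  pd i (fun x => phi (f x)) = fun x => phi' (f x) * pd i f x.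
Proof.
move=> dphi df; apply: pd_is_derive => x.
apply: is_derive_line.
have := dphi (f (0 *: delta_mx i 0 + x)); rewrite scale0r add0r => dphix.
have E : f x = (fun h : R => f (h *: delta_mx i 0 + x)) 0 by rewrite scale0r add0r.
apply: (@is_derive1_comp _ phi (fun h : R => f (h *: delta_mx i 0 + x)) 0).
  by rewrite -E.
by apply: line_is_derive; exact/derivableP.
Qed.

Lemma pd_dilation i (c : R) f : (forall x, derivable f x (delta_mx i 0)) ->
  (forall x, derivable (fun x => f (c *: x)) x (delta_mx i 0)) /\
  pd i (fun x => f (c *: x)) = fun x => c * pd i f (c *: x).
Proof.
move=> df; apply: pd_is_derive => x.
apply: is_derive_line.
pose g (h : R) := f (h *: delta_mx i 0 + c *: x).
have dg : is_derive (0 : R) (1 : R) g (pd i f (c *: x)).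
  by apply: line_is_derive; exact/derivableP.
have dl : is_derive (0 : R) (1 : R) (fun h => c * h) c.
  have := is_derivZ c (@is_deriv_id R) 0; by rewrite mulr1.
rewrite (_ : (fun h => _) = g \o (fun h => c * h)).
  rewrite mulrC; apply: is_derive1_comp.
  by rewrite mulr0.
by apply/funext => h; rewrite /g /= scalerDr scalerA.
Qed.

Lemma pd_translation i (v : X) f : (forall x, derivable f x (delta_mx i 0)) ->
  (forall x, derivable (fun x => f (x + v)) x (delta_mx i 0)) /\
  pd i (fun x => f (x + v)) = fun x => pd i f (x + v).
Proof.
move=> df; apply: pd_is_derive => x.
apply: is_derive_line.
rewrite (_ : (fun h => _) = fun h => f (h *: delta_mx i 0 + (x + v))).
  by apply: line_is_derive; exact/derivableP.
by apply/funext => h; rewrite addrA.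
Qed.

Lemma Cs_cst m (c : R) : Cs m (fun=> c).
Proof.
elim: m c => [|m IH] c; split=> //; try (by move=> x; exact: cst_continuous).
by move=> i; have [dc ->] := pd_cst i c; split.
Qed.

Lemma Cs_add m f g : Cs m f -> Cs m g -> Cs m (fun x => f x + g x).
Proof.
elim: m f g => [|m IH] f g [cf Hf] [cg Hg]; split=> //;
  try exact: continuous_add.
move=> i; have [df Cf] := Hf i; have [dg Cg] := Hg i.
by have [dfg ->] := pdD df dg; split=> //; exact: IH.
Qed.

Lemma Cs_mul m f g : Cs m f -> Cs m g -> Cs m (fun x => f x * g x).
Proof.
elim: m f g => [|m IH] f g Cf Cg; split=> //;
  try exact: continuous_mul (Cs_continuous Cf) (Cs_continuous Cg).
move=> i; have [df Cdf] := Cf.2 i; have [dg Cdg] := Cg.2 i.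
have [dfg ->] := pdM df dg; split=> //; apply: Cs_add; apply: IH => //; exact: CsS.
Qed.

Lemma Cs_scale m (c : R) f : Cs m f -> Cs m (fun x => c * f x).
Proof. by move=> Cf; apply: Cs_mul => //; exact: Cs_cst. Qed.

Lemma Cs_sub m f g : Cs m f -> Cs m g -> Cs m (fun x => f x - g x).
Proof.
move=> Cf Cg; rewrite (_ : (fun x => _) = fun x => f x + -1 * g x).
  by apply: Cs_add => //; exact: Cs_scale.
by apply/funext => x; rewrite mulN1r.
Qed.

Lemma Cs_sum m (I : Type) (s : seq I) (F : I -> X -> R) : (forall j, Cs m (F j)) ->
  Cs m (fun x => \sum_(j <- s) F j x).
Proof.
move=> CF; elim: s => [|j s IH].
  rewrite (_ : (fun x => _) = fun=> 0); first exact: Cs_cst.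
  by apply/funext => x; rewrite big_nil.
rewrite (_ : (fun x => _) = fun x => F j x + \sum_(j <- s) F j x); first exact: Cs_add.
by apply/funext => x; rewrite big_cons.
Qed.

Lemma Cs_comp m (phi : nat -> R -> R) f k : isjet phi -> Cs m f -> Cs m (fun x => phi k (f x)).
Proof.
move=> jphi; elim: m f k => [|m IH] f k Cf; split=> //;
  try (by move=> x; apply: continuous_comp;
    [exact: (Cs_continuous Cf)|exact: (derivative_continuous (jphi k))]).
move=> i; have [df Cdf] := Cf.2 i.
have [dp ->] := pd_comp (jphi k) df; split=> //; apply: Cs_mul => //.
by apply: IH; exact: CsS.
Qed.

Lemma Cs_dilation m (c : R) f : Cs m f -> Cs m (fun x => f (c *: x)).
Proof.
elim: m f => [|m IH] f Cf; split=> //; try (by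
  move=> x; apply: continuous_comp; [exact: scaler_continuous|exact: (Cs_continuous Cf)]).
move=> i; have [df Cdf] := Cf.2 i.
by have [dp ->] := pd_dilation c df; split=> //; apply: Cs_scale; exact: IH.
Qed.

End partial_derivatives.

Section jet_bounds.
Variables (R : realType) (d : nat).
Notation X := 'cV[R]_d.
Implicit Types (f g : X -> R) (x : X) (i : 'I_d) (A B : R).

Lemma jet_bound_norm m k f x B : jet_bound m k f x B -> `|f x| <= B.
Proof. by case: m => [|m] []. Qed.

Lemma jet_bound_ge0 m k f x B : jet_bound m k f x B -> 0 <= B.
Proof. by move/jet_bound_norm; apply: le_trans. Qed.

Lemma jet_bound_le m n k l f x A B : (m <= n)%N -> (k <= l)%N -> A <= B ->
  jet_bound n l f x A -> jet_bound m k f x B.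
Proof.
elim: n m k l f => [|n IH] [|m] k l f //= mn kl AB [fA H]; split=> //;
  try exact: le_trans AB.
by move=> i ik; apply: (IH m i.+1 i.+1) => //; apply: H; exact: leq_trans kl.
Qed.

Lemma jet_bound0 m k x B : 0 <= B -> jet_bound m k (fun=> 0) x B.
Proof.
elim: m k => [|m IH] k B0; split; rewrite ?normr0//.
by move=> i _; rewrite (pd_cst i 0).2; exact: IH.
Qed.

Lemma jet_bound_cst m k (c : R) x B : `|c| <= B -> jet_bound m k (fun=> c) x B.
Proof.
case: m => [|m] cB; split=> // i _; rewrite (pd_cst i c).2.
by apply: jet_bound0; exact: le_trans cB.
Qed.

Lemma jet_bound_add m k f g x A B : Cs m f -> Cs m g ->
  jet_bound m k f x A -> jet_bound m k g x B -> jet_bound m k (fun x => f x + g x) x (A + B).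
Proof.
elim: m k f g => [|m IH] k f g Cf Cg [fA Hf] [gB Hg]; split=> //;
  try exact: le_trans (ler_normD _ _) (lerD _ _).
move=> i ik; have [df Cdf] := Cf.2 i; have [dg Cdg] := Cg.2 i.
by rewrite (pdD df dg).2; apply: IH => //; [exact: Hf|exact: Hg].
Qed.

(** Each differentiation splits a product into two products, whence 2^m. *)
Lemma jet_bound_mul m k f g x A B : Cs m f -> Cs m g ->
  jet_bound m k f x A -> jet_bound m k g x B ->
  jet_bound m k (fun x => f x * g x) x (2 ^+ m * (A * B)).
Proof.
elim: m k f g A B => [|m IH] k f g A B Cf Cg jf jg.
  split=> //; rewrite expr0 mul1r normrM.
  by apply: ler_pM; rewrite ?(jet_bound_norm jf) ?(jet_bound_norm jg).
have A0 := jet_bound_ge0 jf; have B0 := jet_bound_ge0 jg.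
split.
  rewrite normrM; apply: (@le_trans _ _ (A * B)).
    by apply: ler_pM; rewrite ?(jet_bound_norm jf) ?(jet_bound_norm jg).
  by rewrite ler_peMl ?mulr_ge0// exprn_ege1// ler1n.
move=> i ik; have [df Cdf] := Cf.2 i; have [dg Cdg] := Cg.2 i.
rewrite (pdM df dg).2 exprS -mulrA mulr_natl mulr2n.
apply: jet_bound_add; try by apply: Cs_mul => //; exact: CsS.
  apply: IH => //; [exact: CsS| |exact: jg.2].
  by apply: jet_bound_le jf => //.
have jg' : jet_bound m i.+1 g x B by exact: jet_bound_le jg.
have := IH i.+1 g (pd i f) B A (CsS Cg) Cdf jg' (jf.2 i ik).
by rewrite (mulrC B A).
Qed.

Lemma jet_bound_scale m k (c : R) f x A : Cs m f -> jet_bound m k f x A ->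
  jet_bound m k (fun x => c * f x) x (`|c| * A).
Proof.
elim: m k f => [|m IH] k f Cf [fA Hf]; split; rewrite ?normrM ?ler_wpM2l//.
move=> i ik; have [df Cdf] := Cf.2 i.
by rewrite (pdZ c df).2; apply: IH => //; exact: Hf.
Qed.

Lemma jet_bound_sub m k f g x A B : Cs m f -> Cs m g ->
  jet_bound m k f x A -> jet_bound m k g x B -> jet_bound m k (fun x => f x - g x) x (A + B).
Proof.
move=> Cf Cg jf jg; rewrite (_ : (fun x => _) = fun x => f x + -1 * g x); last first.
  by apply/funext => y; rewrite mulN1r.
apply: jet_bound_add => //; first exact: Cs_scale.
by have := jet_bound_scale (-1) Cg jg; rewrite normrN1 mul1r.
Qed.

Lemma jet_bound_dilation m k (c : R) f x A : Cs m f -> `|c| <= 1 ->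
  jet_bound m k f (c *: x) A -> jet_bound m k (fun x => f (c *: x)) x A.
Proof.
move=> Cf c1; elim: m k f Cf => [|m IH] k f Cf [fA Hf]; split=> //.
move=> i ik; have [df Cdf] := Cf.2 i.
rewrite (pd_dilation c df).2.
have jd := IH i.+1 (pd i f) Cdf (Hf i ik).
have := jet_bound_scale c (Cs_dilation c Cdf) jd.
by apply: jet_bound_le => //; rewrite ler_piMl// (jet_bound_ge0 jd).
Qed.

Lemma jet_bound_translation m k (v : X) f x A : Cs m f ->
  jet_bound m k f (x + v) A -> jet_bound m k (fun x => f (x + v)) x A.
Proof.
elim: m k f => [|m IH] k f Cf [fA Hf]; split=> //.
move=> i ik; have [df Cdf] := Cf.2 i.
by rewrite (pd_translation v df).2; apply: IH => //; exact: Hf.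
Qed.

(** Each use of the chain rule brings out a derivative of [f], bounded by [H], and a product, which
    costs at most 2^m. *)
Lemma jet_bound_comp m k (phi : nat -> R -> R) f x (H B : R) : isjet phi -> Cs m f ->
  1 <= H -> jet_bound m k f x H -> (forall j, (j <= m)%N -> `|phi j (f x)| <= B) ->
  jet_bound m k (fun x => phi 0%N (f x)) x ((2 ^+ m * H) ^+ m * B).
Proof.
elim: m k phi => [|m IH] k phi jphi Cf H1 jf phiB.
  by split=> //; rewrite expr0 mul1r phiB.
have H0 : 0 <= H by exact: le_trans H1.
have B0 : 0 <= B by exact: le_trans (phiB 0%N _).
have K1 n : 1 <= 2 ^+ n * H by rewrite mulr_ege1// exprn_ege1// ler1n.
split; first by rewrite (le_trans (phiB 0%N _))// ler_peMl// exprn_ege1.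
move=> i ik; have [df Cdf] := Cf.2 i.
rewrite (pd_comp (jphi 0%N) df).2.
have jphi' : isjet (fun j => phi j.+1) by move=> j; exact: jphi.
have jf' : jet_bound m i.+1 f x H by exact: jet_bound_le jf.
have j1 := IH i.+1 (fun j => phi j.+1) jphi' (CsS Cf) H1 jf' (fun j jm => phiB j.+1 jm).
have j2 : jet_bound m i.+1 (pd i f) x H by exact: jf.2.
have := jet_bound_mul (Cs_comp 1 jphi (CsS Cf)) Cdf j1 j2.
apply: jet_bound_le => //.
rewrite exprS (_ : 2 ^+ m * (_ * _ * _) = (2 ^+ m * H) * (2 ^+ m * H) ^+ m * B); last by ring.
rewrite ler_wpM2r// ler_pM ?exprn_ge0 ?mulr_ge0 ?exprn_ge0//.
  by rewrite ler_wpM2r// exprS ler_peMl ?exprn_ge0// ler1n.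
rewrite lerXn2r ?nnegrE ?mulr_ge0 ?exprn_ge0//.
by rewrite ler_wpM2r// exprS ler_peMl ?exprn_ge0// ler1n.
Qed.

(** [K] comes before [f], [g] and [H], and the dependence on [H] is an explicit power: in
    [netapprox_comp], [H] grows with [x] and this power has to be absorbed by a weight. *)
Lemma jet_bound_comp_sub m (phi : nat -> R -> R) (C : R) : isjet phi ->
  (forall j t, (j <= m.+1)%N -> (0 < j)%N -> `|phi j t| <= C) ->
  exists2 K, 0 <= K & forall k f g x (H e : R), Cs m f -> Cs m g -> 1 <= H ->
    jet_bound m k f x H -> jet_bound m k g x H ->
    jet_bound m k (fun x => f x - g x) x e ->
    jet_bound m k (fun x => phi 0%N (f x) - phi 0%N (g x)) x (K * H ^+ m * e).
Proof.
elim: m phi => [|m IH] phi jphi phiC.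
  have C0 : 0 <= C by exact: le_trans (phiC 1%N 0 _ _).
  exists C => // k f g x H e Cf Cg H1 jf jg [fge _]; split=> //.
  rewrite expr0 mulr1.
  apply: le_trans (derivative_lipschitz _ _ (jphi 0%N) (fun t => phiC 1%N t isT isT)) _.
  exact: ler_wpM2l.
have C0 : 0 <= C by exact: le_trans (phiC 1%N 0 _ _).
have jphi' : isjet (fun j => phi j.+1) by move=> j; exact: jphi.
have [|K K0 HK] := IH (fun j => phi j.+1) jphi'.
  by move=> j t jm _; exact: phiC.
pose L := (2 ^+ m) ^+ m * C.
have L0 : 0 <= L by rewrite mulr_ge0// exprn_ge0// exprn_ge0.
exists (2 ^+ m * (K + L) + C).
  by rewrite addr_ge0// mulr_ge0 ?exprn_ge0// addr_ge0.
move=> k f g x H e Cf Cg H1 jf jg jfg.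
have H0 : 0 <= H by exact: le_trans H1.
have e0 := jet_bound_ge0 jfg.
have Hm n : 1 <= H ^+ n by exact: exprn_ege1.
have KL0 : 0 <= 2 ^+ m * (K + L) by rewrite mulr_ge0 ?exprn_ge0// addr_ge0.
split.
  apply: le_trans (derivative_lipschitz _ _ (jphi 0%N) (fun t => phiC 1%N t isT isT)) _.
  apply: ler_pM => //; last exact: jet_bound_norm jfg.
  apply: (@le_trans _ _ (2 ^+ m * (K + L) + C)); first by rewrite lerDr.
  by rewrite ler_peMr// addr_ge0.
move=> i ik; have [df Cdf] := Cf.2 i; have [dg Cdg] := Cg.2 i.
have Cpf := Cs_comp 1 jphi (CsS Cf); have Cpg := Cs_comp 1 jphi (CsS Cg).
have [dpf pf] := pd_comp (jphi 0%N) df; have [dpg pg] := pd_comp (jphi 0%N) dg.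
have subE (u v : X -> R) : (fun x => u x - v x) = (fun x => u x + -1 * v x).
  by apply/funext => y; rewrite mulN1r.
have [dnpg npg] := pdZ (-1) dpg.
rewrite subE (pdD dpf dnpg).2 npg pf pg.
(* The first summand falls under the induction hypothesis for phi', the second under
   [jet_bound_comp]. *)
rewrite (_ : (fun x => _) = (fun x => (phi 1%N (f x) - phi 1%N (g x)) * pd i f x +
   phi 1%N (g x) * (pd i f x - pd i g x))); last by apply/funext => y; ring.
have jf' : jet_bound m i.+1 f x H by exact: jet_bound_le jf.
have jg' : jet_bound m i.+1 g x H by exact: jet_bound_le jg.
have jfg' : jet_bound m i.+1 (fun x => f x - g x) x e by exact: jet_bound_le jfg.
have j1 := HK i.+1 f g x H e (CsS Cf) (CsS Cg) H1 jf' jg' jfg'.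
have j2 : jet_bound m i.+1 (pd i f) x H by exact: jf.2.
have j3 : jet_bound m i.+1 (fun x => pd i f x - pd i g x) x e.
  have := jfg.2 i ik; have [dng ng] := pdZ (-1) dg.
  by rewrite subE (pdD df dng).2 ng -subE.
have j4 := jet_bound_comp jphi' (CsS Cg) H1 jg' (fun j jm => phiC j.+1 _ (leqW jm) isT).
have Csub := Cs_sub Cpf Cpg; have Csub' := Cs_sub Cdf Cdg.
have := jet_bound_add (Cs_mul Csub Cdf) (Cs_mul Cpg Csub')
  (jet_bound_mul Csub Cdf j1 j2) (jet_bound_mul Cpg Csub' j4 j3).
apply: jet_bound_le => //.
rewrite exprMn (_ : _ + _ = 2 ^+ m * (K * H ^+ m.+1 + L * H ^+ m) * e); last by rewrite /L exprS; ring.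
rewrite ler_wpM2r//.
apply: (@le_trans _ _ (2 ^+ m * (K * H ^+ m.+1 + L * H ^+ m.+1))).
  by rewrite ler_wpM2l ?exprn_ge0// lerD2l ler_wpM2l// exprS ler_peMl// exprn_ge0.
rewrite [leRHS](_ : _ = 2 ^+ m * (K * H ^+ m.+1 + L * H ^+ m.+1) + C * H ^+ m.+1); last by ring.
by rewrite lerDl mulr_ge0// exprn_ge0.
Qed.

End jet_bounds.

(** * Networks of several variables *)

Section networks.
Variables (R : realType) (d : nat).
Notation X := 'cV[R]_d.
Implicit Types (f g h : X -> R) (x : X) (a : 'rV[R]_d) (b : R).

Definition linear_form (a : 'rV[R]_d) (b : R) x : R := (a *m x) 0 0 + b.

Lemma linear_formE a b x : linear_form a b x = \sum_i a 0 i * x i 0 + b.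
Proof. by rewrite /linear_form mxE. Qed.

Lemma coord_le_norm x i : `|x i 0| <= `|x|.
Proof. by rewrite [leRHS]/Num.Def.normr/= mx_normrE; exact: (le_bigmax _ _ (i, 0)). Qed.

Lemma linear_form_le a b x : `|linear_form a b x| <= (\sum_i `|a 0 i|) * `|x| + `|b|.
Proof.
rewrite linear_formE (le_trans (ler_normD _ _))// lerD2r.
rewrite (le_trans (ler_norm_sum _ _ _))// big_distrl/=; apply: ler_sum => i _.
by rewrite normrM ler_wpM2l// coord_le_norm.
Qed.

Lemma pd_linear_form a b (i : 'I_d) :
  (forall x, derivable (linear_form a b) x (delta_mx i 0)) /\ pd i (linear_form a b) = fun=> a 0 i.
Proof.
apply: pd_is_derive => x; apply: is_derive_line.
have := is_deriv_affine (a 0 i) (linear_form a b x) (@is_deriv_id R) 0; rewrite mulr1.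
rewrite (_ : (fun t => _ + _) = (fun t : R => linear_form a b (t *: delta_mx i 0 + x)))//.
apply/funext => t; rewrite /linear_form mulmxDr -scalemxAr !mxE addrA; congr (_ + _ + _).
  rewrite mulrC; congr (_ * _); rewrite (bigD1 i)//= big1 ?addr0 => [|k ki].
    by rewrite mxE !eqxx mulr1.
  by rewrite mxE (negPf ki) mulr0.
Qed.

Lemma linear_form_continuous a b : continuous (linear_form a b).
Proof.
rewrite (_ : linear_form a b = (fun x => \sum_i a 0 i * x i 0 + b)); last first.
  by apply/funext => x; rewrite linear_formE.
apply: continuous_add; last by move=> x; exact: cst_continuous.
elim: (index_enum _) => [|i s IH].
  rewrite (_ : (fun x => _) = fun=> 0); first by move=> x; exact: cst_continuous.
  by apply/funext => x; rewrite big_nil.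
rewrite (_ : (fun x => _) = (fun x : X => a 0 i * x i 0 + \sum_(j <- s) a 0 j * x j 0)); last first.
  by apply/funext => x; rewrite big_cons.
apply: continuous_add => //; apply: continuous_mul; first by move=> x; exact: cst_continuous.
by move=> x; exact: coord_continuous.
Qed.

Lemma Cs_linear_form m a b : Cs m (linear_form a b).
Proof.
case: m => [|m]; split => //; try exact: linear_form_continuous.
by move=> i; have [df ->] := pd_linear_form a b i; split => //; exact: Cs_cst.
Qed.

Lemma jet_bound_ridge m k j (u : nat -> R -> R) a b x (A B : R) : isjet u ->
  1 <= A -> (forall i, `|a 0 i| <= A) ->
  (forall l, (l <= j + m)%N -> `|u l (linear_form a b x)| <= B) ->
  jet_bound m k (fun x => u j (linear_form a b x)) x (A ^+ m * B).
Proof.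
move=> ju A1 aA; elim: m k j => [|m IH] k j uB.
  by split=> //; rewrite expr0 mul1r uB// addn0.
have B0 : 0 <= B by exact: le_trans (uB j (leq_addr _ _)).
have A0 : 0 <= A by exact: le_trans A1.
split; first by rewrite (le_trans (uB j (leq_addr _ _)))// ler_peMl// exprn_ege1.
move=> i ik; have [dl pl] := pd_linear_form a b i.
rewrite (pd_comp (ju j) dl).2 pl.
rewrite (_ : (fun x => _) = (fun x => a 0 i * u j.+1 (linear_form a b x))); last first.
  by apply/funext => y; rewrite mulrC.
have jb : jet_bound m i.+1 (fun x => u j.+1 (linear_form a b x)) x (A ^+ m * B).
  by apply: IH => l lj; apply: uB; rewrite addnS -addSn.
have := jet_bound_scale (a 0 i) (Cs_comp j.+1 ju (Cs_linear_form m a b)) jb.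
by apply: jet_bound_le => //; rewrite exprS -mulrA ler_wpM2r// mulr_ge0// exprn_ge0.
Qed.

(* netfun psi j consists of the scalar functions affine in the outputs of a layer that is
   preceded by j - 1 other hidden layers; j = 0 means affine in the input. *)
Inductive netfun (psi : R -> R) : nat -> (X -> R) -> Prop :=
| netfun_affine a b : netfun psi 0 (linear_form a b)
| netfun_cst j c : netfun psi j.+1 (fun=> c)
| netfun_neuron j c h f : netfun psi j h -> netfun psi j.+1 f ->
    netfun psi j.+1 (fun x => c * psi (h x) + f x).

Lemma Cs_netfun psi m j f : Cinfty psi -> netfun psi j f -> Cs m f.
Proof.
move=> /isjet_activation jpsi; elim => [a b|k c|k c h g _ Ch _ Cg].
- exact: Cs_linear_form.
- exact: Cs_cst.
- by apply: Cs_add => //; apply: Cs_scale; apply: (Cs_comp 0 jpsi).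
Qed.

Lemma netfun_scale psi j c f : netfun psi j f -> netfun psi j (fun x => c * f x).
Proof.
elim => [a b|k b|k b h g hh _ _ hg].
- rewrite (_ : (fun x => _) = linear_form (c *: a) (c * b)); first exact: netfun_affine.
  by apply/funext => x; rewrite /linear_form -scalemxAl [in RHS]mxE mulrDr.
- exact: netfun_cst.
- rewrite (_ : (fun x => _) = (fun x => c * b * psi (h x) + c * g x)); first exact: netfun_neuron.
  by apply/funext => x; rewrite mulrDr mulrA.
Qed.

Lemma netfun0_inv psi j f : netfun psi j f -> j = 0%N -> exists a b, f = linear_form a b.
Proof. by case=> [a b|//|//] _; exists a, b. Qed.

Lemma netfun_addc psi j c f : netfun psi j f -> netfun psi j (fun x => c + f x).
Proof.
elim => [a b|k b|k b h g hh _ _ hg].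
- rewrite (_ : (fun x => _) = linear_form a (c + b)); first exact: netfun_affine.
  by apply/funext => x; rewrite /linear_form addrCA.
- exact: netfun_cst.
- rewrite (_ : (fun x => _) = (fun x => b * psi (h x) + (c + g x))); first exact: netfun_neuron.
  by apply/funext => x; rewrite addrCA.
Qed.

Lemma netfun_add psi j f g : netfun psi j f -> netfun psi j g -> netfun psi j (fun x => f x + g x).
Proof.
move=> hf; elim: hf g => [a b|k c|k c h f' hh _ _ IH] g hg.
- have [a' [b' ->]] := netfun0_inv hg erefl.
  rewrite (_ : (fun x => _) = linear_form (a + a') (b + b')); first exact: netfun_affine.
  by apply/funext => x; rewrite /linear_form mulmxDl [in RHS]mxE addrACA.
- exact: netfun_addc.
- rewrite (_ : (fun x => _) = (fun x => c * psi (h x) + (f' x + g x))).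
    by apply: netfun_neuron => //; exact: IH.
  by apply/funext => x; rewrite addrA.
Qed.

Definition netapprox psi m j f : Prop := Cs m f /\
  forall (W : R -> R) (e : R), weight W -> 0 < e ->
  exists2 h, netfun psi j h & forall x, jet_bound m d (fun x => f x - h x) x (e * W `|x|).

Lemma jet_bound_sub_trans m k f g h x (A B : R) : Cs m f -> Cs m g -> Cs m h ->
  jet_bound m k (fun x => f x - g x) x A -> jet_bound m k (fun x => g x - h x) x B ->
  jet_bound m k (fun x => f x - h x) x (A + B).
Proof.
move=> Cf Cg Ch j1 j2; rewrite (_ : (fun x => _) = fun x => (f x - g x) + (g x - h x)).
  by apply: jet_bound_add => //; exact: Cs_sub.
by apply/funext => y; rewrite subrKA.
Qed.

Lemma netapprox_closed psi m j f : Cinfty psi -> Cs m f ->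
  (forall (W : R -> R) (e : R), weight W -> 0 < e -> exists2 g, netapprox psi m j g &
    forall x, jet_bound m d (fun x => f x - g x) x (e * W `|x|)) -> netapprox psi m j f.
Proof.
move=> cpsi Cf H; split=> // W e wW e0; have e2 : 0 < e / 2 by rewrite divr_gt0.
have [g [Cg gP] fg] := H W _ wW e2; have [h hh gh] := gP W _ wW e2.
exists h => // x.
have -> : e * W `|x| = e / 2 * W `|x| + e / 2 * W `|x| by field.
exact: jet_bound_sub_trans (Cs_netfun m cpsi hh) (fg x) (gh x).
Qed.

Lemma netapprox_netfun psi m j f : Cinfty psi -> netfun psi j f -> netapprox psi m j f.
Proof.
move=> cpsi hf; split; first exact: Cs_netfun hf.
move=> W e [W1 _ _] e0; exists f => // x.
rewrite (_ : (fun x => _) = fun=> 0); last by apply/funext => y; rewrite subrr.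
by apply: jet_bound0; rewrite mulr_ge0 ?(ltW e0)// (le_trans _ (W1 _)).
Qed.

Lemma netapprox_add psi m j f g : Cinfty psi -> netapprox psi m j f -> netapprox psi m j g ->
  netapprox psi m j (fun x => f x + g x).
Proof.
move=> cpsi [Cf fP] [Cg gP]; split; first exact: Cs_add.
move=> W e wW e0; have e2 : 0 < e / 2 by rewrite divr_gt0.
have [h hh fh] := fP W _ wW e2; have [k hk gk] := gP W _ wW e2.
exists (fun x => h x + k x); first exact: netfun_add.
move=> x; have -> : e * W `|x| = e / 2 * W `|x| + e / 2 * W `|x| by field.
rewrite (_ : (fun x => _) = fun x => (f x - h x) + (g x - k x)); last first.
  by apply/funext => y; rewrite opprD addrACA.
by apply: jet_bound_add => //; apply: Cs_sub => //; [exact: Cs_netfun hh|exact: Cs_netfun hk].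
Qed.

Lemma netapprox_scale psi m j c f : Cinfty psi -> netapprox psi m j f ->
  netapprox psi m j (fun x => c * f x).
Proof.
move=> cpsi [Cf fP]; split; first exact: Cs_scale.
move=> W e wW e0; have c0 : 0 < `|c| + 1 by rewrite ltr_wpDl.
have ec : 0 < e / (`|c| + 1) by rewrite divr_gt0.
have [h hh fh] := fP W _ wW ec; exists (fun x => c * h x); first exact: netfun_scale.
move=> x; rewrite (_ : (fun x => _) = fun x => c * (f x - h x)); last first.
  by apply/funext => y; rewrite mulrBr.
have Cfh : Cs m (fun x => f x - h x) by apply: Cs_sub => //; exact: Cs_netfun hh.
apply: jet_bound_le (jet_bound_scale c Cfh (fh x)) => //.
have [W1 _ _] := wW; have W0 : 0 <= W `|x| by exact: le_trans (W1 _).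
rewrite mulrA ler_wpM2r// mulrCA ler_piMr ?(ltW e0)// ler_pdivrMr// mul1r lerDl//.
Qed.

End networks.

(** * Composition with the activation and increase of depth *)

Lemma weight_root (R : realType) (W : R -> R) (n : nat) : weight W ->
  exists2 V, weight V & forall t, V t ^+ n.+1 = W t.
Proof.
move=> [W1 Wle Woo]; have W0 t : 0 <= W t by exact: le_trans (W1 t).
have VE t : (W t `^ n.+1%:R^-1) ^+ n.+1 = W t.
  by rewrite -powR_mulrn ?powR_ge0// -powRrM mulVf ?powRr1// pnatr_eq0.
exists (fun t => W t `^ n.+1%:R^-1) => //.
have i0 : 0 <= n.+1%:R^-1 :> R by rewrite invr_ge0.
split=> [t|s t st|M].
- by apply: (@le_trans _ _ (1 `^ n.+1%:R^-1)); [rewrite powR1|rewrite ge0_ler_powR ?nnegrE].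
- by rewrite ge0_ler_powR ?nnegrE// Wle.
- have [r rP] := Woo (Num.max M 0 ^+ n.+1); exists r => t /rP h.
  apply: (@le_trans _ _ (Num.max M 0)); first by rewrite le_max lexx.
  by rewrite -(@ler_pXn2r _ n.+1) ?nnegrE ?powR_ge0 ?le_max ?lexx ?orbT// VE.
Qed.

Section depth.
Variables (R : realType) (d : nat).
Notation X := 'cV[R]_d.
Implicit Types (f g h : X -> R) (x : X) (a : 'rV[R]_d) (b : R).

Lemma netapprox_ridge psi m (u : nat -> R -> R) a b : Cinfty psi -> isjet u ->
  approx1 m (activation_jet psi) u -> netapprox psi m 1 (fun x => u 0%N (linear_form a b x)).
Proof.
move=> cpsi ju au; split; first by apply: Cs_comp => //; exact: Cs_linear_form.
move=> W e wW e0.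
have [V wV VW] := @weight_affine R W (\sum_i `|a 0 i|) `|b| wW (sumr_ge0 _ (fun i _ => normr_ge0 _)).
pose A : R := 1 + \sum_i `|a 0 i|.
have A1 : 1 <= A by rewrite lerDl sumr_ge0.
have A0 : 0 < A ^+ m by rewrite exprn_gt0// (lt_le_trans _ A1).
have aA i : `|a 0 i| <= A.
  by rewrite /A (bigD1 i)//= addrCA lerDl addr_ge0// sumr_ge0.
have eA : 0 < e / A ^+ m by rewrite divr_gt0.
have [s us] := au V _ wV eA.
have jnet : isjet (net1 (activation_jet psi) s).
  by apply: isjet_sum; exact: isjet_activation.
exists (fun x => net1 (activation_jet psi) s 0 (linear_form a b x)).
  elim: s {us jnet} => [|p s IH].
    rewrite (_ : (fun x => _) = fun=> 0); first exact: netfun_cst.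
    by apply/funext => x; rewrite /net1 big_nil.
  rewrite (_ : (fun x => _) = (fun x => p.1.1 * psi (linear_form (p.1.2 *: a) (p.1.2 * b + p.2) x) +
     net1 (activation_jet psi) s 0 (linear_form a b x))).
    by apply: netfun_neuron => //; exact: netfun_affine.
  apply/funext => x; rewrite /net1 big_cons expr0 mulr1; congr (_ * psi _ + _).
  by rewrite /linear_form -scalemxAl [in RHS]mxE; ring.
move=> x; have jB := isjetB ju jnet.
have := @jet_bound_ridge R d m d 0 _ a b x A (e / A ^+ m * W `|x|) jB A1 aA.
rewrite mulrA mulrCA mulfV ?gt_eqF// mulr1; apply=> l lm.
apply: le_trans (us l _ lm) _; rewrite ler_wpM2l ?(ltW eA)//.
by apply: VW => //; exact: linear_form_le.
Qed.

(** [f] is bounded, but its approximants are only controlled by a weight V. Their error is of size V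
    and composition multiplies it by V^m, so V is taken with V^(m+1) = [W]. *)
Lemma netapprox_comp psi m j f (H C : R) : Cinfty psi ->
  (forall k t, (k <= m.+1)%N -> (0 < k)%N -> `|activation_jet psi k t| <= C) ->
  (forall x, jet_bound m d f x H) -> netapprox psi m j f ->
  netapprox psi m j.+1 (fun x => psi (f x)).
Proof.
move=> cpsi psiC fH [Cf fP].
have jpsi := isjet_activation cpsi.
split; first by apply: (Cs_comp 0 jpsi).
move=> W e wW e0.
have [K K0 HK] := @jet_bound_comp_sub R d m _ C jpsi psiC.
have [V wV VW] := weight_root m wW.
pose H1 : R := `|H| + 1.
have H10 : 1 <= H1 + 1 by rewrite lerDr addr_ge0.
have D0 : 0 < K * (H1 + 1) ^+ m + 1 by rewrite ltr_wpDl// mulr_ge0// exprn_ge0// (le_trans _ H10).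
pose t := Num.min 1 (e / (K * (H1 + 1) ^+ m + 1)).
have t0 : 0 < t by rewrite lt_min ltr01 divr_gt0.
have t1 : t <= 1 by rewrite ge_min lexx.
have [h hh fh] := fP V t wV t0.
have Ch := Cs_netfun m cpsi hh.
exists (fun x => psi (h x)).
  rewrite (_ : (fun x => _) = (fun x => 1 * psi (h x) + 0)).
    by apply: netfun_neuron => //; exact: netfun_cst.
  by apply/funext => x; rewrite mul1r addr0.
move=> x; have [V1 _ _] := wV; have Vx := V1 `|x|.
have V0 : 0 <= V `|x| by exact: le_trans Vx.
pose B := (H1 + 1) * V `|x|.
have HB : H + t * V `|x| <= B.
  rewrite /B mulrDl mul1r lerD//.
    apply: (@le_trans _ _ H1); first by rewrite (le_trans (ler_norm H))// lerDl.
    by rewrite ler_peMr// addr_ge0.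
  by rewrite ler_piMl.
have B1 : 1 <= B by rewrite mulr_ege1.
have jf : jet_bound m d f x B.
  apply: jet_bound_le (fH x) => //; apply: le_trans HB.
  by rewrite lerDl mulr_ge0// ltW.
have jh : jet_bound m d h x B.
  rewrite (_ : h = (fun x => f x - (f x - h x))); last by apply/funext => y; rewrite subKr.
  exact: jet_bound_le (leqnn _) (leqnn _) HB (jet_bound_sub Cf (Cs_sub Cf Ch) (fH x) (fh x)).
have := HK d f h x B _ Cf Ch B1 jf jh (fh x).
apply: jet_bound_le => //.
rewrite -(VW `|x|) /B exprMn exprS.
rewrite (_ : K * _ * _ = (K * (H1 + 1) ^+ m * t) * (V `|x| * V `|x| ^+ m)); last by ring.
rewrite ler_wpM2r ?mulr_ge0 ?exprn_ge0//.
apply: (@le_trans _ _ ((K * (H1 + 1) ^+ m + 1) * t)).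
  by rewrite ler_wpM2r ?lerDl// ltW.
by rewrite mulrC -ler_pdivlMr// ge_min lexx orbT.
Qed.

(* To first order in c, psi (d0 + c f) is psi d0 + c psi'(d0) f. *)
Lemma netapprox_deepen psi m j f (H C d0 : R) : Cinfty psi ->
  (forall k t, (0 < k)%N -> (k <= m.+2)%N -> `|activation_jet psi k t| <= C) ->
  activation_jet psi 1 d0 != 0 ->
  (forall x, jet_bound m d f x H) -> netapprox psi m j.+1 f -> netapprox psi m j.+2 f.
Proof.
move=> cpsi psiC psi1 fH af; have [Cf _] := af.
have jpsi := isjet_activation cpsi.
set phi := activation_jet psi in psiC psi1 jpsi.
set D := phi 1%N d0 in psi1.
have C0 : 0 <= C by exact: le_trans (psiC 1%N 0 _ _).
pose H1 : R := 1 + `|H|.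
have H11 : 1 <= H1 by rewrite lerDl.
have fH1 x : jet_bound m d f x H1.
  by apply: jet_bound_le (fH x) => //; rewrite (le_trans (ler_norm H))// lerDr.
have fH1' x : `|f x| <= H1 by exact: jet_bound_norm (fH1 x).
have H10 : 0 <= H1 by exact: le_trans H11.
apply: netapprox_closed => // W e wW e0.
pose K := (2 ^+ m * H1) ^+ m * (C / `|D| * H1 ^+ 2).
have D0 : 0 < `|D| by rewrite normr_gt0.
have K0 : 0 <= K.
  by rewrite mulr_ge0 ?exprn_ge0 ?mulr_ge0 ?exprn_ge0// divr_ge0.
pose c := Num.min 1 (e / (K + 1)).
have c0 : 0 < c by rewrite lt_min ltr01 divr_gt0// ltr_wpDl.
have c1 : c <= 1 by rewrite ge_min lexx.
have Kc : K * c <= e.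
  apply: (@le_trans _ _ (K * (e / (K + 1)))); first by rewrite ler_wpM2l// ge_min lexx orbT.
  by rewrite mulrCA ler_piMr ?(ltW e0)// ler_pdivrMr ?ltr_wpDl// mul1r lerDl.
(* The jet of the tangent line at 0 to the rescaled activation (c D)^-1 psi (c t + d0), whose slope
   there is 1. *)
pose q (k : nat) (t : R) := if k is k'.+1 then (k' == 0%N)%:R else phi 0%N d0 / (c * D) + t.
have jq : isjet q.
  case=> [|k] /=.
    apply: is_deriv_ext (is_derivD (is_deriv_cst (phi 0%N d0 / (c * D))) (@is_deriv_id R)) _ _ => // t.
    by rewrite add0r.
  by apply: is_deriv_ext (is_deriv_cst (k == 0%N)%:R) _ _.
pose w (k : nat) (t : R) : R := (c * D)^-1 * c ^+ k * phi k (c * t + d0) - q k t.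
have jw : isjet w by apply: isjetB => //; exact: isjet_affine.
have cD : c * D != 0 by rewrite mulf_neq0// gt_eqF.
exists (fun x => (c * D)^-1 * psi (c * f x + d0) - phi 0%N d0 / (c * D)).
  apply: netapprox_add => //; last by apply: netapprox_netfun => //; exact: netfun_cst.
  apply: netapprox_scale => //; apply: (netapprox_comp (H := H1 + `|d0|) (C := C)) => //.
  - by move=> k t k1 k2; apply: psiC => //; exact: leqW.
  - move=> x; apply: jet_bound_add; [exact: Cs_scale|exact: Cs_cst| |exact: jet_bound_cst].
    apply: jet_bound_le (jet_bound_scale c Cf (fH1 x)) => //.
    by rewrite gtr0_norm// ler_piMl.
  - apply: netapprox_add => //; first exact: netapprox_scale.
    by apply: netapprox_netfun => //; exact: netfun_cst.
move=> x.
rewrite (_ : (fun x => _) = (fun x => -1 * w 0%N (f x))); last first.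
  by apply/funext => y; rewrite /w /q expr0 mulr1 /phi /activation_jet /derive1n /=; ring.
(* Every order is O(c): order 0 by Taylor, order 1 by the Lipschitz bound on psi', and the higher
   ones by the powers of c left over from the scaling. *)
have wB k : (k <= m)%N -> `|w k (f x)| <= C / `|D| * H1 ^+ 2 * c.
  have CD0 : 0 <= C / `|D| by rewrite divr_ge0.
  have HC (y : R) : `|y| <= C * c -> `|y| / `|D| <= C / `|D| * H1 ^+ 2 * c.
    move=> yC; rewrite ler_pdivrMr// (_ : _ * `|D| = C * c * H1 ^+ 2); last by field; rewrite gt_eqF.
    by rewrite (le_trans yC)// ler_peMr ?exprn_ege1// mulr_ge0// ltW.
  have d0x : phi 0%N (c * f x + d0) - phi 0%N d0 - c * f x * D =
      phi 0%N (d0 + c * f x) - phi 0%N d0 - c * f x * phi 1%N d0 by rewrite (addrC (c * f x)).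
  case: k => [|[|k]] km.
  - have T := taylor_bound d0 (c * f x) (jpsi 0%N) (jpsi 1%N) (fun t => psiC 2%N t isT isT).
    have -> : w 0%N (f x) = (phi 0%N (c * f x + d0) - phi 0%N d0 - c * f x * D) / (c * D).
      by rewrite /w /q expr0; field; rewrite psi1 gt_eqF.
    rewrite d0x normrM normfV normrM (gtr0_norm c0) ler_pdivrMr ?mulr_gt0//.
    apply: le_trans T _; rewrite exprMn (_ : _ * (c * `|D|) = C * (c ^+ 2 * H1 ^+ 2)); last by field; rewrite gt_eqF.
    rewrite ler_wpM2l// ler_wpM2l ?sqr_ge0// -[f x ^+ 2]real_normK ?num_real//.
    by rewrite lerXn2r ?nnegrE.
  - have -> : w 1%N (f x) = (phi 1%N (c * f x + d0) - D) / D.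
      have q1 : q 1%N (f x) = 1 by [].
      by rewrite /w q1 expr1; field; rewrite psi1 gt_eqF.
    have T := derivative_lipschitz d0 (c * f x + d0) (jpsi 1%N) (fun t => psiC 2%N t isT isT).
    rewrite normrM normfV ler_pdivrMr//; apply: le_trans T _.
    rewrite addrK normrM (gtr0_norm c0) (_ : _ * `|D| = C * (c * H1 ^+ 2)); last by field; rewrite gt_eqF.
    rewrite ler_wpM2l// ler_wpM2l ?(ltW c0)// (le_trans (fH1' x))// expr2 ler_peMr//.
  - have -> : w k.+2 (f x) = c ^+ k * c * phi k.+2 (c * f x + d0) / D.
      have q2 : q k.+2 (f x) = 0 by [].
      by rewrite /w q2 !exprS; field; rewrite psi1 gt_eqF.
    rewrite normrM normfV; apply: HC.
    rewrite normrM mulrC; apply: ler_pM => //; first by apply: psiC => //; exact: leqW (leqW km).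
    rewrite ger0_norm ?mulr_ge0 ?exprn_ge0 ?(ltW c0)// ler_piMl ?(ltW c0)//.
    by rewrite exprn_ile1// ltW.
have jb := jet_bound_comp jw Cf H11 (fH1 x) wB.
have := jet_bound_scale (-1) (Cs_comp 0 jw Cf) jb.
apply: jet_bound_le => //.
rewrite normrN1 mul1r mulrA -/K (le_trans Kc)// ler_peMr ?(ltW e0)//.
by case: wW => W1 _ _; exact: W1.
Qed.

Lemma jet_bound_cosine m a b : exists H, forall x,
  jet_bound m d (fun x => cos (linear_form a b x)) x H.
Proof.
pose A : R := 1 + \sum_i `|a 0 i|.
have A1 : 1 <= A by rewrite lerDl sumr_ge0.
have aA i : `|a 0 i| <= A.
  by rewrite /A (bigD1 i)//= addrCA lerDl addr_ge0// sumr_ge0.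
exists (A ^+ m * 1) => x.
have := @jet_bound_ridge R d m d 0 _ a b x A 1 (@isjet_cosine R) A1 aA.
rewrite (_ : (fun x => _) = (fun x => cos (linear_form a b x))); last first.
  by apply/funext => y; rewrite /cosine_jet mul0r addr0.
by apply => l _; rewrite ler_norml cos_le1 cos_geN1.
Qed.

Lemma activation_derivative_neq0 (psi : R -> R) : Abinfty psi -> exists t, activation_jet psi 1 t != 0.
Proof.
move=> [cpsi _ [psiinc _] _]; apply: contrapT => H.
have := zero_deriv_cst 1 2 (isjet_activation cpsi 0%N) _.
rewrite /activation_jet /= => E.
have h12 : (1 : R) < 2 by rewrite ltr1n.
have := psiinc 1 2 ltr01 h12; rewrite E ?ltxx// => t.
by apply/eqP/negPn/negP => nt; apply: H; exists t.
Qed.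

(** Deepening requires a bounded jet, which ridge cosines have; hence depth is gained here, before
    cosines are combined. *)
Lemma netapprox_cosine psi m j a b : Abinfty psi ->
  netapprox psi m j.+1 (fun x => cos (linear_form a b x)).
Proof.
move=> apsi; have [cpsi _ _ psib] := apsi.
have [d0 D0] := activation_derivative_neq0 apsi.
have [A AP] : exists A : nat -> R, forall k t, `|activation_jet psi k.+1 t| <= A k.
  have [|A AP] := @choice nat R (fun k B => forall t, `|activation_jet psi k.+1 t| <= B).
    by move=> k; have [B _ H] := psib k.+1 isT; exists B.
  by exists A.
have A0 k : 0 <= A k by exact: le_trans (AP k 0).
pose C := \sum_(k < m.+2) A k.
have psiC k t : (0 < k)%N -> (k <= m.+2)%N -> `|activation_jet psi k t| <= C.
  case: k => [//|k] _ km; apply: le_trans (AP k t) _.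
  by rewrite /C (bigD1 (Ordinal km))//= lerDl sumr_ge0.
have [H fH] := jet_bound_cosine m a b.
elim: j => [|j IH]; last exact: netapprox_deepen psiC D0 fH IH.
rewrite (_ : (fun x => _) = (fun x => cosine_jet 0 (linear_form a b x))).
  by apply: netapprox_ridge => //; [exact: isjet_cosine|exact: approx1_cosine].
by apply/funext => x; rewrite /cosine_jet mul0r addr0.
Qed.

End depth.

(** * Trigonometric approximation *)

Section trigonometric_polynomials.
Variables (R : realType) (d : nat).
Notation X := 'cV[R]_d.
Implicit Types (f g h : X -> R) (x : X) (a : 'rV[R]_d) (b c : R).

(* Integer frequencies make these functions 2 pi-periodic in each coordinate. *)
Inductive trig : (X -> R) -> Prop :=
| trig0 : trig (fun=> 0)
| trig_term c a b f : (forall i, a 0 i \is a Num.int) -> trig f ->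
    trig (fun x => c * cos (linear_form a b x) + f x).

Lemma trig_eq f g : trig f -> f =1 g -> trig g.
Proof. by move=> tf /funext <-. Qed.

Lemma trig_add f g : trig f -> trig g -> trig (fun x => f x + g x).
Proof.
move=> tf tg; elim: tf => [|c a b h ha _ IH]; first by apply: trig_eq tg _ => x; rewrite add0r.
by apply: trig_eq (trig_term c b ha IH) _ => x; rewrite addrA.
Qed.

Lemma trig_scale c f : trig f -> trig (fun x => c * f x).
Proof.
elim => [|c' a b h ha _ IH]; first by apply: trig_eq trig0 _ => x; rewrite mulr0.
by apply: trig_eq (trig_term (c * c') b ha IH) _ => x; rewrite mulrDr mulrA.
Qed.

Lemma trig_cst c : trig (fun=> c).
Proof.
have h0 : forall i, (0 : 'rV[R]_d) 0 i \is a Num.int by move=> i; rewrite mxE.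
apply: trig_eq (trig_term c 0 h0 trig0) _ => x.
by rewrite /linear_form mul0mx mxE !addr0 cos0 mulr1.
Qed.

Lemma cosM (s t : R) : cos s * cos t = (cos (s + t) + cos (s - t)) / 2.
Proof. by rewrite cosD cosB; field. Qed.

Lemma trig_mul f g : trig f -> trig g -> trig (fun x => f x * g x).
Proof.
move=> tf tg; elim: tf => [|c a b h ha _ IH].
  by apply: trig_eq trig0 _ => x; rewrite mul0r.
apply: trig_eq (trig_add (f := fun x => c * cos (linear_form a b x) * g x) _ IH) _; last first.
  by move=> x; rewrite mulrDl.
elim: tg => [|c' a' b' h' ha' _ IH']; first by apply: trig_eq trig0 _ => x; rewrite mulr0.
have ap i : (a + a') 0 i \is a Num.int by rewrite mxE rpredD.
have am i : (a - a') 0 i \is a Num.int by rewrite !mxE rpredB.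
apply: trig_eq (trig_term (c * c' / 2) (b + b') ap (trig_term (c * c' / 2) (b - b') am IH')) _ => x.
rewrite mulrDr addrA; congr (_ + _).
have -> : linear_form (a + a') (b + b') x = linear_form a b x + linear_form a' b' x.
  by rewrite /linear_form mulmxDl [in LHS]mxE addrACA.
have -> : linear_form (a - a') (b - b') x = linear_form a b x - linear_form a' b' x.
  by rewrite /linear_form mulmxBl [in LHS]mxE [X in _ + X + _]mxE opprD addrACA.
by rewrite mulrACA cosM; ring.
Qed.

Lemma trig_sum (I : Type) (s : seq I) (F : I -> X -> R) : (forall i, trig (F i)) ->
  trig (fun x => \sum_(i <- s) F i x).
Proof.
move=> HF; elim: s => [|i s IH]; first by apply: trig_eq trig0 _ => x; rewrite big_nil.
by apply: trig_eq (trig_add (HF i) IH) _ => x; rewrite big_cons.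
Qed.

Lemma cosine_jet0 (x : R) : cosine_jet 0 x = cos x.
Proof. by rewrite /cosine_jet mul0r addr0. Qed.

Lemma Cs_trig m f : trig f -> Cs m f.
Proof.
elim => [|c a b h _ _ IH]; first exact: Cs_cst.
apply: Cs_add => //; apply: Cs_scale.
rewrite (_ : (fun x => _) = (fun x => cosine_jet 0 (linear_form a b x))).
  by apply: Cs_comp; [exact: isjet_cosine|exact: Cs_linear_form].
by apply/funext => x; rewrite cosine_jet0.
Qed.

Lemma trig_jet_bounded m f : trig f -> exists B, forall x, jet_bound m d f x B.
Proof.
elim => [|c a b h _ th [B hB]]; first by exists 0 => x; exact: jet_bound0.
have [B' cB'] := jet_bound_cosine m a b.
exists (`|c| * B' + B) => x.
have Cc : Cs m (fun x => cos (linear_form a b x)).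
  rewrite (_ : (fun x => _) = (fun x => cosine_jet 0 (linear_form a b x))).
    by apply: Cs_comp; [exact: isjet_cosine|exact: Cs_linear_form].
  by apply/funext => y; rewrite cosine_jet0.
apply: jet_bound_add => //; [exact: Cs_scale|exact: Cs_trig|exact: jet_bound_scale].
Qed.

Lemma cos_int_period (z y : R) : z \is a Num.int -> cos (y + z * (2 * pi)) = cos y.
Proof.
move=> /intrP[k ->]; case: k => n.
  rewrite -[LHS](cos_sub_periods _ n); congr cos.
  by rewrite -mulr_natl; ring.
rewrite -[in RHS](cos_sub_periods y n.+1); congr cos.
by rewrite NegzE mulrNz -mulr_natl; ring.
Qed.

Lemma trig_periodic f (v : X) x : (forall i, v i 0 \is a Num.int) -> trig f ->
  f (x + (2 * pi) *: v) = f x.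
Proof.
move=> hv; elim => [//|c a b h ha _ IH]; rewrite IH; congr (_ * _ + _).
have z : (a *m v) 0 0 \is a Num.int by rewrite mxE rpred_sum// => i _; rewrite rpredM.
rewrite -[RHS](cos_int_period _ z); congr cos.
by rewrite /linear_form mulmxDr -scalemxAr [in LHS]mxE [X in _ + X + _]mxE; ring.
Qed.

Lemma netapprox_trig psi m j (c : R) f : Abinfty psi -> trig f ->
  netapprox psi m j.+1 (fun x => f (c *: x)).
Proof.
move=> apsi; have [cpsi _ _ _] := apsi; elim => [|c' a b h _ _ IH].
  by apply: netapprox_netfun => //; exact: netfun_cst.
apply: netapprox_add => //; apply: netapprox_scale => //.
rewrite (_ : (fun x => _) = (fun x => cos (linear_form (c *: a) b x))).
  exact: netapprox_cosine.
by apply/funext => x; rewrite /linear_form -scalemxAr -scalemxAl.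
Qed.

(** [net1] over the cosine jet serves as format for trigonometric polynomials: amplitude, frequency,
    phase. One more factor of the kernel shifts each frequency by 0, 1 and - 1. *)
Lemma cosine_kernel_expansion n : exists s : seq (R * R * R),
  (forall p, p \in s -> p.1.2 \is a Num.int) /\
  forall t, cosine_kernel n t = net1 (@cosine_jet R) s 0 t.
Proof.
elim: n => [|n [s [sint sE]]].
  exists [:: (1, 0, 0)]; split=> [p|t]; first by rewrite inE => /eqP -> /=.
  by rewrite /net1 big_seq1 cosine_jet0 /= expr0 mul0r add0r cos0 !mulr1 /cosine_kernel expr0.
exists ([seq (p.1.1 / 2, p.1.2, p.2) | p <- s] ++
  ([seq (p.1.1 / 4, p.1.2 + 1, p.2) | p <- s] ++ [seq (p.1.1 / 4, p.1.2 - 1, p.2) | p <- s])).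
split=> [p|t].
  rewrite !mem_cat => /or3P[] /mapP[q qs ->] /=; first exact: sint.
    by apply: rpredD; [exact: sint|exact: rpred1].
  by apply: rpredB; [exact: sint|exact: rpred1].
rewrite /cosine_kernel exprS -/(cosine_kernel n t) sE /net1 !big_cat/= !big_map/=.
rewrite -!big_split/= big_distrr/=; apply: eq_bigr => p _.
rewrite !cosine_jet0 !expr0.
have -> : (p.1.2 + 1) * t + p.2 = (p.1.2 * t + p.2) + t by ring.
have -> : (p.1.2 - 1) * t + p.2 = (p.1.2 * t + p.2) - t by ring.
by set y := p.1.2 * t + p.2; rewrite (cosD y t) (cosB y t); field.
Qed.

Definition cosine_kernel_jet n : nat -> R -> R := activation_jet (@cosine_kernel R n).

Lemma cosine_kernel_jetP n : isjet (cosine_kernel_jet n) /\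
  forall k, exists B : R, forall t, `|cosine_kernel_jet n k t| <= B.
Proof.
have [s [_ sE]] := cosine_kernel_expansion n.
have js : isjet (net1 (@cosine_jet R) s) by apply: isjet_sum; exact: isjet_cosine.
have E k : cosine_kernel_jet n k = net1 (@cosine_jet R) s k.
  elim: k => [|k IH]; first by apply/funext => t; exact: sE.
  rewrite /cosine_kernel_jet /activation_jet derive1nS -/(activation_jet _ k) -/(cosine_kernel_jet n k) IH.
  by apply/funext => t; rewrite derive1E; exact: (@derive_val _ _ _ _ _ _ _ (js k t)).
split=> [k|k]; first by rewrite !E; exact: js.
exists (\sum_(p <- s) `|p.1.1 * p.1.2 ^+ k|) => t; rewrite E /net1.
apply: le_trans (ler_norm_sum _ _ _) _; apply: ler_sum => p _.
by rewrite normrM ler_piMr// ler_norml cos_le1 cos_geN1.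
Qed.

Lemma trig_cosine_kernel n (i : 'I_d) (s0 : R) : trig (fun x => cosine_kernel n (x i 0 - s0)).
Proof.
have [s [sint sE]] := cosine_kernel_expansion n.
apply: trig_eq (_ : trig (fun x => net1 (@cosine_jet R) s 0 (x i 0 - s0))) _; last first.
  by move=> x; rewrite sE.
elim: s sint {sE} => [|p s IH] sint; first by apply: trig_eq trig0 _ => x; rewrite /net1 big_nil.
pose a : 'rV[R]_d := p.1.2 *: delta_mx 0 i.
have ha k : a 0 k \is a Num.int.
  rewrite !mxE; apply: rpredM; first by apply: sint; rewrite inE eqxx.
  by case: (_ && _); [exact: rpred1|exact: rpred0].
have sint' q : q \in s -> q.1.2 \is a Num.int by move=> qs; rewrite sint// inE qs orbT.
apply: trig_eq (trig_term p.1.1 (p.2 - p.1.2 * s0) ha (IH sint')) _ => x.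
rewrite /net1 big_cons expr0 mulr1 cosine_jet0; congr (_ * cos _ + _).
rewrite /linear_form -scalemxAl -rowE !mxE; ring.
Qed.

End trigonometric_polynomials.

(** * Convolution with the cosine kernels in one coordinate *)

Lemma norm_lipschitz_continuous (R : realType) (V W : normedModType R) (f : V -> W) (k : R) :
  0 < k -> (forall x y, `|f x - f y| <= k * `|x - y|) -> continuous f.
Proof.
move=> k0 lip x; apply/cvgrPdist_le => e e0; near=> y.
apply: le_trans (lip x y) _; rewrite -ler_pdivlMl//; near: y.
by apply: cvgr_dist_le => //; rewrite mulr_gt0 ?invr_gt0.
Unshelve. all: by end_near. Qed.

(** [h] is not assumed periodic, so the recentring at [t] is carried out on the majorant [G], which
    is. *)
Lemma cosine_kernel_approx_at (R : realType) (h : R -> R) (n : nat) (t e M : R) : continuous h ->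
  (forall s, - pi <= s <= pi -> `|h s| <= e + M * (1 - cos (t - s))) ->
  `|Int (fun s => cosine_kernel n (t - s) * h s) (- pi) pi| <= cosine_mass R n * (e + M / n.+1%:R).
Proof.
move=> ch hM.
have cK := @cosine_kernel_continuous R n.
have p0 : - pi <= pi :> R by have := pi_gt0 R; lra.
have cc (c : R) : continuous (fun _ : R => c) by move=> x; exact: cst_continuous.
have c1 : continuous (fun s : R => 1 - cos s).
  by apply: (continuous_add (@cc 1)) => s; apply: cvgN; exact: continuous_cos.
have c2 := continuous_mul (@cc e) cK.
have c3 := continuous_mul (@cc M) (continuous_mul cK c1).
have c5 := continuous_add c2 c3.
pose G s := e * @cosine_kernel R n s + M * (@cosine_kernel R n s * (1 - cos s)).
have GT s : G (s + 2 * pi) = G s by rewrite /G /cosine_kernel cosD2pi_natl.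
have refl (f : R -> R) : continuous f -> continuous (fun s => f (t - s)).
  move=> cf; rewrite (_ : (fun s => _) = (fun s => f (-1 * s + t))); first exact: continuous_affine.
  by apply/funext => s; congr f; ring.
have E : Int (fun s => G (t - s)) (- pi) pi = cosine_mass R n * (e + M / n.+1%:R).
  rewrite (Int_reflect t c5 GT) IntD// !IntZ//; last exact: continuous_mul.
  by rewrite cosine_moment -/(cosine_mass R n); ring.
have cG : continuous (fun s => G (t - s)) by exact: refl.
have cL : continuous (fun s => cosine_kernel n (t - s) * h s).
  by apply: continuous_mul => //; exact: refl.
have bd s : - pi <= s <= pi -> `|cosine_kernel n (t - s) * h s| <= G (t - s).
  move=> sp; rewrite normrM ger0_norm ?cosine_kernel_ge0//.
  rewrite [leRHS](_ : _ = cosine_kernel n (t - s) * (e + M * (1 - cos (t - s)))); last by rewrite /G; ring.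
  by rewrite ler_wpM2l ?cosine_kernel_ge0// hM.
rewrite -E ler_norml; apply/andP; split.
  rewrite -mulN1r -IntZ//; apply: le_Int => //; first exact: continuous_mul.
  by move=> s /bd; rewrite mulN1r ler_norml => /andP[].
by apply: le_Int => // s /bd; rewrite ler_norml => /andP[].
Qed.

Section replace_coordinate.
Variables (R : realType) (d : nat) (i : 'I_d).
Notation X := 'cV[R]_d.
Implicit Types (f g h : X -> R) (x : X) (s t : R).

(** Written as a translation along the i-th axis so that partial derivatives can be read along
    it. *)
Definition setc s x : X := x + (s - x i 0) *: delta_mx i 0.

Lemma setcE s x j : setc s x j 0 = if j == i then s else x j 0.
Proof.
rewrite /setc !mxE eqxx andbT; case: eqP => [->|_]; last by rewrite mulr0 addr0.
by rewrite mulr1 addrC subrK.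
Qed.

Lemma setc_id x : setc (x i 0) x = x.
Proof. by rewrite /setc subrr scale0r addr0. Qed.

Lemma setc_line s t x : setc (s + t) x = t *: delta_mx i 0 + setc s x.
Proof. by rewrite /setc addrCA -scalerDl addrA [t + s]addrC. Qed.

Lemma setc_diff_norm s t x : `|setc s x - setc t x| <= `|s - t|.
Proof.
rewrite /setc opprD addrACA subrr add0r -scalerBl normrZ.
rewrite (_ : s - x i 0 - (t - x i 0) = s - t); last by ring.
rewrite ler_piMr// [leLHS]/Num.Def.normr/= mx_normrE bigmax_le// => -[k l] _ /=.
by rewrite mxE; case: (_ && _); rewrite ?normr1 ?normr0.
Qed.

Lemma setc_is_deriv h x : (forall x, derivable h x (delta_mx i 0)) ->
  is_deriv (fun s => h (setc s x)) (fun s => pd i h (setc s x)).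
Proof.
move=> dh s.
have dl : is_derive (0 : R) (1 : R) (fun t => h (t *: delta_mx i 0 + setc s x)) (pd i h (setc s x)).
  by apply: line_is_derive; exact/derivableP.
have ds : is_derive s (1 : R) (fun t => t - s) 1.
  by have := is_derivB (@is_deriv_id R) (is_deriv_cst s) s; rewrite subr0.
rewrite (_ : (fun s => _) = (fun t => h (t *: delta_mx i 0 + setc s x)) \o (fun t => t - s)).
  rewrite -[pd _ _ _]mulr1; apply: is_derive1_comp.
  by rewrite subrr.
by apply/funext => t; rewrite /= -setc_line addrC subrK.
Qed.

Lemma setc_continuous s : continuous (setc s).
Proof.
have lip x y : `|setc s x - setc s y| <= 2 * `|x - y|.
  rewrite /setc opprD addrACA -scalerBl.
  rewrite (_ : s - x i 0 - (s - y i 0) = - (x - y) i 0); last by rewrite !mxE; ring.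
  apply: le_trans (ler_normD _ _) _; rewrite mulr_natl mulr2n lerD2l normrZ normrN.
  rewrite -[leRHS]mulr1 ler_pM ?coord_le_norm//.
  rewrite [leLHS]/Num.Def.normr/= mx_normrE bigmax_le// => -[k l] _ /=.
  by rewrite mxE; case: (_ && _); rewrite ?normr1 ?normr0.
exact: norm_lipschitz_continuous lip.
Qed.

Lemma pd_setc s (j : 'I_d) h : (forall x, derivable h x (delta_mx j 0)) ->
  (forall x, derivable (fun x => h (setc s x)) x (delta_mx j 0)) /\
  pd j (fun x => h (setc s x)) = if j == i then fun=> 0 else fun x => pd j h (setc s x).
Proof.
move=> dh; apply: pd_is_derive => x; apply: is_derive_line.
case: eqP => [->|/eqP ji].
  rewrite (_ : (fun t => _) = fun=> h (setc s x)); first exact: is_derive_cst.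
  apply/funext => t; congr h; apply/colP => k; rewrite !setcE; case: eqP => // ki.
  by rewrite !mxE (_ : k == i = false) ?mulr0 ?add0r//; apply/eqP.
rewrite (_ : (fun t => _) = (fun t : R => h (t *: delta_mx j 0 + setc s x))).
  by apply: line_is_derive; exact/derivableP.
apply/funext => t; congr h; apply/colP => k; rewrite setcE [in RHS]mxE setcE.
case: eqP => [->|_]; last by rewrite !mxE.
by rewrite !mxE eq_sym (negPf ji) mulr0 add0r.
Qed.

Lemma Cs_setc m s h : Cs m h -> Cs m (fun x => h (setc s x)).
Proof.
elim: m h => [|m IH] h Ch; split=> //;
  try (by move=> x; apply: (@continuous_comp _ _ _ (setc s) h);
    [exact: setc_continuous|exact: (Cs_continuous Ch)]).
move=> j; have [dh Cdh] := Ch.2 j; have [ds ->] := pd_setc s dh; split=> //.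
by case: eqP => _; [exact: Cs_cst|exact: IH].
Qed.

End replace_coordinate.

Lemma column_box_compact (R : realType) (d : nat) (r : R) :
  compact [set x : 'cV[R]_d | forall j, `|x j 0| <= r].
Proof.
have cr := @rV_compact R d (fun=> `[- r, r]%classic) (fun=> @segment_compact R (- r) r).
have ct : continuous (@trmx R 1 d).
  have lip (x y : 'rV[R]_d) : `|x^T - y^T| <= `|x - y|.
    rewrite -linearB/= [leLHS]/Num.Def.normr/= mx_normrE bigmax_le// => -[k l] _ /=.
    by rewrite mxE [leRHS]/Num.Def.normr/= mx_normrE; exact: (le_bigmax _ _ (l, k)).
  by apply: (@norm_lipschitz_continuous R _ _ _ 1) => // x y; rewrite mul1r.
have := continuous_compact (continuous_subspaceT ct) cr.
congr (compact _); apply/seteqP; split=> x /=.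
  move=> [y yr <-] j; have := yr j; rewrite mxE in_itv/= ler_norml.
  by rewrite (ord1 0).
move=> xr; exists x^T; last by rewrite trmxK.
by move=> j; rewrite mxE in_itv/= -ler_norml (ord1 ord0).
Qed.

Section kernel_operator.
Variables (R : realType) (d : nat).
Notation X := 'cV[R]_d.
Implicit Types (f g h : X -> R) (x y : X) (j : 'I_d).

Lemma pd_sum j (I : Type) (s : seq I) (F : I -> X -> R) :
  (forall k x, derivable (F k) x (delta_mx j 0)) ->
  (forall x, derivable (fun x => \sum_(k <- s) F k x) x (delta_mx j 0)) /\
  pd j (fun x => \sum_(k <- s) F k x) = fun x => \sum_(k <- s) pd j (F k) x.
Proof.
move=> dF; elim: s => [|k s [ds sE]].
  rewrite (_ : (fun x => _) = fun=> 0); last by apply/funext => x; rewrite big_nil.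
  by have [dc ->] := pd_cst j (0 : R); split=> //; apply/funext => x; rewrite big_nil.
rewrite (_ : (fun x => _) = fun x => F k x + \sum_(k <- s) F k x); last first.
  by apply/funext => x; rewrite big_cons.
have [dD ->] := pdD (dF k) ds; split=> //.
by apply/funext => x; rewrite big_cons sE.
Qed.

(** In the induction over coordinates, those below [i] have already been frozen at quadrature
    nodes. *)
Definition depends_from (i : nat) h : Prop :=
  forall x y, (forall j, (i <= j)%N -> x j 0 = y j 0) -> h x = h y.

(* With this margin, h vanishes at two points whose coordinates in [- pi, pi] are close
   modulo 2 pi without being close. *)
Definition vanishes_from (i : nat) h : Prop :=
  forall x j, (i <= j)%N -> pi / 2 < `|x j 0| -> h x = 0.

Lemma pd_depends_from i j h : (forall x, derivable h x (delta_mx j 0)) ->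
  depends_from i h -> depends_from i (pd j h).
Proof.
move=> dh hi x y xy; apply/esym/derive_val/is_derive_line.
rewrite (_ : (fun t => _) = (fun t : R => h (t *: delta_mx j 0 + x))).
  by apply: line_is_derive; exact/derivableP.
by apply/funext => t; apply: hi => k ik; rewrite !mxE xy.
Qed.

Lemma pd_depends_from0 i j h : depends_from i h -> (j < i)%N ->
  (forall x, derivable h x (delta_mx j 0)) /\ pd j h = fun=> 0.
Proof.
move=> hi ji; apply: pd_is_derive => x; apply: is_derive_line.
rewrite (_ : (fun t => _) = fun=> h x); first exact: is_derive_cst.
apply/funext => t; apply: hi => k ik; rewrite !mxE (_ : k == j = false) ?mulr0 ?add0r//.
by apply/eqP => kj; move: ji; rewrite -kj ltnNge ik.
Qed.

Lemma pd_vanishes_from i j h : vanishes_from i h -> vanishes_from i (pd j h).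
Proof.
move=> hv x k ik xk; apply: derive_val; apply: is_derive_line.
apply: near_eq_is_derive (is_derive_cst (0 : R) (0 : R) (1 : R)).
near=> t; apply/esym; apply: (hv _ k ik).
have : `|t| < `|x k 0| - pi / 2.
  by near: t; apply: (@cvgr_norm_lt _ _ _ (nbhs (0 : R)) _ id 0) => //; rewrite normr0 subr_gt0.
move=> tx; rewrite !mxE eqxx andbT.
have : `|t * (k == j)%:R| <= `|t| by case: eqP; rewrite ?mulr1 ?mulr0 ?normr0.
have := lerB_normD (x k 0) (t * (k == j)%:R); rewrite [x k 0 + _]addrC; lra.
Unshelve. all: by end_near. Qed.

Variable i : 'I_d.

Definition coordB (s : R) : X -> R := linear_form (delta_mx 0 i) (- s).

Lemma coordBE s x : coordB s x = x i 0 - s.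
Proof. by rewrite /coordB /linear_form -rowE mxE. Qed.

Definition node_step (N : nat) : R := (pi - - pi) / N.+1%:R.
Definition node (N k : nat) : R := - pi + k%:R * node_step N.

(* Riemann sum for the convolution of h in the i-th coordinate with the c-th derivative of
   the normalized kernel; it is trigonometric in that coordinate. *)
Definition kernel_sum (n N c : nat) h x : R :=
  \sum_(k < N.+1) node_step N / cosine_mass R n *
    (cosine_kernel_jet n c (coordB (node N k) x) * h (setc i (node N k) x)).

(** Along the i-th axis only the kernel varies, because [h] is evaluated at nodes; along the other
    axes only [h] does. *)
Lemma pd_kernel_sum n N c j h : (forall x, derivable h x (delta_mx j 0)) ->
  (forall x, derivable (kernel_sum n N c h) x (delta_mx j 0)) /\
  pd j (kernel_sum n N c h) =
    if j == i then kernel_sum n N c.+1 h else kernel_sum n N c (pd j h).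
Proof.
move=> dh; have [jK _] := @cosine_kernel_jetP R n.
have dK s := pd_comp (jK c) (pd_linear_form (delta_mx 0 i) (- s) j).1.
have dM s := pdM (dK s).1 (pd_setc i s dh).1.
have dZ k := pdZ (node_step N / cosine_mass R n) (dM (node N k)).1.
have [dS SE] := @pd_sum j _ (index_enum 'I_N.+1) _ (fun k : 'I_N.+1 => (dZ k).1).
split; first exact: dS.
rewrite {1}/kernel_sum SE.
have E k x : pd j (fun x => node_step N / cosine_mass R n *
    (cosine_kernel_jet n c (coordB (node N k) x) * h (setc i (node N k) x))) x =
    node_step N / cosine_mass R n * (if j == i then
      cosine_kernel_jet n c.+1 (coordB (node N k) x) * h (setc i (node N k) x)
      else cosine_kernel_jet n c (coordB (node N k) x) * pd j h (setc i (node N k) x)).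
  rewrite (dZ k).2 (dM _).2 (dK _).2 (pd_setc i _ dh).2 (pd_linear_form _ _ j).2 mxE eqxx /=.
  case: eqP => _; last by rewrite mulr0 mulr0 addr0.
  by rewrite mulr0 add0r mulr1 [h _ * _]mulrC.
apply/funext => x; under eq_bigr do rewrite E.
by case: eqP.
Qed.

Lemma kernel_sum_depends i0 n N c h : (i0 <= i)%N -> depends_from i0 h ->
  depends_from i0 (kernel_sum n N c h).
Proof.
move=> ii hi x y xy; apply: eq_bigr => k _; rewrite !coordBE xy//.
congr (_ * (_ * _)); apply: hi => j ij; rewrite !setcE.
by case: eqP => // _; exact: xy.
Qed.

Lemma Cs_kernel_sum m n N c h : Cs m h -> Cs m (kernel_sum n N c h).
Proof.
move=> Ch; have [jK _] := @cosine_kernel_jetP R n.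
apply: Cs_sum => k; apply: Cs_scale; apply: Cs_mul; last exact: Cs_setc.
by apply: Cs_comp => //; exact: Cs_linear_form.
Qed.

Let p0 : - pi <= pi :> R. Proof. by have := pi_gt0 R; lra. Qed.

Let box : set X := [set x | forall j, `|x j 0| <= pi].

Let setc_box s x : `|s| <= pi -> box x -> box (setc i s x).
Proof. by move=> sp bx j; rewrite setcE; case: eqP. Qed.

Lemma bounded_on_box h : continuous h -> exists2 M : R, 0 <= M & forall x, box x -> `|h x| <= M.
Proof.
move=> ch; have bc : compact box by exact: column_box_compact.
have cnh : continuous (fun x => `|h x|).
  by move=> x; apply: (@continuous_comp _ _ _ h); [exact: ch|exact: norm_continuous].
have b0 : box 0 by move=> j; rewrite mxE normr0 ltW// pi_gt0.
have [c _ cM] := @compact_EVT_max _ R (fun x => `|h x|) box (ex_intro _ _ b0) bc (continuous_subspaceT cnh).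
by exists `|h c| => // x bx; apply: cM; rewrite inE.
Qed.

Let slice_continuous n c h x : continuous h ->
  continuous (fun s => cosine_kernel_jet n c (x i 0 - s) * h (setc i s x)).
Proof.
move=> ch; have [jK _] := @cosine_kernel_jetP R n.
apply: continuous_mul.
  rewrite (_ : (fun s => _) = (fun s => cosine_kernel_jet n c (-1 * s + x i 0))).
    exact: continuous_affine (derivative_continuous (jK c)).
  by apply/funext => s; congr cosine_kernel_jet; ring.
have cs : continuous (fun s => setc i s x).
  apply: (@norm_lipschitz_continuous R _ _ _ 1) => // s t.
  by rewrite mul1r setc_diff_norm.
by move=> s; apply: continuous_comp; [exact: cs|exact: ch].
Qed.

(** The threshold for [N] depends on [n] through the derivatives of the kernel, but not on [x]:
    replacing a coordinate by a node stays in the box, where [h] has a single modulus of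
    continuity. *)
Lemma kernel_sum_riemann n c h (e : R) : continuous h -> 0 < e ->
  \forall N \near \oo, forall x, box x ->
  `|kernel_sum n N c h x -
    Int (fun s => cosine_kernel_jet n c (x i 0 - s) * h (setc i s x)) (- pi) pi / cosine_mass R n| <= e.
Proof.
move=> ch e0; have [jK KB] := @cosine_kernel_jetP R n.
have [B BP] := KB c; have [L LP] := KB c.+1.
have B0 : 0 <= B by exact: le_trans (BP 0).
have L0 : 0 <= L by exact: le_trans (LP 0).
have [M M0 MP] := bounded_on_box ch.
have mn := cosine_mass_gt0 R n.
have pp := pi_gt0 R.
pose e1 := e * cosine_mass R n / (2 * pi).
have e10 : 0 < e1 by rewrite divr_gt0 ?mulr_gt0.
have eB : 0 < e1 / (2 * (B + 1)) by rewrite divr_gt0// mulr_gt0// ltr_wpDl.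
have [dl dl0 dlP] := heine (@column_box_compact R d pi) ch eB.
have D0 : 0 < 2 * (L * M + 1) by rewrite mulr_gt0// ltr_wpDl// mulr_ge0.
pose r := Num.min dl (e1 / (2 * (L * M + 1))).
have r0 : 0 < r by rewrite lt_min dl0 divr_gt0.
have rp0 : 0 < r / (2 * pi) by rewrite divr_gt0// mulr_gt0.
have [N0 _ HN] := near_infty_natSinv_lt (PosNum rp0).
exists N0 => // N /= N0N x bx.
have := HN N N0N; rewrite /= ltr_pdivlMr ?mulr_gt0// => Nr.
have := @riemann_sum_bound R _ (- pi) pi e1 N.+1 (@slice_continuous n c h x ch) p0 (ltn0Sn N).
move=> /(_ _)/le_trans H.
have -> : kernel_sum n N c h x = (\sum_(k < N.+1) (pi - - pi) / N.+1%:R *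
   (cosine_kernel_jet n c (x i 0 - (- pi + k%:R * ((pi - - pi) / N.+1%:R))) *
     h (setc i (- pi + k%:R * ((pi - - pi) / N.+1%:R)) x))) / cosine_mass R n.
  rewrite big_distrl/=; apply: eq_bigr => k _; rewrite coordBE /node /node_step; ring.
rewrite -mulrBl normrM normfV (gtr0_norm mn) ler_pdivrMr//.
apply: H; last first.
  rewrite opprK /e1 (_ : pi + pi = 2 * pi); last by ring.
  by rewrite divfK// gt_eqF// mulr_gt0.
move=> s t; rewrite -!ler_norml => sp tp st.
have st' : `|s - t| < r.
  by apply: le_lt_trans st _; rewrite opprK (_ : pi + pi = 2 * pi) 1?mulrC//; ring.
rewrite (_ : _ - _ = cosine_kernel_jet n c (x i 0 - s) * (h (setc i s x) - h (setc i t x)) +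
  (cosine_kernel_jet n c (x i 0 - s) - cosine_kernel_jet n c (x i 0 - t)) * h (setc i t x)); last by ring.
apply: (le_trans (ler_normD _ _)); rewrite !normrM.
have h1 : `|h (setc i s x) - h (setc i t x)| <= e1 / (2 * (B + 1)).
  apply: dlP; first exact: setc_box.
  by apply: le_lt_trans (setc_diff_norm _ _ _ _) _; apply: lt_le_trans st' _; rewrite ge_min lexx.
have h2 : `|cosine_kernel_jet n c (x i 0 - s) - cosine_kernel_jet n c (x i 0 - t)| <= L * r.
  apply: le_trans (derivative_lipschitz _ _ (jK c) LP) _; rewrite ler_wpM2l//.
  by rewrite (_ : x i 0 - s - (x i 0 - t) = - (s - t)) ?normrN ?(ltW st')//; ring.
have h3 : `|h (setc i t x)| <= M by apply: MP; exact: setc_box.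
have q1 : B * (e1 / (2 * (B + 1))) <= e1 / 2.
  rewrite mulrCA ler_pM2l// invfM mulrCA ler_piMr ?invr_ge0//.
  by rewrite ler_pdivrMr ?ltr_wpDl// mul1r lerDl.
have q2 : L * r * M <= e1 / 2.
  have rr : r <= e1 / (2 * (L * M + 1)) by rewrite ge_min lexx orbT.
  rewrite mulrAC; apply: le_trans (ler_wpM2l (mulr_ge0 L0 M0) rr) _.
  rewrite mulrCA ler_pM2l// invfM mulrCA ler_piMr ?invr_ge0//.
  by rewrite ler_pdivrMr ?ltr_wpDl ?mulr_ge0// mul1r lerDl.
have -> : e1 = e1 / 2 + e1 / 2 by field.
apply: lerD.
  by apply: le_trans q1; apply: ler_pM => //; exact: BP.
by apply: le_trans q2; apply: ler_pM => //; rewrite mulr_ge0// ltW.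
Qed.

(** Derivatives pass from the kernel to [h]. The boundary terms vanish with [h] at - pi and pi, and
    the sign of each integration by parts cancels the one from differentiating in - s. *)
Lemma kernel_integral_parts n c l h x : Cs c h -> vanishes_from i h ->
  Int (fun s => cosine_kernel_jet n (c + l) (x i 0 - s) * h (setc i s x)) (- pi) pi =
  Int (fun s => cosine_kernel_jet n l (x i 0 - s) * iter c (pd i) h (setc i s x)) (- pi) pi.
Proof.
elim: c h => [//|c IH] h Ch hv.
have [dh Cdh] := Ch.2 i.
rewrite iterSr -IH//; last exact: pd_vanishes_from.
have [jK _] := @cosine_kernel_jetP R n.
have dK : is_deriv (fun s => -1 * cosine_kernel_jet n (c + l) (-1 * s + x i 0))
    (fun s => cosine_kernel_jet n (c.+1 + l) (x i 0 - s)).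
  apply: is_deriv_ext (is_derivZ (-1) (is_deriv_affine (-1) (x i 0) (jK (c + l)%N))) _ _ => // s.
  rewrite mulrA mulrNN !mulr1 mul1r; congr cosine_kernel_jet; ring.
have dH := setc_is_deriv x dh.
have cs : continuous (fun s => setc i s x).
  apply: (@norm_lipschitz_continuous R _ _ _ 1) => // s t.
  by rewrite mul1r setc_diff_norm.
have cdh : continuous (fun s => pd i h (setc i s x)).
  by move=> s; apply: continuous_comp; [exact: cs|exact: (Cs_continuous Cdh)].
have cK : continuous (fun s => cosine_kernel_jet n (c.+1 + l) (x i 0 - s)).
  rewrite (_ : (fun s => _) = (fun s => cosine_kernel_jet n (c.+1 + l) (-1 * s + x i 0))).
    exact: continuous_affine (derivative_continuous (jK _)).
  by apply/funext => s; congr cosine_kernel_jet; ring.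
have pp := pi_gt0 R.
have hp : h (setc i pi x) = 0 /\ h (setc i (- pi) x) = 0.
  by split; apply: (hv _ i (leqnn _)); rewrite setcE eqxx ?normrN gtr0_norm//; lra.
have := Int_parts (- pi) pi dH dK cdh cK; rewrite hp.1 hp.2 !mul0r subrr sub0r.
rewrite (_ : (fun t => h (setc i t x) * _) =
   (fun s => cosine_kernel_jet n (c.+1 + l) (x i 0 - s) * h (setc i s x))); last first.
  by apply/funext => s; rewrite mulrC.
move=> ->; rewrite (_ : (fun t => pd i h _ * _) =
   (fun s => -1 * (cosine_kernel_jet n (c + l) (x i 0 - s) * pd i h (setc i s x)))); last first.
  apply/funext => s; rewrite mulrCA; congr (_ * _); rewrite mulrC; congr (cosine_kernel_jet _ _ _ * _); ring.
rewrite IntZ ?mulN1r ?opprK//.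
by apply: slice_continuous; exact: Cs_continuous Cdh.
Qed.

Lemma kernel_integral_cvg h (e : R) : continuous h -> vanishes_from i h -> 0 < e ->
  \forall n \near \oo, forall x, box x ->
  `|Int (fun s => cosine_kernel n (x i 0 - s) * h (setc i s x)) (- pi) pi / cosine_mass R n - h x| <= e.
Proof.
move=> ch hv e0; have pp := pi_gt0 R.
have [M M0 MP] := bounded_on_box ch.
have e2 : 0 < e / 2 by rewrite divr_gt0.
have [dl dl0 dlP] := heine (@column_box_compact R d pi) ch e2.
pose r := Num.min dl (pi / 2).
have r0 : 0 < r by rewrite lt_min dl0 divr_gt0.
have rp : r <= pi / 2 by rewrite ge_min lexx orbT.
have rpi : r <= pi by lra.
have cr := one_minus_cos_gt0 r0 rpi.
pose A := 2 * M / (1 - cos r).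
have A0 : 0 <= A by rewrite divr_ge0 ?mulr_ge0// ltW.
have eA : 0 < e / 2 / (A + 1) by rewrite !divr_gt0// ltr_wpDl.
have [N _ HN] := near_infty_natSinv_lt (PosNum eA).
exists N => // n /= Nn x bx.
have := HN n Nn; rewrite /= ltr_pdivlMr ?ltr_wpDl// => nA.
have mn := cosine_mass_gt0 R n.
have cK := @cosine_kernel_continuous R n.
set t := x i 0.
have tp : `|t| <= pi by exact: bx.
pose v s := h (setc i s x) - h x.
have csl : continuous (fun s => h (setc i s x)).
  have cs : continuous (fun s => setc i s x).
    apply: (@norm_lipschitz_continuous R _ _ _ 1) => // s s'.
    by rewrite mul1r setc_diff_norm.
  by move=> s; apply: continuous_comp; [exact: cs|exact: ch].
have cc (c : R) : continuous (fun _ : R => c) by move=> ?; exact: cst_continuous.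
have cv : continuous v by apply: (continuous_add csl (@cc (- h x))).
have cKt : continuous (fun s => @cosine_kernel R n (t - s)).
  rewrite (_ : (fun s => _) = (fun s => cosine_kernel n (-1 * s + t))); first exact: continuous_affine.
  by apply/funext => s; congr cosine_kernel; ring.
have vb s : - pi <= s <= pi -> `|v s| <= e / 2 + A * (1 - cos (t - s)).
  rewrite -ler_norml => sp.
  have c1 : 0 <= A * (1 - cos (t - s)) by rewrite mulr_ge0// subr_ge0 cos_le1.
  have hx : h x = h (setc i t x) by rewrite setc_id.
  (* Three ranges of |t - s|: near 0, [h] varies little; up to 2 pi - r, 1 - cos is bounded below;
     beyond that the kernel peaks again, but both coordinates exceed pi / 2 in modulus, where [h]
     vanishes. *)
  have [ts|ts] := ltP `|t - s| r.
    rewrite ler_wpDr// /v hx; apply: dlP; first exact: setc_box.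
    apply: le_lt_trans (setc_diff_norm _ _ _ _) _; rewrite distrC.
    by apply: lt_le_trans ts _; rewrite ge_min lexx.
  have big : 1 - cos r <= 1 - cos (t - s) -> `|v s| <= e / 2 + A * (1 - cos (t - s)).
    move=> H; apply: (@le_trans _ _ (2 * M)).
      apply: le_trans (ler_normB _ _) _.
      by have := MP _ bx; have := MP _ (setc_box sp bx); lra.
    have cr' : 1 - cos r != 0 by rewrite gt_eqF.
    by rewrite -[leLHS](divfK cr') ler_wpDl ?(ltW e2)// ler_wpM2l.
  have [tsp|tsp] := leP `|t - s| pi; first by apply: big; exact: one_minus_cos_ge.
  have [tsr|tsr] := leP `|t - s| (2 * pi - r).
    apply: big; have := @one_minus_cos_ge R r (2 * pi - `|t - s|) r0.
    rewrite ger0_norm; last by lra.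
    rewrite (_ : cos (2 * pi - `|t - s|) = cos (t - s)); first by apply; lra.
    rewrite addrC cosD2pi_natl cosN.
    by have [_|_] := ger0P (t - s) => //; rewrite cosN.
  have h1 : pi / 2 < `|t| by have := ler_normB t s; lra.
  have h2 : pi / 2 < `|s| by have := ler_normB t s; lra.
  have hx0 : h x = 0 by apply: (hv _ i (leqnn _)).
  have hs0 : h (setc i s x) = 0 by apply: (hv _ i (leqnn _)); rewrite setcE eqxx.
  by rewrite /v hx0 hs0 subrr normr0 addr_ge0// ltW.
have E : Int (fun s => cosine_kernel n (t - s) * h (setc i s x)) (- pi) pi - cosine_mass R n * h x =
    Int (fun s => cosine_kernel n (t - s) * v s) (- pi) pi.
  rewrite -(_ : Int (fun s => cosine_kernel n (t - s)) (- pi) pi = cosine_mass R n); last first.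
    by rewrite Int_reflect// => s; rewrite /cosine_kernel cosD2pi_natl.
  rewrite mulrC -IntZ// -IntB; last 2 first.
  - exact: continuous_mul.
  - exact: continuous_mul.
  by congr Int; apply/funext => s; rewrite /v; ring.
have := cosine_kernel_approx_at n cv vb; rewrite -E => H.
have mn' : cosine_mass R n != 0 by rewrite gt_eqF.
rewrite (_ : _ / _ - _ = (Int (fun s => cosine_kernel n (t - s) * h (setc i s x)) (- pi) pi
   - cosine_mass R n * h x) / cosine_mass R n); last by field.
rewrite normrM normfV (gtr0_norm mn) ler_pdivrMr//; apply: le_trans H _.
rewrite mulrC ler_pM2r//.
have : A / n.+1%:R <= e / 2.
  by apply: le_trans (ltW nA); rewrite mulrC ler_wpM2l ?invr_ge0// lerDl.
by move=> q; rewrite [leRHS](_ : e = e / 2 + e / 2) ?lerD2l//; field.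
Qed.

Lemma kernel_sum_cvg c h (e : R) : Cs c h -> vanishes_from i h -> 0 < e ->
  \forall n \near \oo, \forall N \near \oo, forall x, box x ->
  `|iter c (pd i) h x - kernel_sum n N c h x| <= e.
Proof.
move=> Ch hv e0; have e2 : 0 < e / 2 by rewrite divr_gt0.
have [Ccont Cv] : continuous (iter c (pd i) h) /\ vanishes_from i (iter c (pd i) h).
  elim: c h Ch hv => [|c IH] h Ch hv; first by split=> //; exact: Cs_continuous Ch.
  rewrite iterSr; apply: IH; first by have [] := Ch.2 i.
  exact: pd_vanishes_from.
have := kernel_integral_cvg Ccont Cv e2; apply: filterS => n Hn.
have := kernel_sum_riemann n c (Cs_continuous Ch) e2; apply: filterS => N HN x bx.
have := Hn x bx; have := HN x bx.
have := @kernel_integral_parts n c 0 h x Ch hv; rewrite addn0 => ->.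
rewrite distrC; set I := Int _ _ _ / _ => h1 h2.
rewrite -(subrKA I) (_ : e = e / 2 + e / 2); last by field.
by apply: le_trans (ler_normD _ _) _; rewrite lerD// distrC.
Qed.

End kernel_operator.

(** * Approximation on one period cell *)

Section trigonometric_approximation.
Variables (R : realType) (d : nat).
Notation X := 'cV[R]_d.
Implicit Types (f g h : X -> R) (x y : X) (i j : 'I_d).

Lemma depends_from_sub k f g : depends_from k f -> depends_from k g ->
  depends_from k (fun x => f x - g x).
Proof. by move=> hf hg x y xy; rewrite (hf _ _ xy) (hg _ _ xy). Qed.

Lemma Cs_iter_pd c m i h : Cs (c + m) h -> Cs m (iter c (pd i) h).
Proof. by elim: c h => [//|c IH] h Ch; rewrite iterSr; apply: IH; have [] := Ch.2 i. Qed.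

Lemma iter_pd_depends_from c m i k h : Cs (c + m) h -> depends_from k h ->
  depends_from k (iter c (pd i) h).
Proof.
elim: c h => [//|c IH] h Ch hk; have [dh Cdh] := Ch.2 i.
by rewrite iterSr; apply: IH => //; exact: pd_depends_from.
Qed.

Lemma pd_sub j f g : (forall x, derivable f x (delta_mx j 0)) ->
  (forall x, derivable g x (delta_mx j 0)) ->
  pd j (fun x => f x - g x) = fun x => pd j f x - pd j g x.
Proof.
move=> df dg; have [dg' E] := pdZ (-1) dg.
rewrite (_ : (fun x => f x - g x) = fun x => f x + -1 * g x); last first.
  by apply/funext => x; rewrite mulN1r.
by rewrite (pdD df dg').2 E; apply/funext => x; rewrite mulN1r.
Qed.

(** Once the i-th axis has been differentiated, [jet_bound] only continues with indices at most i:
    the index i again, which raises [c], or a smaller one, along which both functions are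
    constant. *)
Lemma kernel_sum_jet_cvg m c i h (e : R) : Cs (c + m) h -> depends_from i h ->
  vanishes_from i h -> 0 < e ->
  \forall n \near \oo, \forall N \near \oo, forall x, (forall j, `|x j 0| <= pi) ->
  jet_bound m i.+1 (fun x => iter c (pd i) h x - kernel_sum i n N c h x) x e.
Proof.
move=> Ch hd hv e0; elim: m c Ch => [|m IH] c Ch.
  rewrite addn0 in Ch.
  by apply: filterS (kernel_sum_cvg Ch hv e0) => n; apply: filterS => N H x bx; split=> //; exact: H.
have Cc : Cs c h by apply: Cs_le Ch; rewrite leq_addr.
have C1 : Cs 1 h by apply: Cs_le Ch; rewrite addnS.
have := IH c.+1; rewrite addSnnS => /(_ Ch).
apply: filterS2 (kernel_sum_cvg Cc hv e0) => n.
apply: filterS2 => N H1 H2 x bx; split; first exact: H1.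
move=> j ji; have [dI _] := (Cs_iter_pd i Ch).2 j.
have [dS SE] := pd_kernel_sum i n N c (fun x => (C1.2 j).1 x).
rewrite pd_sub//.
have [ij|ij] := eqVneq j i.
  by rewrite SE ij eqxx; have := H2 x bx; rewrite iterS.
have ji' : (j < i)%N by rewrite ltn_neqAle -ltnS ji andbT -val_eqE in ij *.
have sd : depends_from i (fun x => iter c (pd i) h x - kernel_sum i n N c h x).
  apply: depends_from_sub; first exact: iter_pd_depends_from Ch hd.
  by apply: kernel_sum_depends => //; exact: hd.
have := (pd_depends_from0 sd ji').2; rewrite pd_sub// => ->.
by apply: jet_bound0; exact: ltW.
Qed.

Lemma kernel_sum_approx m k i h (e : R) : Cs m h -> depends_from i h -> vanishes_from i h -> 0 < e ->
  \forall n \near \oo, \forall N \near \oo, forall x, (forall j, `|x j 0| <= pi) ->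
  jet_bound m k (fun x => h x - kernel_sum i n N 0 h x) x e.
Proof.
move=> Ch hd hv e0; elim: m k h Ch hd hv => [|m IH] k h Ch hd hv.
  by apply: filterS (@kernel_sum_cvg R d i 0 h e Ch hv e0) => n; apply: filterS => N H x bx;
    split=> //; exact: H.
have C1 : Cs 1 h by apply: Cs_le Ch.
have C0 : Cs 0 h by apply: Cs_le Ch.
have Hd : \forall n \near \oo, forall j, \forall N \near \oo, forall x,
    (forall j, `|x j 0| <= pi) ->
    jet_bound m j.+1 (fun x => pd j h x - pd j (kernel_sum i n N 0 h) x) x e.
  apply: filter_forall => j; have [dh Cdh] := Ch.2 j.
  have SE n N := (pd_kernel_sum i n N 0 dh).2.
  have [ij|ij] := eqVneq j i.
    have := @kernel_sum_jet_cvg m 1 i h e Ch hd hv e0.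
    apply: filterS => n; apply: filterS => N H x bx.
    by rewrite SE ij eqxx; exact: H.
  have [ji|ji] := ltnP j i.
    apply: nearW => n; apply: nearW => N x bx.
    rewrite SE (negPf ij) (pd_depends_from0 hd ji).2.
    rewrite (_ : (fun x => _) = fun=> 0); first by apply: jet_bound0; exact: ltW.
    apply/funext => y; rewrite sub0r /kernel_sum big1 ?oppr0// => l _.
    by rewrite !mulr0.
  have := IH j.+1 (pd j h) Cdh (pd_depends_from dh hd) (pd_vanishes_from j hv).
  apply: filterS => n; apply: filterS => N H x bx.
  by rewrite SE (negPf ij); exact: H.
apply: filterS2 Hd (@kernel_sum_cvg R d i 0 h e C0 hv e0) => n /filter_forall.
apply: filterS2 => N H1 H2 x bx; split; first exact: H2.
move=> j jk; rewrite pd_sub; [exact: H1|exact: (Ch.2 j).1|].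
exact: (pd_kernel_sum i n N 0 (Ch.2 j).1).1.
Qed.

Lemma jet_bound_sum m k (I : Type) (s : seq I) (F : I -> X -> R) x (B : I -> R) :
  (forall l, Cs m (F l)) -> (forall l, jet_bound m k (F l) x (B l)) ->
  jet_bound m k (fun x => \sum_(l <- s) F l x) x (\sum_(l <- s) B l).
Proof.
move=> CF FB; elim: s => [|l s IH].
  rewrite big_nil (_ : (fun x => _) = fun=> 0); first exact: jet_bound0.
  by apply/funext => y; rewrite big_nil.
rewrite big_cons (_ : (fun x => _) = fun x => F l x + \sum_(l <- s) F l x); last first.
  by apply/funext => y; rewrite big_cons.
by apply: jet_bound_add => //; exact: Cs_sum.
Qed.

(** Induction on the number d - k of active coordinates. The kernel sum is trigonometric in
    coordinate k, and its coefficients are slices of [g] depending only on the later coordinates. *)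
Theorem trig_approximation m (k : nat) g (e : R) : Cs m g -> depends_from k g ->
  vanishes_from k g -> 0 < e ->
  exists2 t, trig t & forall x, (forall j, `|x j 0| <= pi) -> jet_bound m d (fun x => g x - t x) x e.
Proof.
move=> Cg gd gv; have [q] := ubnP (d - k); elim: q k g e Cg gd gv => // q IH k g e Cg gd gv dkq e0.
have [dk|kd] := leqP d k.
  exists (fun=> g 0); first exact: trig_cst.
  move=> x _; rewrite (_ : (fun x => _) = fun=> 0); first by apply: jet_bound0; exact: ltW.
  apply/funext => y; rewrite (gd y 0) ?subrr// => j kj.
  by have := leq_ltn_trans (leq_trans dk kj) (ltn_ord j); rewrite ltnn.
pose i := Ordinal kd.
have e2 : 0 < e / 2 by rewrite divr_gt0.
have [n Hn] := filter_ex (@kernel_sum_approx m d i g (e / 2) Cg gd gv e2).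
have [N HN] := filter_ex Hn.
pose K l x := cosine_kernel n (x i 0 - node R N l).
have tK l : trig (K l) by exact: trig_cosine_kernel.
have /choice[B BP] : forall l, exists B, forall x, jet_bound m d (K l) x B.
  by move=> l; exact: trig_jet_bounded.
pose w : R := `|node_step R N / cosine_mass R n|.
pose D := \sum_(l < N.+1) w * (2 ^+ m * B l).
have B0 l : 0 <= B l by exact: jet_bound_ge0 (BP l 0).
have D0 : 0 <= D by rewrite sumr_ge0// => l _; rewrite mulr_ge0 ?mulr_ge0 ?exprn_ge0 ?normr_ge0 ?B0.
(* D bounds the factor by which multiplication with the kernels and summation over the nodes amplify
   the errors of the slices. *)
have eD : 0 < e / 2 / (D + 1) by rewrite divr_gt0// ltr_wpDl.
pose h l x := g (setc i (node R N l) x).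
have Ch l : Cs m (h l) by exact: Cs_setc.
have /choice[t tP] : forall l, exists t, trig t /\ forall x, (forall j, `|x j 0| <= pi) ->
    jet_bound m d (fun x => h l x - t x) x (e / 2 / (D + 1)).
  move=> l; have [||||t tt tP] := IH k.+1 (h l) (e / 2 / (D + 1)) (Ch l); last by exists t.
  - move=> x y xy; apply: gd => j; rewrite leq_eqVlt !setcE => /predU1P[kj|kj].
      by rewrite (_ : j == i) //; apply/eqP/val_inj.
    by case: eqP => // _; exact: xy.
  - move=> x j kj xj; apply: (gv _ j (ltnW kj)); rewrite setcE.
    by case: eqP => // ji; move: kj; rewrite ji ltnn.
  - by rewrite -ltnS (leq_trans _ dkq)// ltnS subnS prednK// subn_gt0.
  - exact: eD.
exists (fun x => \sum_(l < N.+1) node_step R N / cosine_mass R n * (K l x * t l x)).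
  by apply: trig_sum => l; apply: trig_scale; apply: trig_mul => //; have [] := tP l.
move=> x bx; pose F (l : 'I_N.+1) x := node_step R N / cosine_mass R n * (K l x * (h l x - t l x)).
have Cht l : Cs m (fun x => h l x - t l x) by apply: Cs_sub => //; apply: Cs_trig; have [] := tP l.
have CK l : Cs m (K l) by exact: Cs_trig.
have CKht l : Cs m (fun x => K l x * (h l x - t l x)) by exact: Cs_mul.
have CF l : Cs m (F l) by exact: Cs_scale.
have jF (l : 'I_N.+1) : jet_bound m d (F l) x (w * (2 ^+ m * (B l * (e / 2 / (D + 1))))).
  apply: jet_bound_scale => //; apply: jet_bound_mul => //.
  by have [_] := tP l; exact.
rewrite (_ : (fun x => _) = fun x => (g x - kernel_sum i n N 0 g x) + \sum_(l < N.+1) F l x); last first.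
  apply/funext => y; rewrite -addrA; congr (_ + _); rewrite /kernel_sum -sumrN -sumrN -big_split/=.
  apply: eq_bigr => l _; rewrite /F /K /h coordBE; rewrite /cosine_kernel_jet /activation_jet /=; ring.
apply: (@jet_bound_le _ _ m m d d _ _ (e / 2 + \sum_(l < N.+1) w * (2 ^+ m * (B l * (e / 2 / (D + 1)))))) => //.
  rewrite [leRHS](_ : e = e / 2 + e / 2); last by field.
  rewrite lerD2l (_ : \sum_(l < _) _ = D * (e / 2 / (D + 1))); last first.
    by rewrite /D big_distrl/=; apply: eq_bigr => l _; ring.
  rewrite mulrCA ler_piMr ?(ltW e2)//.
  by rewrite ler_pdivrMr ?ltr_wpDl// mul1r lerDl.
apply: jet_bound_add; last 2 first.
- exact: HN.
- exact: jet_bound_sum.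
- by apply: Cs_sub => //; exact: Cs_kernel_sum.
- exact: Cs_sum.
Qed.

End trigonometric_approximation.

(** * Functions of compact support *)

Section compact_support.
Variables (R : realType) (d : nat).
Notation X := 'cV[R]_d.
Implicit Types (f g : X -> R) (x : X).

Lemma vanishing_jet_bounded m k g : Cs m g -> vanishes_from 0 g ->
  exists B, forall x, jet_bound m k g x B.
Proof.
elim: m k g => [|m IH] k g Cg gv.
  have [M M0 HM] := bounded_on_box (Cs_continuous Cg).
  exists M => x; split=> //; have [bx|] := pselect (forall j, `|x j 0| <= pi); first exact: HM.
  move=> /existsNP[j /negP]; rewrite -ltNge => xj.
  by rewrite (gv x j)// ?normr0// (lt_trans _ xj)//; have := pi_gt0 R; lra.
have [B0 HB0] := IH k g (CsS Cg) gv.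
have /choice[B HB] : forall i : 'I_d, exists B, forall x, jet_bound m i.+1 (pd i g) x B.
  by move=> i; apply: IH; [exact: (Cg.2 i).2|exact: pd_vanishes_from].
have B00 : 0 <= B0 := jet_bound_ge0 (HB0 0).
have Bi0 i : 0 <= B i := jet_bound_ge0 (HB i 0).
exists (B0 + \sum_i B i) => x; split.
  by apply: le_trans (jet_bound_norm (HB0 x)) _; rewrite lerDl sumr_ge0.
move=> i _; apply: jet_bound_le (HB i x) => //.
by rewrite (bigD1 i)//= addrCA lerDl addr_ge0// sumr_ge0.
Qed.

Lemma integer_translate (c : R) x : exists2 v : X, (forall i, v i 0 \is a Num.int) &
  forall i, `|(c *: x + (2 * pi) *: v) i 0| <= pi.
Proof.
have p0 := pi_gt0 R; have pp : 0 < 2 * pi :> R by rewrite mulr_gt0.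
exists (\col_i - (Num.floor ((c * x i 0 + pi) / (2 * pi)))%:~R) => i.
  by rewrite mxE rpredN intr_int.
rewrite !mxE; set t := _ * x i 0; set n := Num.floor _.
have := floor_le ((t + pi) / (2 * pi)); rewrite ler_pdivlMr// => h1.
have := floorD1_gt ((t + pi) / (2 * pi)); rewrite ltr_pdivrMr// intrD => h2.
rewrite -/n in h1 h2; rewrite ler_norml; lra.
Qed.

Theorem netapprox_compact_support psi m j (r : R) f : Abinfty psi -> Cs m f ->
  (forall x i, r < `|x i 0| -> f x = 0) -> netapprox psi m j.+1 f.
Proof.
move=> apsi Cf fr; have [cpsi _ _ _] := apsi; apply: netapprox_closed => // W e wW e0.
have p0 := pi_gt0 R; have [W1 Wle Woo] := wW.
have scaled S : 1 <= S -> r <= S * (pi / 2) ->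
    vanishes_from 0 (fun x => f (S *: x)) /\ f = (fun x => (fun y => f (S *: y)) (S^-1 *: x)).
  move=> S1 rS; have S0 : 0 < S by exact: lt_le_trans S1.
  split=> [x i _ xi|]; last by apply/funext => x; rewrite scalerA divff ?scale1r// gt_eqF.
  apply: (fr _ i); rewrite mxE normrM gtr0_norm//; apply: le_lt_trans rS _.
  by rewrite ltr_pM2l.
(* B bounds the jet of [f] itself and is fixed before the final period, so that it can be compared
   with the weight. *)
have [B fB] : exists B, forall x, jet_bound m d f x B.
  pose S := Num.max 1 (r / (pi / 2)).
  have S1 : 1 <= S by rewrite le_max lexx.
  have [|fv fE] := scaled S S1.
    by rewrite -ler_pdivrMr ?divr_gt0// le_max lexx orbT.
  have [B HB] := vanishing_jet_bounded d (Cs_dilation S Cf) fv.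
  exists B => x; rewrite fE; apply: (@jet_bound_dilation _ _ m d S^-1 (fun x => f (S *: x))) => //; first exact: Cs_dilation.
  by rewrite ger0_norm ?invr_ge0 ?invf_le1 ?(le_trans ler01)// (lt_le_trans ltr01).
have B0 : 0 <= B := jet_bound_ge0 (fB 0).
(* Outside of the cell, [f] contributes at most B to the error and the trigonometric polynomial at
   most B + e; the cell is made to contain the ball where the weight may be too small to absorb
   this. *)
have [q qP] := Woo ((2 * B + e) / e).
pose S := Num.max (Num.max 1 (r / (pi / 2))) (q / pi).
have S1 : 1 <= S by rewrite !le_max lexx.
have S0 : 0 < S by exact: lt_le_trans S1.
have Si : `|S^-1| <= 1 by rewrite ger0_norm ?invr_ge0 ?invf_le1// ltW.
have [|fv fE] := scaled S S1.
  by rewrite -ler_pdivrMr ?divr_gt0// !le_max lexx orbT.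
have qS : q <= S * pi by rewrite -ler_pdivrMr// le_max lexx orbT.
have fd : depends_from 0 (fun x => f (S *: x)).
  by move=> x y xy; congr (f (_ *: _)); apply/colP => i; exact: xy.
have [t tt tP] := trig_approximation (Cs_dilation S Cf) fd fv e0.
exists (fun x => t (S^-1 *: x)); first exact: netapprox_trig.
move=> x; have Ct := Cs_trig m tt.
have CT : Cs m (fun x => t (S^-1 *: x)) by exact: Cs_dilation.
have near x' : (forall i, `|(S^-1 *: x') i 0| <= pi) ->
    jet_bound m d (fun x => f x - t (S^-1 *: x)) x' e.
  move=> bx; rewrite [in X in jet_bound _ _ X]fE.
  apply: (@jet_bound_dilation _ _ m d S^-1 (fun x => f (S *: x) - t x)) => //.
    by apply: Cs_sub => //; exact: Cs_dilation.
  exact: tP.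
have [bx|] := pselect (forall i, `|(S^-1 *: x) i 0| <= pi).
  by apply: jet_bound_le (near x bx) => //; rewrite ler_peMr// ltW.
move=> /existsNP[i /negP]; rewrite -ltNge mxE normrM gtr0_norm ?invr_gt0// mulrC ltr_pdivlMr// => xi.
have [v vint vx] := integer_translate S^-1 x.
(* By periodicity the jet at [x] is the jet at a translate in the cell, where it is within e of that
   of [f]. *)
have TB : jet_bound m d (fun x => t (S^-1 *: x)) x (B + e).
  rewrite (_ : (fun x => _) = (fun x => t (S^-1 *: (x + (S * (2 * pi)) *: v)))); last first.
    apply/funext => y; rewrite scalerDr scalerA mulKf ?gt_eqF//.
    by rewrite trig_periodic.
  apply: (@jet_bound_translation _ _ m d _ (fun x => t (S^-1 *: x))) => //.
  set x' := x + _; rewrite (_ : (fun x => _) = (fun x => f x - (f x - t (S^-1 *: x)))); last first.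
    by apply/funext => y; rewrite subKr.
  apply: jet_bound_sub => //; first exact: Cs_sub.
  by apply: near => k; rewrite /x' scalerDr scalerA mulKf ?gt_eqF.
have := jet_bound_sub Cf CT (fB x) TB.
apply: jet_bound_le => //.
have : (2 * B + e) / e <= W `|x|.
  apply: qP; apply: le_trans qS _; apply: le_trans (coord_le_norm x i).
  by rewrite mulrC ltW.
by rewrite ler_pdivrMr// [W _ * e]mulrC (_ : B + (B + e) = 2 * B + e)//; ring.
Qed.

End compact_support.

(** * Cutoff functions *)

Section cutoff_functions.
Variable R : realType.
Implicit Types s t : R.

(* Iterated integrals of the positive part: ramp k is only of class C^k. *)
Fixpoint ramp (k : nat) : R -> R :=
  if k is l.+1 then Int (ramp l) 0 else fun t => Num.max 0 t.

Lemma ramp_continuous k : continuous (ramp k).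
Proof.
elim: k => [|k IH]; last exact: derivative_continuous (Int_deriv 0 IH).
apply: (@norm_lipschitz_continuous R _ _ _ 1) => // s t; rewrite mul1r /ramp.
have [s0|s0] := leP 0 s; have [t0|t0] := leP 0 t => //.
- rewrite subr0 ger0_norm// (le_trans _ (ler_norm _))//; lra.
- rewrite sub0r normrN ger0_norm// -normrN (le_trans _ (ler_norm _))//; lra.
- by rewrite subrr normr0.
Qed.

Lemma ramp_deriv k : is_deriv (ramp k.+1) (ramp k).
Proof. exact: Int_deriv (@ramp_continuous k). Qed.

Lemma ramp_neg k t : t <= 0 -> ramp k t = 0.
Proof.
elim: k t => [|k IH] t t0; first exact/max_idPl.
have cc : continuous (fun _ : R => 0 : R) by move=> ?; exact: cst_continuous.
have := Int_chasles (ramp k) 0 t 0; rewrite /= (@eq_Int _ (ramp k) (fun=> 0) t 0)//.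
- by rewrite Int_cst mul0r addr0 (IntE _ _ (Int_deriv 0 (@ramp_continuous k))) subrr => <-.
- exact: ramp_continuous.
- by move=> s /andP[_ s0]; exact: IH.
Qed.

Lemma ramp_gt0 k t : 0 < t -> 0 < ramp k t.
Proof.
have rampE : forall t, 0 <= t -> ramp k t = t ^+ k.+1 / k.+1`!%:R.
  elim: k => [|k IH] {}t t0; first by rewrite /= expr1 divr1; exact/max_idPr.
  have dP : is_deriv (fun s : R => s ^+ k.+2 / k.+2`!%:R) (fun s => s ^+ k.+1 / k.+1`!%:R).
    move=> s; have := @is_deriveX R R id k.+2 s 1 1 (is_derive_id _ _).
    move=> /(@is_deriveZ _ _ _ _ (k.+2`!%:R^-1)); rewrite /GRing.scale /= mulr1.
    rewrite (_ : k.+2`!%:R^-1 * (_ * _) = s ^+ k.+1 / k.+1`!%:R).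
      by rewrite (_ : _ \*: _ = (fun s => s ^+ k.+2 / k.+2`!%:R))//; apply/funext => z;
        rewrite /= exprfctE mulrC.
    rewrite [k.+2`!]factS natrM invfM mulrACA mulVf ?pnatr_eq0// mul1r.
    by rewrite mulrC.
  rewrite /= (@eq_Int _ (ramp k) (fun s => s ^+ k.+1 / k.+1`!%:R))//.
  - by rewrite (IntE _ _ dP) expr0n/= mul0r subr0.
  - exact: ramp_continuous.
  - by apply: continuous_mul => s; [exact: exprn_continuous|exact: cst_continuous].
  - by move=> s /andP[s0 _]; exact: IH.
by move=> t0; rewrite rampE ?ltW// divr_gt0 ?exprn_gt0 ?ltr0n ?fact_gt0.
Qed.

Variable d : nat.
Notation X := 'cV[R]_d.
Implicit Types (x : X) (f g : X -> R).

Lemma Cs_ramp m (f : X -> R) : Cs m f -> Cs m (fun x => ramp m (f x)).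
Proof.
elim: m f => [|m IH] f Cf; split=> //; try (by move=> x; apply: (@continuous_comp _ _ _ f (ramp _));
  [exact: (Cs_continuous Cf)|exact: ramp_continuous]).
move=> i; have [df Cdf] := Cf.2 i.
have [dp ->] := pd_comp (@ramp_deriv m) df; split=> //.
by apply: Cs_mul => //; apply: IH; exact: CsS.
Qed.

(** A ramp of 1 - |x|^2 is supported in the Euclidean unit ball, where all coordinates are at most 1
    <= pi / 2. *)
Lemma bump_exists m : exists2 f : X -> R, Cs m f & f 0 = 1 /\ vanishes_from 0 f.
Proof.
pose v (x : X) : R := 1 - \sum_(i < d) x i 0 * x i 0.
have Cv : Cs m v.
  apply: Cs_sub; first exact: Cs_cst.
  apply: Cs_sum => i; rewrite (_ : (fun x : X => _) =
    fun x => linear_form (delta_mx 0 i) 0 x * linear_form (delta_mx 0 i) 0 x); last first.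
    by apply/funext => x; rewrite /linear_form -rowE mxE addr0.
  by apply: Cs_mul; exact: Cs_linear_form.
exists (fun x => (ramp m 1)^-1 * ramp m (v x)); first exact/Cs_scale/Cs_ramp.
split=> [|x i _ xi].
  rewrite /v big1 ?subr0 ?mulVf ?gt_eqF ?ramp_gt0// => i _.
  by rewrite mxE mul0r.
rewrite (@ramp_neg m (v x)) ?mulr0//; rewrite /v (bigD1 i)//=.
have : 0 <= \sum_(j < d | j != i) x j 0 * x j 0 by apply: sumr_ge0 => j _; rewrite -expr2 sqr_ge0.
have x1 : 1 <= `|x i 0| by apply: le_trans (ltW xi); have := pi_ge2 R; lra.
have : 1 <= x i 0 * x i 0 by rewrite -expr2 -real_normK ?num_real// exprn_ege1.
lra.
Qed.

(** All cutoffs are dilates of one bump by factors at most 1, which do not increase derivatives;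
    hence [C] comes before [r0] and [e]. *)
Lemma cutoff_exists m : exists C : R, forall r0 e : R, 0 < e ->
  exists f : X -> R, exists r : R, [/\ Cs m f, forall x i, r < `|x i 0| -> f x = 0,
    forall x, jet_bound m d (fun x => 1 - f x) x C &
    forall x, `|x| <= r0 -> jet_bound m d (fun x => 1 - f x) x e].
Proof.
have [f Cf [f0 fv]] := bump_exists m.
have [B fB] := vanishing_jet_bounded d Cf fv.
have C1 : Cs m (fun _ : X => 1 : R) by exact: Cs_cst.
have C1f : Cs m (fun x => 1 - f x) by exact: Cs_sub.
have uB x : jet_bound m d (fun x => 1 - f x) x (1 + B).
  by apply: jet_bound_sub => //; apply: jet_bound_cst; rewrite normr1.
exists (1 + B) => r0 e e0.
have B0 : 0 <= 1 + B := jet_bound_ge0 (uB 0).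
have cu : continuous (fun x => 1 - f x) := Cs_continuous C1f.
have /cvgrPdist_le/(_ _ e0) := cu (0 : X).
rewrite f0 subrr => /nbhs_norm0P[dl /= dl0 Hdl].
(* The middle bound makes the derivatives of positive order, which carry a factor c, at most e; the
   last one sends the ball of radius [r0] to where the bump is within e of 1. *)
pose c : R := Num.min (Num.min 1 (e / (1 + B + 1))) (dl / (2 * (`|r0| + 1))).
have B1 : 0 < 1 + B + 1 by rewrite ltr_wpDl.
have r1 : 0 < `|r0| + 1 by rewrite ltr_wpDl.
have c0 : 0 < c by rewrite !lt_min ltr01 !divr_gt0// mulr_gt0.
have c1 : `|c| <= 1 by rewrite gtr0_norm// !ge_min lexx.
exists (fun x => f (c *: x)), (c^-1 * (pi / 2)); split.
- exact: Cs_dilation.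
- move=> x i xi; apply: (fv _ i) => //.
  by rewrite mxE normrM gtr0_norm// -ltr_pdivrMl.
- by move=> x; exact: (@jet_bound_dilation _ _ m d c _ x _ C1f).
move=> x xr; have ue : `|1 - f (c *: x)| <= e.
  rewrite -normrN -sub0r; apply: Hdl; rewrite /= normrZ gtr0_norm//.
  have cd : c <= dl / (2 * (`|r0| + 1)) by rewrite ge_min lexx orbT.
  have xr' : `|x| <= `|r0| + 1.
    by rewrite (le_trans xr)// (le_trans (ler_norm _))// lerDl.
  apply: le_lt_trans (ler_pM (ltW c0) (normr_ge0 _) cd xr') _.
  by rewrite (_ : _ / _ * _ = dl / 2); [lra|field; rewrite gt_eqF].
case: m Cf C1f C1 fB uB => [|m] Cf C1f C1 fB uB; split=> // i _.
have [du Cdu] := C1f.2 i.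
rewrite (pd_dilation c du).2.
have ju : jet_bound m i.+1 (fun x => pd i (fun x => 1 - f x) (c *: x)) x (1 + B).
  by apply: jet_bound_dilation => //; exact: (uB _).2.
apply: jet_bound_le (jet_bound_scale c (Cs_dilation c Cdu) ju) => //.
have ce : c <= e / (1 + B + 1) by rewrite !ge_min lexx orbT.
rewrite gtr0_norm//; apply: le_trans (ler_wpM2r B0 ce) _.
by rewrite mulrAC ler_pdivrMr// ler_pM2l// lerDl.
Qed.

(** The form needed for dominated convergence: off the ball the error is only bounded by a multiple
    of [G], with a constant that depends neither on the ball nor on the precision. *)
Theorem netfun_approx psi m j (g : X -> R) (G : X -> R) : Abinfty psi -> Cs m g ->
  (forall x, jet_bound m d g x (G x)) ->
  exists2 C : R, 0 <= C & forall (W : R -> R) (r0 e n : R), weight W -> 0 < e -> 0 < n ->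
    exists2 h, netfun psi j.+1 h & forall x, jet_bound m d (fun x => g x - h x) x
      ((if `|x| <= r0 then e else C) * G x + n * W `|x|).
Proof.
move=> apsi Cg gG; have [cpsi _ _ _] := apsi; have [C HC] := cutoff_exists m.
have C0 : 0 <= C.
  by have [f [r [_ _ fC _]]] := HC 0 1 ltr01; exact: jet_bound_ge0 (fC 0).
exists (2 ^+ m * C) => [|W r0 e n wW e0 n0]; first by rewrite mulr_ge0// exprn_ge0.
have p2 : 0 < 2 ^+ m :> R by rewrite exprn_gt0.
have e2 : 0 < e / 2 ^+ m by rewrite divr_gt0.
have [f [r [Cf fr fC fe]]] := HC r0 _ e2.
have Cfg : Cs m (fun x => f x * g x) by exact: Cs_mul.
have [|_ H] := @netapprox_compact_support R d psi m j r (fun x => f x * g x) apsi Cfg.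
  by move=> x i xi; rewrite (fr x i)// mul0r.
have [h hh hP] := H W n wW n0; exists h => // x.
apply: jet_bound_sub_trans (hP x) => //; first exact: Cs_netfun hh.
rewrite (_ : (fun x => _) = (fun x => (1 - f x) * g x)); last first.
  by apply/funext => y; rewrite mulrBl mul1r.
have C1f : Cs m (fun x => 1 - f x) by apply: Cs_sub => //; exact: Cs_cst.
case: ifP => xr.
  have := jet_bound_mul C1f Cg (fe x xr) (gG x).
  by rewrite mulrA [2 ^+ m * _]mulrC divfK// gt_eqF.
by rewrite -mulrA; apply: jet_bound_mul.
Qed.

End cutoff_functions.

(** * Network parameters *)

Section network_realization.
Variables (R : realType) (d : nat) (psi : R -> R).
Notation X := 'cV[R]_d.
Implicit Types (x : X) (f h : X -> R).

Lemma netfun_expansion j f : netfun psi j.+1 f -> exists (c : R) (s : seq (R * (X -> R))),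
  (forall l : 'I_(size s), netfun psi j (nth (0, fun=> 0) s l).2) /\
  forall x, f x = \sum_(l < size s) (nth (0, fun=> 0) s l).1 * psi ((nth (0, fun=> 0) s l).2 x) + c.
Proof.
move E : j.+1 => k nf; elim: nf j E => {k f} [//|k c|k c h f nh _ nf IH] j [kj].
  by exists c, [::]; split=> [[]//|x]; rewrite big_ord0 add0r.
have [c' [s [sP fE]]] := IH j (congr1 S kj); exists c', ((c, h) :: s); split=> [[[|l] ls]|x] /=.
- by rewrite kj.
- by have := sP (Ordinal (ls : (l < size s)%N)).
- by rewrite big_ord_recl fE addrA.
Qed.

(** Each component comes with its own neurons. The common layer is their disjoint union [T], and the
    weight matrix is zero between a component and the neurons of another one. *)
Lemma netfun_layer j n (F : 'I_n -> X -> R) : (forall a, netfun psi j.+1 (F a)) ->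
  exists (k : nat) (h : 'I_k -> X -> R) (Wb : 'M[R]_(n, k) * 'cV[R]_n),
    (forall i, netfun psi j (h i)) /\
    forall x, \col_a F a x = affine Wb (map_mx psi (\col_i h i x)).
Proof.
move=> nF; have /choice[c /choice[s sP]] := fun a => netfun_expansion (nF a).
pose T : finType := {a : 'I_n & 'I_(size (s a))}.
pose p (t : T) := nth (0, fun=> 0) (s (tag t)) (tagged t).
exists #|T|, (fun i => (p (enum_val i)).2),
  (\matrix_(a, i) ((tag (enum_val i) == a)%:R * (p (enum_val i)).1), \col_a c a).
split=> [i|x]; first by have [+ _] := sP (tag (enum_val i)); exact.
apply/colP => a; rewrite !mxE (sP a).2; congr (_ + _).
pose Phi (t : T) := (tag t == a)%:R * (p t).1 * psi ((p t).2 x).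
transitivity (\sum_(b < n) \sum_(l < size (s b)) Phi (Tagged (fun b => 'I_(size (s b))) l)).
  rewrite (bigD1 a)//= [X in _ + X]big1 ?addr0.
    by apply: eq_bigr => l _; rewrite /Phi eqxx mul1r.
  by move=> b /negPf ba; rewrite big1// => l _; rewrite /Phi /= ba !mul0r.
transitivity (\sum_(t : T) Phi t).
  by rewrite sig_big_dep; apply: eq_bigr => -[].
rewrite big_enum_val; apply: eq_bigr => i _; by rewrite !mxE.
Qed.

Lemma pid_padding k n (y : 'cV[R]_k) : (k <= n)%N ->
  (pid_mx k : 'M[R]_(k, n)) *m map_mx psi ((pid_mx k : 'M[R]_(k, n))^T *m y) = map_mx psi y.
Proof.
move=> kn; have entry (i : 'I_k) (v : 'cV[R]_n) : ((pid_mx k : 'M[R]_(k, n)) *m v) i 0 = v (widen_ord kn i) 0.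
  rewrite mxE (bigD1 (widen_ord kn i))//= big1 ?addr0.
    by rewrite mxE eqxx ltn_ord mul1r.
  move=> l li; rewrite mxE (_ : _ == _ :> nat = false) ?mul0r//.
  by apply/negbTE; apply: contraNneq li => il; apply/eqP/val_inj.
apply/colP => i; rewrite entry [in LHS]mxE [in RHS]mxE; congr psi.
rewrite mxE (bigD1 i)//= big1 ?addr0.
  by rewrite !mxE /= eqxx ltn_ord mul1r.
move=> l li; rewrite !mxE (_ : _ == _ :> nat = false) ?mul0r//.
by apply/negbTE; apply: contraNneq li => il; apply/eqP/val_inj.
Qed.

Definition pad k m n (Wb : 'M[R]_(k, m) * 'cV[R]_k) : 'M[R]_(n, m) * 'cV[R]_n :=
  ((pid_mx k)^T *m Wb.1, (pid_mx k)^T *m Wb.2).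

(* Zero padding: the extra neurons output psi 0, which the following layer ignores. *)
Lemma affine_pad k m n l (Wb : 'M[R]_(k, m) * 'cV[R]_k) (Vc : 'M[R]_(l, k) * 'cV[R]_l) z :
  (k <= n)%N -> affine (Vc.1 *m (pid_mx k : 'M[R]_(k, n)), Vc.2) (map_mx psi (affine (pad n Wb) z)) =
  affine Vc (map_mx psi (affine Wb z)).
Proof.
by move=> kn; rewrite /affine /pad /= -mulmxA -mulmxA -mulmxDr pid_padding.
Qed.

(** All hidden layers must share one width. Allowing every large [dW] lets the induction step widen
    the earlier layers to match the new one. *)
Lemma netfun_realization j n (F : 'I_n -> X -> R) : (forall a, netfun psi j.+1 (F a)) ->
  exists W0, forall dW, (W0 <= dW)%N ->
  exists (first : 'M[R]_(dW, d) * 'cV[R]_dW) (hid : seq ('M[R]_(dW, dW) * 'cV[R]_dW))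
    (last : 'M[R]_(n, dW) * 'cV[R]_n), size hid = j /\
    forall x, \col_a F a x = affine last (foldl (fun z Wb => map_mx psi (affine Wb z))
      (map_mx psi (affine first x)) hid).
Proof.
elim: j n F => [|j IH] n F nF; have [k [h [Vc [nh hE]]]] := netfun_layer nF.
  have /choice[w wP] : forall i, exists w : 'rV[R]_d * R, forall x, h i x = linear_form w.1 w.2 x.
    by move=> i; have [a [b ->]] := netfun0_inv (nh i) erefl; exists (a, b).
  exists k => dW kW.
  exists (pad dW (\matrix_i (w i).1, \col_i (w i).2)), [::], (Vc.1 *m pid_mx k, Vc.2).
  split=> // x; rewrite hE /= affine_pad//; congr (affine _ (map_mx _ _)).
  apply/colP => i; rewrite !mxE wP /linear_form mxE; congr (_ + _).
  by apply: eq_bigr => l _; rewrite !mxE.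
have [W0 HW0] := IH k h nh; exists (maxn W0 k) => dW; rewrite geq_max => /andP[W0W kW].
have [first [hid [last [hs lE]]]] := HW0 dW W0W.
exists first, (rcons hid (pad dW last)), (Vc.1 *m pid_mx k, Vc.2).
split=> [|x]; first by rewrite size_rcons hs.
by rewrite hE lE foldl_rcons affine_pad.
Qed.

Theorem netfun_nn L n (F : 'I_n -> X -> R) : (2 <= L)%N -> (forall a, netfun psi (L - 2).+1 (F a)) ->
  exists dW (theta : nn_params R d dW n L), (0 < dW)%N /\ forall x, nn psi theta x = \col_a F a x.
Proof.
move=> _ /netfun_realization[W0 /(_ W0.+1 (leqnSn _))[first [hid [last [hs E]]]]].
by exists W0.+1, (NNParams first (Tuple (introT eqP hs)) last); split=> // x; rewrite E.
Qed.

End network_realization.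

(** * The Sobolev norm *)

Section multi_indices.
Variables (R : realType) (d : nat).
Notation X := 'cV[R]_d.
Implicit Types (f : X -> R) (x : X) (s : seq 'I_d) (al : 'I_d -> nat).

Definition ipd al s f : X -> R := foldr (fun i h => iter (al i) (pd i) h) f s.

Lemma jet_bound_iter_pd c m k (i : 'I_d) f x (B : R) : (i < k)%N -> jet_bound (c + m) k f x B ->
  jet_bound m i.+1 (iter c (pd i) f) x B.
Proof.
elim: c k f => [|c IH] k f ik jf; first exact: jet_bound_le jf.
by rewrite iterSr; apply: (IH i.+1) => //; exact: jf.2.
Qed.

Lemma jet_bound_ipd al s m k f x (B : R) : pairwise (relpre val ltn) s ->
  (forall i, i \in s -> (i < k)%N) -> (\sum_(i <- s) al i <= m)%N ->
  jet_bound m k f x B -> `|ipd al s f x| <= B.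
Proof.
elim/last_ind: s m k f => [|s i IH] m k f ss sk sm jf; first exact: jet_bound_norm jf.
rewrite -cats1 big_cat big_seq1/= in sm.
move: ss; rewrite pairwise_rcons => /andP[/allP si ss].
rewrite /ipd foldr_rcons; apply: (IH (m - al i)%N i.+1) => //.
- by move=> j js; apply: ltnW; have := si j js.
- by rewrite leq_subRL 1?addnC// (leq_trans _ sm)// leq_addl.
apply: (@jet_bound_iter_pd _ _ k); first by apply: sk; rewrite mem_rcons mem_head.
by rewrite subnKC// (leq_trans _ sm)// leq_addl.
Qed.

Lemma eq_ipd al al' s f : {in s, al =1 al'} -> ipd al s f = ipd al' s f.
Proof.
elim: s => [//|i s IH] H; rewrite /ipd /= H ?mem_head//; congr (iter _ _).
by apply: IH => j js; apply: H; rewrite inE js orbT.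
Qed.

Lemma ipd_cat al s1 s2 f : ipd al (s1 ++ s2) f = ipd al s1 (ipd al s2 f).
Proof. exact: foldr_cat. Qed.

Lemma ipd0 al s f : {in s, forall i, al i = 0%N} -> ipd al s f = f.
Proof.
elim: s => [//|i s IH] H; rewrite /ipd /= H ?mem_head//=.
by apply: IH => j js; apply: H; rewrite inE js orbT.
Qed.

Lemma enum_ord_pairwise : pairwise (relpre val ltn) (enum 'I_d).
Proof. by rewrite -pairwise_map val_enum_ord -sorted_pairwise ?iota_ltn_sorted//; exact: ltn_trans. Qed.

(* Applying pd i first amounts to incrementing al i because no index above i occurs. *)
Lemma ipd_pd al (i : 'I_d) f : (forall j : 'I_d, (i < j)%N -> al j = 0%N) ->
  ipd al (enum 'I_d) (pd i f) = ipd (fun j => al j + (j == i))%N (enum 'I_d) f.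
Proof.
move=> ali; have /path.splitPr E := mem_enum 'I_d i.
have := enum_ord_pairwise; case: E => s1 s2.
rewrite pairwise_cat pairwise_cons => /and4P[/allrelP s12 _ /allP s2i _].
have h2 j : j \in s2 -> al j = 0%N /\ (j == i) = false.
  move=> js; have ij : (i < j)%N by exact: s2i.
  by split; [exact: ali|apply: contraTF ij => /eqP ->; rewrite ltnn].
have h1 j : j \in s1 -> (j == i) = false.
  move=> js; have : (j < i)%N by apply: s12 => //; rewrite mem_head.
  by apply: contraTF => /eqP ->; rewrite ltnn.
have cE al' g : ipd al' (i :: s2) g = iter (al' i) (pd i) (ipd al' s2 g) by [].
rewrite !ipd_cat !cE [ipd al s2 _]ipd0; last by move=> j /h2[].
rewrite [in RHS](ipd0 (s := s2)); last by move=> j /h2[-> ->].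
rewrite eqxx addn1 iterSr; apply: eq_ipd => j /h1 ->; by rewrite addn0.
Qed.

(** The decreasing strings of indices below [k] in [jet_bound] correspond to multi-indices supported
    below [k]; [ipd_pd] turns one more innermost derivative into an increment. *)
Lemma ipd_jet_bound m k f x (B : R) :
  (forall al, (forall i : 'I_d, (k <= i)%N -> al i = 0%N) -> (\sum_i al i <= m)%N ->
    `|ipd al (enum 'I_d) f x| <= B) -> jet_bound m k f x B.
Proof.
elim: m k f => [|m IH] k f H; (split;
  [by have := H (fun=> 0%N) (fun _ _ => erefl); rewrite big1// ipd0//; apply|]) => //.
move=> i ik; apply: IH => al ali alm; rewrite ipd_pd//.
apply: H => [j kj|]; last first.
  have E : (\sum_(j < d) (j == i) = 1)%N.
    by rewrite (bigD1 i)//= eqxx big1// => j /negPf ->.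
  by rewrite big_split/= E addn1.
have ij := leq_trans ik kj; rewrite ali// add0n.
by apply/eqP; rewrite eqb0; apply: contraTneq ij => ->; rewrite ltnn.
Qed.

End multi_indices.

Section vector_valued.
Variables (R : realType) (d n : nat).
Notation X := 'cV[R]_d.
Notation Y := 'cV[R]_n.
Implicit Types (f : X -> Y) (x : X) (a : 'I_n) (al : 'I_d -> nat).

Lemma col_norm_le (y : Y) (e : R) : 0 <= e -> (forall a, `|y a 0| <= e) -> `|y| <= e.
Proof.
move=> e0 H; rewrite [leLHS]/Num.Def.normr/= mx_normrE bigmax_le// => -[k l] _ /=.
by rewrite (ord1 l).
Qed.

Lemma continuous_components (V : normedModType R) (f : V -> Y) : continuous f <-> forall a, continuous (fun x : V => f x a 0).
Proof.
split=> [cf a x|cf x].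
  have cc : continuous (fun y : Y => y a 0).
    apply: (@norm_lipschitz_continuous R _ _ _ 1) => // y z; rewrite mul1r.
    rewrite (_ : y a 0 - z a 0 = (y - z) a 0); last by rewrite !mxE.
    by rewrite [leRHS]/Num.Def.normr/= mx_normrE; exact: (le_bigmax _ _ (a, 0)).
  by apply: (@continuous_comp _ _ _ f (fun y : Y => y a 0)); [exact: cf|exact: cc].
apply/cvgrPdist_le => e e0.
have : \forall y \near x, forall a, `|f x a 0 - f y a 0| <= e.
  by apply: filter_forall => a; have /cvgrPdist_le := cf a x; apply.
apply: filterS => y H; apply: col_norm_le (ltW e0) _ => a.
by rewrite !mxE; exact: H.
Qed.

Lemma derivable_components f x (v : X) : derivable f x v <->
  forall a, derivable (fun x => f x a 0) x v.
Proof.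
rewrite derivable_mxP; split=> [H a|H a b]; first exact: H.
by rewrite (ord1 b).
Qed.

Lemma partial_component f i a : (forall x, derivable f x (delta_mx i 0)) ->
  (fun x => partial i f x a 0) = pd i (fun x => f x a 0).
Proof. by move=> df; apply/funext => x; rewrite /partial derive_mx// mxE. Qed.

Lemma Cm_components m f : Cm m f <-> forall a, Cs m (fun x => f x a 0).
Proof.
elim: m f => [|m IH] f; split.
- by move=> [cf _] a; split=> //; move/continuous_components : cf.
- by move=> H; split=> //; apply/continuous_components => a; exact: (H a).1.
- move=> [cf H] a; split; first by move/continuous_components : cf.
  move=> i; have [df /IH Cdf] := H i; split; last by rewrite -partial_component.
  by move=> x; have /derivable_components := df x.
- move=> H; split; first by apply/continuous_components => a; exact: (H a).1.
  move=> i; have df x : derivable f x (delta_mx i 0).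
    by apply/derivable_components => a; exact: ((H a).2 i).1.
  by split=> //; apply/IH => a; rewrite partial_component//; exact: ((H a).2 i).2.
Qed.

Lemma Cm_iter_partial c m i f : Cm (c + m) f -> Cm m (iter c (partial i) f) /\
  forall a, (fun x => iter c (partial i) f x a 0) = iter c (pd i) (fun x => f x a 0).
Proof.
elim: c f => [//|c IH] f Cf; have [df Cdf] := Cf.2 i.
have [C1 E] := IH _ Cdf; rewrite iterSr; split=> // a.
by rewrite E iterSr partial_component.
Qed.

Lemma mpartial_component al m f : Cm m f -> (\sum_i al i <= m)%N ->
  Cm (m - \sum_i al i)%N (mpartial al f) /\
  forall a, (fun x => mpartial al f x a 0) = ipd al (enum 'I_d) (fun x => f x a 0).
Proof.
rewrite /mpartial -[index_enum _]enumT; elim/last_ind: (enum 'I_d) m f => [|s i IH] m f Cf.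
  by rewrite big_nil subn0.
rewrite -cats1 big_cat big_seq1/= => sm.
have am : (al i <= m)%N by rewrite (leq_trans _ sm)// leq_addl.
have [|C1 E1] := @Cm_iter_partial (al i) (m - al i)%N i f; first by rewrite subnKC.
have [|C2 E2] := IH _ _ C1; first by rewrite leq_subRL// addnC.
rewrite cats1 !foldr_rcons; split=> [|a]; first by rewrite addnC subnDA.
by rewrite E2 E1 /ipd foldr_rcons.
Qed.

Lemma norm2_ge_component (y : Y) a : `|y a 0| <= norm2 y.
Proof.
rewrite -sqrtr_sqr ler_wsqrtr// (bigD1 a)//= lerDl sumr_ge0// => b _.
exact: sqr_ge0.
Qed.

Lemma norm2_le_components (y : Y) (e : R) : (forall a, `|y a 0| <= e) -> norm2 y <= n%:R * e.
Proof.
move=> H; case: n y H => [|k] y H.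
  by rewrite /norm2 big_ord0 sqrtr0 mul0r.
have e0 : 0 <= e := le_trans (normr_ge0 _) (H ord0).
rewrite -[leRHS]ger0_norm ?mulr_ge0// -sqrtr_sqr ler_wsqrtr//.
rewrite (le_trans (_ : _ <= \sum_(a < k.+1) e ^+ 2))//.
  by apply: ler_sum => a _; rewrite -real_normK ?num_real// lerXn2r ?nnegrE.
rewrite sumr_const card_ord exprMn -[leLHS]mulr_natl ler_wpM2r ?sqr_ge0//.
by rewrite -natrX ler_nat leq_pmulr.
Qed.

Lemma norm2_continuous : continuous (@norm2 R n).
Proof.
move=> y; apply: continuous_comp; last exact: sqrt_continuous.
suff : continuous (fun y : Y => \sum_(i < n) y i 0 ^+ 2) by exact.
elim: (index_enum _) => [|a s IH] {}y.
  under eq_fun do rewrite big_nil; exact: cst_continuous.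
under eq_fun do rewrite big_cons.
apply: (@continuousD _ _ _ (fun y : Y => y a 0 ^+ 2)); last exact: IH.
apply: (@continuous_comp _ _ _ (fun y : Y => y a 0) (fun t => t ^+ 2)); last exact: exprn_continuous.
apply: (@norm_lipschitz_continuous R _ _ _ 1) => // z w; rewrite mul1r.
rewrite (_ : z a 0 - w a 0 = (z - w) a 0); last by rewrite !mxE.
by rewrite [leRHS]/Num.Def.normr/= mx_normrE; exact: (le_bigmax _ _ (a, 0)).
Qed.

End vector_valued.

(** * Integrable weights and dominated convergence *)

Section measure_estimates.
Variables (R : realType) (n : nat) (nu : {finite_measure set (borel_cV R n) -> \bar R}) (p : R).
Hypothesis p1 : 1 <= p.
Notation X := 'cV[R]_n.
Notation T := (borel_cV R n).

Let p0 : 0 <= p. Proof. exact: le_trans p1. Qed.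

Lemma continuous_borel (f : X -> R) : continuous f -> measurable_fun [set: T] (f : T -> R).
Proof.
move=> /continuousP cf; apply: (measurability _ (RGenOpens.measurableE R)).
move=> _ [_ [a [b ->] <-]]; rewrite setTI; apply: sub_sigma_algebra.
exact/cf/interval_open.
Qed.

Lemma norm_borel : measurable_fun [set: T] ((fun x : X => `|x|) : T -> R).
Proof. by apply: continuous_borel => x; exact: norm_continuous. Qed.

Lemma norm_homo_borel (W : R -> R) : {homo W : s t / s <= t} ->
  measurable_fun [set: T] ((fun x : X => W `|x|) : T -> R).
Proof.
move=> Wle; apply: (@measurableT_comp _ _ _ _ _ _ W _ ((fun x : X => `|x|) : T -> R)).
  exact: nondecreasing_measurable.
exact: norm_borel.
Qed.

Definition pint (f : T -> R) : Prop := [/\ measurable_fun [set: T] f, forall x, 0 <= f x &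
  (\int[nu]_x (f x `^ p)%:E < +oo)%E].

Lemma measurable_powR_fun (f : T -> R) : measurable_fun [set: T] f ->
  measurable_fun [set: T] (fun x => (f x `^ p)%:E).
Proof.
move=> mf; apply/measurable_EFinP.
exact: (measurableT_comp (measurable_powR p) mf).
Qed.

Lemma powR_add_le (a b : R) : 0 <= a -> 0 <= b -> (a + b) `^ p <= 2 `^ p * (a `^ p + b `^ p).
Proof.
wlog ab : a b / a <= b => [H a0 b0|a0 b0].
  have [ab|/ltW ba] := leP a b; first exact: H.
  by rewrite addrC [_ `^ p + _]addrC; exact: H.
apply: (@le_trans _ _ ((2 * b) `^ p)).
  apply: ge0_ler_powR => //; rewrite ?nnegrE ?addr_ge0 ?mulr_ge0//.
  by rewrite mulr_natl mulr2n lerD2r.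
by rewrite powRM// ler_wpM2l ?powR_ge0// lerDr powR_ge0.
Qed.

Lemma pint_add (f g : T -> R) : pint f -> pint g -> pint (fun x => f x + g x).
Proof.
move=> [mf f0 If] [mg g0 Ig]; have mfg : measurable_fun [set: T] (fun x => f x + g x).
  exact: measurable_funD.
split=> [//|x|]; first exact: addr_ge0.
have mfp := measurable_powR_fun mf; have mgp := measurable_powR_fun mg.
apply: (@le_lt_trans _ _ (\int[nu]_x ((2 `^ p)%:E * ((f x `^ p)%:E + (g x `^ p)%:E)))%E).
  apply: ge0_le_integral => //.
  - by move=> x _; rewrite lee_fin powR_ge0.
  - exact: measurable_powR_fun.
  - by apply: measurable_funeM; exact: emeasurable_funD.
  - by move=> x _; rewrite -EFinD -EFinM lee_fin powR_add_le.
have pos (h : T -> R) x : [set: T] x -> (0 <= (h x `^ p)%:E)%E by rewrite lee_fin powR_ge0.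
rewrite ge0_integralZl_EFin ?powR_ge0//; last 2 first.
- by move=> x _; rewrite -EFinD lee_fin addr_ge0// powR_ge0.
- exact: emeasurable_funD.
rewrite (ge0_integralD nu measurableT (@pos f) mfp (@pos g) mgp).
apply: lte_mul_pinfty; [by rewrite lee_fin powR_ge0|by []|exact: (lte_add_pinfty If Ig)].
Qed.

Lemma pint_scale (c : R) (f : T -> R) : 0 <= c -> pint f -> pint (fun x => c * f x).
Proof.
move=> c0 [mf f0 If]; split=> [|x|]; [exact: measurable_funM|exact: mulr_ge0|].
under eq_integral do rewrite powRM// EFinM.
have pos x : [set: T] x -> (0 <= (f x `^ p)%:E)%E by rewrite lee_fin powR_ge0.
rewrite (ge0_integralZl_EFin nu measurableT pos (measurable_powR_fun mf) (powR_ge0 c p)).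
by rewrite lte_mul_pinfty ?lee_fin ?powR_ge0.
Qed.

Lemma pint_sum (I : Type) (s : seq I) (P : pred I) (F : I -> T -> R) :
  (forall i, P i -> pint (F i)) -> pint (fun x => \sum_(i <- s | P i) F i x).
Proof.
move=> HF; elim: s => [|i s IH].
  rewrite (_ : (fun x => _) = fun=> 0); last by apply/funext => x; rewrite big_nil.
  split=> //; rewrite powR0 ?gt_eqF ?(lt_le_trans ltr01)// integral0; exact: ltry.
rewrite (_ : (fun x => _) = fun x => (if P i then F i x else 0) + \sum_(i <- s | P i) F i x).
  case Pi: (P i); first exact: (pint_add (HF i Pi) IH).
  by rewrite (_ : (fun x => _) = fun x => \sum_(i <- s | P i) F i x)//;
    apply/funext => x; rewrite add0r.
by apply/funext => x; rewrite big_cons; case: ifP => //; rewrite add0r.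
Qed.

Lemma cvg0_small (f : nat -> \bar R) (e : R) : f @ \oo --> 0%E -> 0 < e ->
  \forall k \near \oo, (f k < e%:E)%E.
Proof.
move=> /fine_cvgP[ff /cvgrPdist_lt H] e0; have {H} := H _ e0.
apply: filterS2 ff => k fk; rewrite sub0r normrN /= => fe.
by rewrite -(fineK fk) lte_fin (le_lt_trans (ler_norm _)).
Qed.

Let tail (k : nat) : set T := [set x : X | k%:R < `|x|].

Let measurable_tail k : measurable (tail k).
Proof.
have := norm_borel measurableT (@measurable_itv R `]k%:R, +oo[).
by rewrite setTI; congr measurable; apply/seteqP; split=> x; rewrite /= in_itv/= andbT.
Qed.

Lemma tail_small (e : R) : 0 < e -> \forall k \near \oo, (nu (tail k) < e%:E)%E.
Proof.
apply: cvg0_small; have i0 : \bigcap_k tail k = set0.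
  apply/seteqP; split=> // x /(_ (Num.truncn `|x|).+1 I).
  by rewrite /tail /= => /(lt_trans (truncnS_gt _)); rewrite ltxx.
have := @nonincreasing_cvg_mu _ _ _ nu tail; rewrite i0 measure0; apply => //.
- by rewrite ltey_eq fin_num_measure.
- by move=> k l kl; apply/subsetPset => x; apply: le_lt_trans; rewrite ler_nat.
Qed.

(** Finiteness of [nu] gives radii r k whose outer regions have measure below 2^-(k+1). Counting the
    radii passed by |x| yields a divergent step function of finite integral, and its p-th root is
    the weight. *)
Lemma integrable_weight : exists2 W : R -> R, weight W & pint (fun x : X => W `|x|).
Proof.
have /choice[r rP] : forall k, exists r : nat, (k <= r)%N /\ (nu (tail r) < (1 / (2 ^ k.+1)%:R)%:E)%E.
  move=> k; have e0 : 0 < 1 / (2 ^ k.+1)%:R :> R by rewrite divr_gt0// ltr0n expn_gt0.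
  have [N _ HN] := tail_small e0.
  by exists (maxn k N); split; [exact: leq_maxl|apply: HN; exact: leq_maxr].
pose b (k : nat) (t : R) : R := ((r k)%:R < t :> R)%R%:R.
(* Truncation keeps the count a finite real; it remains monotone and lies below the full series,
   which is what gets integrated. *)
pose U t : R := 1 + \sum_(0 <= k < (Num.truncn t).+1) b k t.
have b0 k t : 0 <= b k t by exact: ler0n.
have U1 t : 1 <= U t by rewrite lerDl sumr_ge0.
have U0 t : 0 <= U t by exact: le_trans (U1 t).
have ble k s t : s <= t -> b k s <= b k t.
  by move=> st; rewrite ler_nat; case: ltP => // /lt_le_trans /(_ st) ->.
have Ule : {homo U : s t / s <= t}.
  move=> s t st; rewrite lerD2l.
  rewrite [in leRHS](@big_cat_nat _ _ _ (Num.truncn s).+1)//=; last first.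
    by rewrite ltnS le_truncn.
  by rewrite ler_wpDr ?sumr_ge0// ler_sum// => k _; exact: ble.
have pinv : p^-1 * p = 1 by rewrite mulVf// gt_eqF// (lt_le_trans ltr01).
have WU t : (U t `^ p^-1) `^ p = U t by rewrite -powRrM pinv powRr1.
have pi0 : 0 <= p^-1 by rewrite invr_ge0.
have Wle : {homo (fun t => U t `^ p^-1) : s t / s <= t}.
  by move=> s t st; apply: ge0_ler_powR => //; rewrite ?nnegrE//; exact: Ule.
exists (fun t => U t `^ p^-1).
  split=> // [t|M].
    have -> : 1 = 1 `^ p^-1 :> R by rewrite powR1.
    by apply: ge0_ler_powR => //; rewrite ?nnegrE.
  pose q := (Num.truncn (`|M| `^ p)).+1.
  (* Beyond this threshold [t] has passed each of the first q radii, and the truncated sum contains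
     all their terms. *)
  exists ((\sum_(0 <= k < q) (r k).+1)%N + q)%:R => t qt.
  have qt' : q%:R <= t by apply: le_trans qt; rewrite ler_nat leq_addl.
  have Uq : q%:R <= U t.
    rewrite /U (@big_cat_nat _ _ _ q)//=; last first.
      by rewrite ltnW// ltnS truncn_ge_nat// (le_trans _ qt').
    rewrite addrCA ler_wpDr ?addr_ge0 ?sumr_ge0//.
    rewrite (_ : \sum_(0 <= k < q) _ = \sum_(0 <= k < q) 1).
      by rewrite sumr_const_nat subn0.
    apply: eq_big_nat => k /andP[_ kq]; rewrite /b (lt_le_trans _ qt)// ltr_nat.
    rewrite (leq_trans _ (leq_addr _ _))//.
    rewrite (bigD1_seq k) ?iota_uniq ?mem_index_iota//=.
    exact: leq_addr.
  apply: le_trans (ler_norm _) _.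
  rewrite -[X in X <= _]powRr1// -(mulfV (_ : p != 0)); last by rewrite gt_eqF// (lt_le_trans ltr01).
  rewrite powRrM; apply: ge0_ler_powR => //; rewrite ?nnegrE ?powR_ge0//.
  by apply: le_trans Uq; apply: ltW; exact: truncnS_gt.
split; [exact: (norm_homo_borel Wle)|by move=> x; exact: powR_ge0|].
under eq_integral do rewrite WU.
have mb k : measurable_fun [set: T] (fun x : T => (\1_(tail (r k)) x : R)%:E).
  by apply/measurable_EFinP; exact: measurable_indic.
apply: (@le_lt_trans _ _ (\int[nu]_x (1 + \sum_(0 <= k <oo) (\1_(tail (r k)) x : R)%:E))%E).
  apply: ge0_le_integral => //.
  - by move=> x _; rewrite lee_fin.
  - by apply/measurable_EFinP; exact: (norm_homo_borel Ule).
  - by apply: emeasurable_funD => //; apply: ge0_emeasurable_sum => // k x _ _; rewrite lee_fin.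
  - move=> x _; rewrite EFinD leeD2l// -sumEFin.
    rewrite [leLHS](_ : _ = (\sum_(0 <= k < (Num.truncn `|(x : X)|).+1) (\1_(tail (r k)) x : R)%:E)%E).
      by apply: nneseries_lim_ge => k _ _; rewrite lee_fin.
    apply: eq_bigr => k _; congr EFin; rewrite /b indicE; congr (nat_of_bool _)%:R.
    by apply/idP/idP; [move=> h; exact: mem_set|move=> /set_mem].
rewrite ge0_integralD//; last 2 first.
- by move=> x _; apply: nneseries_ge0 => k _ _; rewrite lee_fin.
- by apply: ge0_emeasurable_sum => // k x _ _; rewrite lee_fin.
rewrite integral_cst// mul1e integral_nneseries//.
apply: lte_add_pinfty; first by rewrite ltey_eq fin_num_measure.
apply: (@le_lt_trans _ _ 1%:E); last exact: ltry.
apply: le_trans (epsilon_trick0 xpredT ler01).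
apply: lee_nneseries => [k _ _|k _].
  by apply: integral_ge0 => x _; rewrite lee_fin.
by rewrite integral_indic// setIT ltW//; have [] := rP k.
Qed.

(** The relative size of the error in [netfun_approx] for radius k and precision 1 / (k + 1). *)
Definition shrink (k : nat) (x : X) : R := if `|x| <= k%:R then k.+1%:R^-1 else 1.

Lemma shrink_itv k x : 0 < shrink k x <= 1.
Proof. by rewrite /shrink; case: ifP; rewrite ?ltr01 ?lexx// invr_gt0 ltr0n invf_le1 ?ler1n. Qed.

Lemma pint_shrink (D : T -> R) (e : R) : pint D -> 0 < e ->
  exists k, measurable_fun [set: T] (fun x => shrink k x * D x) /\
    (\int[nu]_x ((shrink k x * D x) `^ p)%:E < e%:E)%E.
Proof.
move=> [mD D0 ID] e0.
have ms k : measurable_fun [set: T] (shrink k : T -> R).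
  rewrite (_ : shrink k = (fun x => (fun t : R => if t <= k%:R then k.+1%:R^-1 else 1) `|x|))//.
  apply: (@norm_homo_borel (fun t : R => if t <= k%:R then k.+1%:R^-1 else 1)) => s t st; case: ifPn => sk; case: ifPn => // tk.
    by rewrite invf_le1 ?ler1n.
  by rewrite (le_trans st tk) in sk.
have msD k : measurable_fun [set: T] (fun x => shrink k x * D x) by exact: measurable_funM.
have mDp := measurable_powR_fun mD.
have msp k : measurable_fun [set: T] (fun x => (shrink k x * D x `^ p)%:E).
  by apply/measurable_EFinP; apply: measurable_funM => //; exact/measurable_EFinP.
have iD : nu.-integrable [set: T] (fun x => (D x `^ p)%:E).
  apply/integrableP; split=> //; under eq_integral do rewrite gee0_abs ?lee_fin ?powR_ge0//.
  exact: ID.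
have cs x : (fun k => (shrink k x * D x `^ p)%:E) @ \oo --> (0 : \bar R)%E.
  apply: cvg_EFin; first by apply: nearW.
  apply/cvgrPdist_le => d d0.
  have D1 : 0 < D x `^ p + 1 by rewrite ltr_wpDl ?powR_ge0.
  have dD : 0 < d / (D x `^ p + 1) by rewrite divr_gt0.
  have := near_infty_natSinv_lt (PosNum dD); apply: filterS2 (nbhs_infty_ge (Num.truncn `|x : X|).+1).
  move=> k kx /=; rewrite ltr_pdivlMr// => kd.
  have xk : `|x| <= k%:R by apply: ltW; apply: lt_le_trans (truncnS_gt _) _; rewrite ler_nat.
  rewrite /shrink xk.
  rewrite sub0r normrN ger0_norm ?mulr_ge0 ?invr_ge0 ?powR_ge0//.
  by apply: le_trans (ltW kd); rewrite ler_wpM2l ?invr_ge0// lerDl.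
(* The factor is left outside of the power; as it is at most 1 and p >= 1, this dominates the
   integral in question. *)
have H : (fun k => \int[nu]_x (shrink k x * D x `^ p)%:E)%E @ \oo --> 0%E.
  rewrite -(@integral0 _ _ _ nu setT).
  apply: (@dominated_cvg _ _ _ nu setT measurableT _ (fun=> 0%E) (fun x => (D x `^ p)%:E)).
  - exact: msp.
  - by move=> x _; exact: cs.
  - by [].
  - exact: iD.
  - move=> k x _; have /andP[s0 s1] := shrink_itv k x.
    by rewrite gee0_abs lee_fin ?mulr_ge0 ?powR_ge0 ?(ltW s0)// ler_piMl ?powR_ge0.
have [k kP] := filter_ex (cvg0_small H e0).
exists k; split=> //; apply: le_lt_trans kP.
apply: ge0_le_integral => //.
- by move=> x _; rewrite lee_fin powR_ge0.
- exact: measurable_powR_fun.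
- move=> x _; have /andP[s0 s1] := shrink_itv k x.
  rewrite lee_fin powRM ?(ltW s0)// ler_wpM2r ?powR_ge0//.
  by rewrite ge1r_powR// s0.
Qed.

End measure_estimates.

Section sobolev_estimates.
Variables (R : realType) (din dout m : nat).
Notation X := 'cV[R]_din.
Notation Y := 'cV[R]_dout.
Implicit Types (f : X -> Y) (al : 'I_din -> nat).

Lemma mpartial0 f : mpartial (fun=> 0%N) f = f.
Proof. by rewrite /mpartial; elim: (enum _). Qed.

Definition multi_index (a : {ffun 'I_din -> 'I_m.+1}) : bool := (1 <= \sum_i a i <= m)%N.

(** One p-integrable function that dominates all derivatives of [g]; it plays the role of [G] in
    [netfun_approx]. *)
Definition jet_norm f (x : X) : R :=
  norm2 (f x) + \sum_(a : {ffun 'I_din -> 'I_m.+1} | multi_index a) norm2 (mpartial (fun i => a i : nat) f x).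

Lemma norm2_ge0 (y : Y) : 0 <= norm2 y. Proof. exact: sqrtr_ge0. Qed.

Lemma jet_norm_ge0 f x : 0 <= jet_norm f x.
Proof. by rewrite addr_ge0 ?norm2_ge0// sumr_ge0// => a _; exact: norm2_ge0. Qed.

Lemma jet_norm_ge f x al : (\sum_i al i <= m)%N -> norm2 (mpartial al f x) <= jet_norm f x.
Proof.
move=> alm; have [s0|s0] := posnP (\sum_i al i).
  have -> : al = fun=> 0%N.
    apply/funext => i; move/eqP: s0; rewrite sum_nat_eq0 => /forallP /(_ i) /eqP ->//.
  by rewrite mpartial0 lerDl sumr_ge0// => a _; exact: norm2_ge0.
have E i : al i = (inord (al i) : 'I_m.+1) :> nat.
  by rewrite inordK// ltnS (leq_trans _ alm)// (bigD1 i)//= leq_addr.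
pose a := [ffun i => inord (al i) : 'I_m.+1].
have aE : al = fun i => a i : nat by apply/funext => i; rewrite ffunE -E.
have ha : multi_index a.
  by rewrite /multi_index (_ : (\sum_i a i = \sum_i al i)%N) ?s0//; apply: eq_bigr => i _; rewrite ffunE -E.
rewrite {1}aE /jet_norm (bigD1 a)//= addrCA lerDl addr_ge0 ?norm2_ge0//.
by rewrite sumr_ge0// => b _; exact: norm2_ge0.
Qed.

Lemma jet_norm_jet_bound f x (a : 'I_dout) : Cm m f ->
  jet_bound m din (fun x => f x a 0) x (jet_norm f x).
Proof.
move=> Cf; apply: ipd_jet_bound => al _ alm.
have [_ E] := mpartial_component Cf alm.
by rewrite -E; apply: le_trans (norm2_ge_component _ _) (jet_norm_ge f x alm).
Qed.

Lemma mpartial_jet_bound f x (B : R) al : Cm m f -> (\sum_i al i <= m)%N ->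
  (forall a, jet_bound m din (fun x => f x a 0) x B) -> norm2 (mpartial al f x) <= dout%:R * B.
Proof.
move=> Cf alm jB; have [_ E] := mpartial_component Cf alm.
apply: norm2_le_components => a; have := congr1 (fun h => h x) (E a) => /= ->.
apply: jet_bound_ipd (jB a) => //; first exact: enum_ord_pairwise.
by rewrite big_enum.
Qed.

Lemma continuous_mpartial f al : Cm m f -> (\sum_i al i <= m)%N ->
  continuous (fun x => norm2 (mpartial al f x)).
Proof.
move=> Cf alm; have [CE _] := mpartial_component Cf alm.
have cf : continuous (mpartial al f) by case: (m - _)%N CE => [|l] [].
by move=> x; apply: (@continuous_comp _ _ _ (mpartial al f) (@norm2 R dout));
  [exact: cf|exact: norm2_continuous].
Qed.

Variables (nu : {finite_measure set (borel_cV R din) -> \bar R}) (p : R).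
Hypothesis p1 : 1 <= p.

Let p0 : 0 < p. Proof. exact: lt_le_trans p1. Qed.

Lemma pint_jet_norm f : Cmp nu m p f -> pint nu p (jet_norm f).
Proof.
move=> [Cf If].
have I0 h : (0 <= \int[nu]_x (norm2 (h x : Y) `^ p)%:E)%E.
  by apply: integral_ge0 => x _; rewrite lee_fin powR_ge0.
have {}If : (\int[nu]_x (norm2 (f x) `^ p)%:E
    + \sum_(a : {ffun 'I_din -> 'I_m.+1} | multi_index a)
        \int[nu]_x (norm2 (mpartial (fun i => a i : nat) f x) `^ p)%:E < +oo)%E.
  by apply: lty_poweRy If; rewrite invr_eq0 gt_eqF.
have cont al : (\sum_i al i <= m)%N ->
    measurable_fun [set: borel_cV R din] (fun x => norm2 (mpartial al f x)).
  by move=> alm; apply: (@continuous_borel R din); exact: continuous_mpartial.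
apply: pint_add => //.
  split.
  - by have := cont (fun=> 0%N); rewrite mpartial0; apply; rewrite big1.
  - by move=> x; exact: norm2_ge0.
  - by apply: le_lt_trans If; rewrite leeDl// sume_ge0.
apply: pint_sum => // a ha; split.
- by apply: cont; case/andP : ha.
- by move=> x; exact: norm2_ge0.
apply: le_lt_trans If; rewrite (bigD1 a)//= addeCA leeDl// adde_ge0// sume_ge0//.
Qed.

(** The norm consists of one integral per multi-index and one for order 0, and each receives an
    equal share of eps^p. *)
Lemma sobolev_norm_le f (D : borel_cV R din -> R) (eps : R) : Cm m f -> 0 < eps ->
  measurable_fun [set: borel_cV R din] D ->
  (forall al x, (\sum_i al i <= m)%N -> norm2 (mpartial al f x) <= D x) ->
  (\int[nu]_x (D x `^ p)%:E < (eps `^ p / (#|multi_index|.+1)%:R)%:E)%E ->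
  (sobolev_norm nu m p f <= eps%:E)%E.
Proof.
move=> Cf eps0 mD HD ID; set t := _ / _ in ID.
have I0 h : (0 <= \int[nu]_x (norm2 (h x : Y) `^ p)%:E)%E.
  by apply: integral_ge0 => x _; rewrite lee_fin powR_ge0.
have le al : (\sum_i al i <= m)%N -> (\int[nu]_x (norm2 (mpartial al f x) `^ p)%:E <= t%:E)%E.
  move=> alm; apply: le_trans (ltW ID); apply: ge0_le_integral => //.
  - by move=> x _; rewrite lee_fin powR_ge0.
  - apply: measurable_powR_fun; apply: (@continuous_borel R din); exact: continuous_mpartial.
  - exact: measurable_powR_fun.
  move=> x _; rewrite lee_fin; apply: ge0_ler_powR; rewrite ?nnegrE ?norm2_ge0 ?(ltW p0)//.
    by apply: le_trans (norm2_ge0 _) (HD al x alm).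
  exact: HD.
rewrite [leRHS](_ : _ = ((eps `^ p)%:E `^ p^-1)%E); last first.
  by rewrite poweR_EFin -powRrM mulfV ?gt_eqF// powRr1// ltW.
rewrite /sobolev_norm; set S := (_ + _)%E.
have S0 : (0 <= S)%E by rewrite adde_ge0// sume_ge0.
have SE : (S <= (eps `^ p)%:E)%E.
  apply: (@le_trans _ _ (t%:E + \sum_(a : {ffun 'I_din -> 'I_m.+1} | multi_index a) t%:E)%E).
    apply: leeD; first by have := le (fun=> 0%N); rewrite mpartial0; apply; rewrite big1.
    by apply: lee_sum => a /andP[_ am]; exact: le.
  by rewrite sumEFin -EFinD lee_fin big_const iter_addr_0 -mulrS -[t *+ _]mulr_natr /t divfK.
apply: gt0_ler_poweR => //; rewrite ?invr_ge0 ?(ltW p0)//.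
- by rewrite in_itv/= S0 leey.
- by rewrite in_itv/= lee_fin powR_ge0 leey.
Qed.

End sobolev_estimates.

Theorem theorem2 (R : realType) (din dout : nat)
    (nu : {finite_measure set (borel_cV R din) -> \bar R})
    (m : nat) (p : R) (hp : 1 <= p)
    (g : 'cV[R]_din -> 'cV[R]_dout) (hg : Cmp nu m p g)
    (psi : R -> R) (hpsi : Abinfty psi)
    (L : nat) (hL : (2 <= L)%N)
    (eps : R) (heps : 0 < eps) :
  exists (dW : nat) (theta : nn_params R din dW dout L),
    (0 < dW)%N /\
    (sobolev_norm nu m p (fun x => (g x - nn psi theta x)%R) <= eps%:E)%E.
Proof.
have [Cg _] := hg; have [cpsi _ _ _] := hpsi; have pG := pint_jet_norm hp hg.
pose G := jet_norm m g; have G0 x : 0 <= G x by exact: jet_norm_ge0.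
have [W wW pW] := integrable_weight nu hp; have [W1 _ _] := wW.
(* The constants are chosen before radius and precision, so that the majorant [D] below does not
   depend on [k]. *)
have /choice[C CP] : forall a, exists C, 0 <= C /\ forall (W : R -> R) (r0 e n : R),
    weight W -> 0 < e -> 0 < n -> exists2 h, netfun psi (L - 2).+1 h & forall x,
    jet_bound m din (fun x => g x a 0 - h x) x ((if `|x| <= r0 then e else C) * G x + n * W `|x|).
  move=> a; have [C C0 HC] := netfun_approx (L - 2) hpsi ((Cm_components m g).1 Cg a)
    (fun x => jet_norm_jet_bound x a Cg).
  by exists C.
have C0 a : 0 <= C a by have [] := CP a.
(* The sum of the [C a] covers every component outside of the ball, the added 1 covers the inside,
   and [dout] converts componentwise bounds into Euclidean ones. *)
pose D x := dout%:R * ((\sum_a C a + 1) * G x + W `|x|).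
have S0 : 0 <= \sum_a C a by apply: sumr_ge0.
have pD : pint nu p D.
  exact: (pint_scale (ler0n R dout) (pint_add hp (pint_scale (addr_ge0 S0 ler01) pG) pW)).
have e0 : 0 < eps `^ p / (#|@multi_index din m|.+1)%:R by rewrite divr_gt0// powR_gt0.
have [k [mk Ik]] := pint_shrink hp pD e0.
have k0 : 0 < k.+1%:R^-1 :> R by rewrite invr_gt0.
(* Radius k with both precisions 1 / (k + 1) makes the error of each component at most [shrink k x]
   times the second factor of [D x]. *)
have /choice[h hP] : forall a, exists h, netfun psi (L - 2).+1 h /\ forall x,
    jet_bound m din (fun x => g x a 0 - h x) x
      ((if `|x| <= k%:R then k.+1%:R^-1 else C a) * G x + k.+1%:R^-1 * W `|x|).
  move=> a; have [_ H] := CP a; have [h nh hP] := H W k%:R _ _ wW k0 k0.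
  by exists h.
have [dW [theta [dW0 tE]]] := netfun_nn hL (fun a => (hP a).1).
exists dW, theta; split=> //.
have E a x : (g x - nn psi theta x) a 0 = g x a 0 - h a x by rewrite tE !mxE.
have CE a : (fun x => (g x - nn psi theta x) a 0) = (fun x => g x a 0 - h a x) by apply/funext.
have Cs_h a : Cs m (h a) by apply: Cs_netfun cpsi (hP a).1.
apply: (sobolev_norm_le hp _ heps mk _ Ik).
  apply/Cm_components => a; rewrite CE; apply: Cs_sub => //.
  by move/Cm_components : Cg.
move=> al x alm; rewrite /D mulrCA.
apply: mpartial_jet_bound alm _.
  apply/Cm_components => a; rewrite CE; apply: Cs_sub => //.
  by move/Cm_components : Cg.
move=> a; rewrite CE; apply: jet_bound_le ((hP a).2 x) => //.
have W0 : 0 <= W `|x| by exact: le_trans (W1 _).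
have CS : C a <= \sum_a C a by rewrite (bigD1 a)//= lerDl sumr_ge0.
rewrite /shrink; case: ifP => _.
  by rewrite -mulrDr ler_wpM2l ?(ltW k0)// lerD2r ler_peMl// lerDr.
rewrite mul1r lerD//.
  by rewrite ler_wpM2r// (le_trans CS)// lerDl.
by rewrite ler_piMl// invf_le1// ler1n.
Qed.
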